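(* Let $\alpha,\beta,\gamma,\kappa,\tau,\ell,\xi$ be positive real numbers, and let $\mathcal{H}$ and $\mathcal{A}:\mathcal{D}(\mathcal{A})\subset\mathcal{H}\to\mathcal{H}$ be the Hilbert space and the operator defined in the context. For any initial datum $U_0\in\mathcal{H}$ there exists a unique solution $U\in\mathcal{C}([0,+\infty),\mathcal{H})$ of the problem $$U'(t)=\mathcal{A}U(t)\quad(t>0),\qquad U(0)=U_0 .$$ Moreover, if $U_0\in\mathcal{D}(\mathcal{A})$, then $U\in\mathcal{C}([0,+\infty),\mathcal{D}(\mathcal{A}))\cap\mathcal{C}^1([0,+\infty),\mathcal{H})$.
   Context: Let $\Omega=(0,\ell)$. All function spaces are real. Let $$\mathcal{H}=\left\{(f,g,p,h)\in H^1_0(\Omega)\times L^2(\Omega)\times L^2(\Omega\times(0,1))\times L^2(\Omega)\ :\ \int_\Omega h(x)\,dx=0\right\},$$ a Hilbert space with the inner product, for $U_k=(f_k,g_k,p_k,h_k)$, $k=1,2$, $$\langle U_1,U_2\rangle_{\mathcal{H}}=\int_\Omega\big(\alpha f_{1x}f_{2x}+g_1g_2+h_1h_2\big)\,dx+\xi\int_\Omega\int_0^1p_1(x,\rho)p_2(x,\rho)\,d\rho\,dx.$$ The operator $\mathcal{A}$ is defined by $$\mathcal{A}(u,v,z,\theta)=\Big(v,\ \big(\alpha z(\cdot,1)+\beta v_x\big)_x-\gamma\theta_x,\ -\tfrac1\tau z_\rho,\ -\gamma v_x+\kappa\theta_{xx}\Big)$$ with domain $\mathcal{D}(\mathcal{A})$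 consisting of all $(u,v,z,\theta)\in\mathcal{H}\cap\big[H^1_0(\Omega)\times H^1_0(\Omega)\times L^2(\Omega;H^1(0,1))\times H^2(\Omega)\big]$ such that $z(\cdot,0)=u_x$, $\alpha z(\cdot,1)+\beta v_x\in H^1(\Omega)$ and $\theta_x(0)=\theta_x(\ell)=0$; $\mathcal{D}(\mathcal{A})$ carries the graph norm. Here $z=z(x,\rho)$ with $x\in\Omega$, $\rho\in(0,1)$, and subscripts $x,\rho$ denote partial derivatives. This is the first-order form, with $U=(u,u_t,z,\theta)$, $z(x,\rho,t)=u_x(x,t-\tau\rho)$ and $U_0=(u_0,u_1,f_0(\cdot,-\,\cdot\,\tau),\theta_0)$, of the delayed thermoelastic system $u_{tt}(x,t)-\alpha u_{xx}(x,t-\tau)-\beta u_{xxt}(x,t)+\gamma\theta_x(x,t)=0$, $\theta_t-\kappa\theta_{xx}+\gamma u_{xt}=0$ in $\Omega\times(0,\infty)$ with $u=0$ and $\theta_x=0$ at $x=0,\ell$, initial data $u(\cdot,0)=u_0$, $u_t(\cdot,0)=u_1$, $\theta(\cdot,0)=\theta_0$, and history $u_x(x,t-\tau)=f_0(x,t-\tau)$ for $t\in(0,\tau)$. For $U_0\in\mathcal{H}$, ''solution'' is understood in the usual semigroup (mild) sense: $U\in\mathcal{C}([0,+\infty),\mathcal{H})$ with $\int_0^tU(s)\,ds\in\mathcal{D}(\mathcal{A})$ and $U(t)=U_0+\mathcal{A}\int_0^tU(s)\,ds$ for all $t\ge0$. *)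

(* Defs.v *)
From mathcomp Require Import all_boot all_order all_algebra.
From mathcomp Require Import all_classical all_reals all_analysis.

Set Implicit Arguments.
Unset Strict Implicit.
Unset Printing Implicit Defensive.

Import Order.TTheory GRing.Theory Num.Theory.
Import numFieldNormedType.Exports.

Local Open Scope classical_set_scope.
Local Open Scope ring_scope.

(* Elements of L^2, H^1, etc. are represented by everywhere-defined functions,
   whose values outside the domain are irrelevant; two representatives denote
   the same element when they agree a.e. on the domain (see [Heq]). *)

Section Sobolev.
Context {R : realType}.
Local Notation mu := (@lebesgue_measure R).

Definition L2 d (T : measurableType d) (m : {measure set T -> \bar R})
  (D : set T) (f : T -> R) : Prop := f \_ D \in Lfun m 2%:E.

(* Test functions are taken in C^1_c(]a, b[), as in Brezis' one-dimensional
   Sobolev theory. The closure below is bounded, hence compact, as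
   soon as it lies in ]a, b[. *)
Definition test_fun (a b : R) (phi : R -> R) : Prop :=
  [/\ forall x : R, derivable phi x 1, continuous (derive1 phi) &
      closure [set x | phi x != 0] `<=` `]a, b[].

Definition weak_derivative (a b : R) (f g : R -> R) : Prop :=
  [/\ L2 mu `]a, b[ f, L2 mu `]a, b[ g &
      forall phi, test_fun a b phi ->
        \int[mu]_(x in `]a, b[) (f x * derive1 phi x) =
        - \int[mu]_(x in `]a, b[) (g x * phi x)].

Definition H1 (a b : R) (f : R -> R) : Prop :=
  exists g, weak_derivative a b f g.

(* Weak derivatives are unique up to a.e. equality: this picks one, and is
   meaningful only for [f] in [H1 a b]. *)
Definition wderiv (a b : R) (f : R -> R) : R -> R :=
  xget (fun=> 0) [set g | weak_derivative a b f g].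

Definition H1norm (a b : R) (f : R -> R) : R :=
  Num.sqrt (\int[mu]_(x in `]a, b[) (f x ^+ 2 + wderiv a b f x ^+ 2)).

(* the closure of the test functions in H^1 *)
Definition H10 (a b : R) (f : R -> R) : Prop :=
  H1 a b f /\
  forall e : R, 0 < e -> exists2 phi, test_fun a b phi & H1norm a b (f \- phi) < e.

Definition H2 (a b : R) (f : R -> R) : Prop :=
  H1 a b f /\ H1 a b (wderiv a b f).

(* [y] is the value at [c] in [a, b] of the representative of [f] that is
   continuous on [a, b] *)
Definition point_value (a b : R) (f : R -> R) (c y : R) : Prop :=
  exists g : R -> R, [/\ {within `[a, b], continuous g},
    f = g %[ae mu in `]a, b[%classic] & g c = y].

End Sobolev.

Section Rectangle.
Context {R : realType} (l : R).
Local Notation mu := (@lebesgue_measure R).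

Definition L2rect (z : R * R -> R) : Prop :=
  L2 (mu \x mu)%E (`]0, l[ `*` `]0, 1[) z.

(* [w] is the partial derivative of [z] with respect to the second variable,
   in the sense of L^2(]0, l[; H^1(0, 1)) *)
Definition weak_rho_derivative (z w : R * R -> R) : Prop :=
  [/\ L2rect z, L2rect w &
      {ae mu, forall x, `]0, l[%classic x ->
        weak_derivative 0 1 (fun rho => z (x, rho)) (fun rho => w (x, rho))}].

Definition L2H1 (z : R * R -> R) : Prop :=
  exists w, weak_rho_derivative z w.

Definition wderiv_rho (z : R * R -> R) : R * R -> R :=
  xget (fun=> 0) [set w | weak_rho_derivative z w].

(* [w] is z(., rho), for rho in [0, 1] *)
Definition is_trace (z : R * R -> R) (rho : R) (w : R -> R) : Prop :=
  L2 mu `]0, l[ w /\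
  {ae mu, forall x, `]0, l[%classic x ->
    point_value 0 1 (fun r => z (x, r)) rho (w x)}.

Definition trace (z : R * R -> R) (rho : R) : R -> R :=
  xget (fun=> 0) [set w | is_trace z rho w].

End Rectangle.

Section SeminormedCurves.
Context {R : realType} {V : lmodType R} (N : V -> R).
Implicit Types U : R -> V.

Definition continuous_curve U : Prop :=
  forall t : R, 0 <= t ->
    N (U s - U t) @[s --> within `[0, +oo[ (nbhs t)] --> (0 : R).

(* the derivative is one-sided at t = 0 *)
Definition derivative_curve U (U' : R -> V) : Prop :=
  forall t : R, 0 <= t ->
    N ((s - t)^-1 *: (U s - U t) - U' t)
      @[s --> within (`[0, +oo[ `\ t) (nbhs t)] --> (0 : R).

(* W is the Riemann integral of U over [0, t] *)
Definition is_integral U (t : R) (W : V) : Prop :=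
  forall e : R, 0 < e -> exists2 d : R, 0 < d &
    forall (n : nat) (s c : nat -> R),
      s 0%N = 0 -> s n = t ->
      (forall i, (i < n)%N ->
        [/\ s i <= c i, c i <= s i.+1 & s i.+1 - s i < d]) ->
      N (\sum_(i < n) (s i.+1 - s i) *: U (c i) - W) < e.

End SeminormedCurves.

Section Problem.
Context {R : realType}.
Variables (alpha beta gamma kappa tau l xi : R).
Local Notation mu := (@lebesgue_measure R).
Local Notation Omega := (`]0, l[%classic : set R).
Local Notation D := (wderiv 0 l).

Definition state : Type :=
  ((R -> R) * (R -> R) * (R * R -> R) * (R -> R))%type.

Definition inH (U : state) : Prop :=
  let: (f, g, p, h) := U in
  [/\ H10 0 l f, L2 mu Omega g, L2rect l p, L2 mu Omega h &
      \int[mu]_(x in Omega) h x = 0].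

Definition Heq (U1 U2 : state) : Prop :=
  let: (f1, g1, p1, h1) := U1 in let: (f2, g2, p2, h2) := U2 in
  [/\ f1 = f2 %[ae mu in Omega], g1 = g2 %[ae mu in Omega],
      p1 = p2 %[ae (mu \x mu)%E in Omega `*` `]0, 1[] &
      h1 = h2 %[ae mu in Omega]].

Definition Hip (U1 U2 : state) : R :=
  let: (f1, g1, p1, h1) := U1 in let: (f2, g2, p2, h2) := U2 in
  \int[mu]_(x in Omega) (alpha * (D f1 x * D f2 x) + g1 x * g2 x + h1 x * h2 x)
  + xi * \int[mu]_(x in Omega) \int[mu]_(rho in `]0, 1[)
           (p1 (x, rho) * p2 (x, rho)).

Definition Hnorm (U : state) : R := Num.sqrt (Hip U U).

Definition flux (v : R -> R) (z : R * R -> R) : R -> R :=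
  fun x => alpha * trace l z 1 x + beta * D v x.

Definition inDA (U : state) : Prop :=
  let: (u, v, z, theta) := U in
  inH U /\
  [/\ H10 0 l u, H10 0 l v, L2H1 l z & H2 0 l theta] /\
  [/\ is_trace l z 0 (D u), H1 0 l (flux v z),
      point_value 0 l (D theta) 0 0 & point_value 0 l (D theta) l 0].

Definition A (U : state) : state :=
  let: (u, v, z, theta) := U in
  (v,
   fun x => D (flux v z) x - gamma * D theta x,
   fun q => - tau^-1 * wderiv_rho l z q,
   fun x => - gamma * D v x + kappa * D (D theta) x).

Definition graph_norm (U : state) : R := Hnorm U + Hnorm (A U).

Definition solution (U0 : state) (U : R -> state) : Prop :=
  [/\ forall t : R, 0 <= t -> inH (U t),
      continuous_curve Hnorm U &
      forall t : R, 0 <= t -> exists W : state,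
        [/\ is_integral Hnorm U t W, inDA W & Heq (U t) (U0 + A W)]].

Definition continuous_in_DA (U : R -> state) : Prop :=
  (forall t : R, 0 <= t -> inDA (U t)) /\ continuous_curve graph_norm U.

Definition C1_in_H (U : R -> state) : Prop :=
  (forall t : R, 0 <= t -> inH (U t)) /\
  exists U' : R -> state,
    [/\ forall t : R, 0 <= t -> inH (U' t), derivative_curve Hnorm U U' &
        continuous_curve Hnorm U'].

End Problem.

(* Main.v *)
(** Elements of H^1_0 are written as primitives of mean-zero L^2 functions, so
    that (u, v, z, theta) becomes (w, v, z, theta) with u_x = w and A becomes a
    relation between square-integrable functions in which only primitives occur.

    The inner product of H is replaced by the equivalent one whose delay term has
    weight 2 tau alpha^2 / beta instead of xi. There A is quasi-dissipative: the
    thermal coupling cancels, the transport equation in rho contributes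
    (alpha^2 / beta) (|u_x|^2 - |z(., 1)|^2), and -alpha <z(., 1), v_x> is absorbed
    by the viscosity -beta |v_x|^2 and the outflow -|z(., 1)|^2. Solving the
    transport equation explicitly turns the resolvent equation into a system for
    v_x and theta_x that is an accretive bounded perturbation of the identity,
    hence solvable.

    A quasi-m-dissipative operator generates a semigroup: implicit Euler schemes
    with halved steps converge for data in D(A^2), then for all data by density.
    Uniqueness follows by comparing the primitive of a solution with the implicit
    Euler scheme. *)

(* Function spaces consist of everywhere-defined representatives and no quotient is taken, so every
   norm is a seminorm. Hence operators are relations, single-valued up to null vectors, and a limit
   of points of the domain may need a null correction before the operator applies to it. Writing u
   as a primitive turns integration by parts into one Fubini identity on a triangle: on mean-zero
   functions the primitive is skew-adjoint. The boundary conditions on u, v and theta_x become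
   mean-zero conditions, and these annihilate the integration constants. With m = v_x, Young's
   inequality gives alpha |<z(., 1), m>| <= (alpha^2/beta) |z(., 1)|^2 + (beta/4) |m|^2. An outflow
   with factor alpha^2/beta absorbs the first term: this is the origin of the weight 2 tau
   alpha^2/beta. All estimates are made for that inner product, and curves are carried over to the
   one with weight xi at the end. *)
Require Import Defs.
From HB Require Import structures.
From mathcomp Require Import all_boot all_order all_algebra.
From mathcomp Require Import all_classical all_reals all_analysis.
From mathcomp Require Import measurable_realfun ring lra.

Set Implicit Arguments.
Unset Strict Implicit.
Unset Printing Implicit Defensive.

Import Order.TTheory GRing.Theory Num.Theory.
Import numFieldNormedType.Exports.

Local Open Scope classical_set_scope.
Local Open Scope ring_scope.

(** * Linear combinations in a module: identities by reflection *)

Section LinearCombinations.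
Variables (R : comNzRingType) (E : lmodType R).

Inductive mexp :=
  | MZero | MVar of nat | MAdd of mexp & mexp | MOpp of mexp
  | MScale of R & mexp.

Fixpoint meval (env : seq E) e : E :=
  match e with
  | MZero => 0
  | MVar i => nth 0 env i
  | MAdd e1 e2 => meval env e1 + meval env e2
  | MOpp e1 => - meval env e1
  | MScale a e1 => a *: meval env e1
  end.

(** [eqn] replaces [==] so that the restricted [cbv] call of [module_eq] computes the test on
    concrete indices. *)
Fixpoint mcoef e (i : nat) : R :=
  match e with
  | MZero => 0
  | MVar j => if eqn i j then 1 else 0
  | MAdd e1 e2 => mcoef e1 i + mcoef e2 i
  | MOpp e1 => - mcoef e1 i
  | MScale a e1 => a * mcoef e1 i
  end.

Lemma meval_sum env e :
  meval env e = \sum_(i < size env) mcoef e i *: nth 0 env i.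
Proof.
elim: e => [|j|e1 IH1 e2 IH2|e1 IH1|a e1 IH1] /=.
- by rewrite big1 // => i _; rewrite scale0r.
- case: (ltnP j (size env)) => hj.
    rewrite (bigD1 (Ordinal hj)) //= eqnE eqxx scale1r big1 ?addr0 // => i /eqP hi.
    case: ifP => [/eqP ij|_]; last by rewrite scale0r.
    by case: hi; apply: val_inj.
  rewrite nth_default // big1 // => i _.
  case: ifP => [/eqP ij|_]; last by rewrite scale0r.
  by move: (ltn_ord i); rewrite ij ltnNge hj.
- by rewrite IH1 IH2 -big_split; apply: eq_bigr => i _; rewrite scalerDl.
- by rewrite IH1 -sumrN; apply: eq_bigr => i _; rewrite scaleNr.
- by rewrite IH1 scaler_sumr; apply: eq_bigr => i _; rewrite scalerA.
Qed.

(** A conjunction unfolded by recursion: for a concrete environment it splits into one scalar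
    identity per atom. *)
Fixpoint mcoef_eq n e1 e2 : Prop :=
  match n with
  | 0%N => True
  | n.+1 => mcoef e1 n = mcoef e2 n /\ mcoef_eq n e1 e2
  end.

Lemma meval_eq env e1 e2 : mcoef_eq (size env) e1 e2 ->
  meval env e1 = meval env e2.
Proof.
move=> h; rewrite !meval_sum; apply: eq_bigr => i _; congr (_ *: _).
elim: (size env) h i => [_ []//|n IH /= [h1 h2] i].
have [hi|hi] := ltnP i n; first exact: (IH h2 (Ordinal hi)).
by have -> : val i = n by apply/eqP; rewrite eqn_leq hi -ltnS ltn_ord.
Qed.

End LinearCombinations.

Ltac mod_mem x l :=
  lazymatch l with
  | nil => constr:(false)
  | x :: _ => constr:(true)
  | _ :: ?l' => mod_mem x l'
  end.

Ltac mod_atoms t l :=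
  lazymatch t with
  | (?a + ?b)%R => let l1 := mod_atoms a l in mod_atoms b l1
  | (- ?a)%R => mod_atoms a l
  | (?k *: ?a)%R => mod_atoms a l
  | 0%R => l
  | ?x => lazymatch mod_mem x l with true => l | false => constr:(x :: l) end
  end.

Ltac mod_index x l :=
  lazymatch l with
  | x :: _ => constr:(0%N)
  | _ :: ?l' => let i := mod_index x l' in constr:(S i)
  end.

Ltac mod_reify R t l :=
  lazymatch t with
  | (?a + ?b)%R => let u := mod_reify R a l in let v := mod_reify R b l in
      constr:(MAdd u v)
  | (- ?a)%R => let u := mod_reify R a l in constr:(MOpp u)
  | (?k *: ?a)%R => let u := mod_reify R a l in constr:(@MScale R k u)
  | 0%R => constr:(MZero R)
  | ?x => let i := mod_index x l in constr:(MVar R i)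
  end.

(* Decides identities between linear combinations in an lmodType, up to
   [field] identities between the coefficients. *)
Ltac module_eq R :=
  lazymatch goal with
  | |- @eq ?T ?t1 ?t2 =>
    let l1 := mod_atoms t1 (@nil T) in
    let l := mod_atoms t2 l1 in
    let e1 := mod_reify R t1 l in
    let e2 := mod_reify R t2 l in
    apply: (@meval_eq _ _ l e1 e2);
    cbv [mcoef_eq size mcoef eqn]; do ?split; try (by []); try ring; try (by field)
  end.

(** * Complete semi-inner product spaces *)

Lemma le_eps (R : realType) (x y : R) :
  (forall e : R, 0 < e -> x <= y + e) -> x <= y.
Proof. by move=> h; apply/ler_addgt0Pr. Qed.

Section SemiHilbert.
Variables (R : realType) (E : lmodType R) (ip : E -> E -> R).

(** Definiteness is not part of the notion: the vectors will be function representatives, and those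
    vanishing almost everywhere are null. Limits are then unique only up to null vectors. *)
Record semi_hilbert : Prop := SemiHilbert {
  ipC : forall x y, ip x y = ip y x;
  ipDl : forall x y z, ip (x + y) z = ip x z + ip y z;
  ipZl : forall a x z, ip (a *: x) z = a * ip x z;
  ip_ge0 : forall x, 0 <= ip x x;
  ip_complete : forall x : nat -> E,
    (forall e : R, 0 < e -> exists n, forall i j, (n <= i)%N -> (n <= j)%N ->
       ip (x i - x j) (x i - x j) < e) ->
    exists y, forall e : R, 0 < e -> exists n, forall i, (n <= i)%N ->
       ip (x i - y) (x i - y) < e }.

Definition hnorm x := Num.sqrt (ip x x).

Hypothesis H : semi_hilbert.
Local Notation N := hnorm.

Lemma ipDr x y z : ip x (y + z) = ip x y + ip x z.
Proof. by rewrite ipC // ipDl // !(ipC H x). Qed.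

Lemma ipZr a x y : ip x (a *: y) = a * ip x y.
Proof. by rewrite ipC // ipZl // (ipC H x). Qed.

Lemma ipNl x y : ip (- x) y = - ip x y.
Proof. by rewrite -scaleN1r ipZl // mulN1r. Qed.

Lemma ipNr x y : ip x (- y) = - ip x y.
Proof. by rewrite ipC // ipNl ipC. Qed.

Lemma ip0l x : ip 0 x = 0.
Proof. by rewrite -(scale0r 0) ipZl // mul0r. Qed.

Lemma hnorm_ge0 x : 0 <= N x.
Proof. exact: sqrtr_ge0. Qed.

Lemma sqr_hnorm x : N x ^+ 2 = ip x x.
Proof. by rewrite sqr_sqrtr // ip_ge0. Qed.

Lemma hnorm0 : N 0 = 0.
Proof. by rewrite /hnorm ip0l sqrtr0. Qed.

Lemma hnormZ a x : N (a *: x) = `|a| * N x.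
Proof.
rewrite /hnorm ipZl // ipZr mulrA -expr2 sqrtrM ?sqr_ge0 //.
by rewrite sqrtr_sqr.
Qed.

Lemma hnormN x : N (- x) = N x.
Proof. by rewrite -scaleN1r hnormZ normrN1 mul1r. Qed.

Lemma hnormBC x y : N (x - y) = N (y - x).
Proof. by rewrite -hnormN opprB. Qed.

Lemma cauchy_schwarz x y : `|ip x y| <= N x * N y.
Proof.
rewrite -(@ler_pXn2r _ 2) ?nnegrE ?mulr_ge0 ?hnorm_ge0 //.
rewrite real_normK ?num_real // exprMn !sqr_hnorm.
have quad t : 0 <= ip x x + t * ip x y *+ 2 + t ^+ 2 * ip y y.
  have := ip_ge0 H (x + t *: y).
  rewrite !ipDl // !ipDr !ipZl // !ipZr (ipC H y x).
  by congr (_ <= _); ring.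
have y0 := ip_ge0 H y; have x0 := ip_ge0 H x.
have [yz|yn0] := eqVneq (ip y y) 0.
  rewrite yz mulr0 in quad *.
  have [->|xy0] := eqVneq (ip x y) 0; first by rewrite expr0n.
  (* For null [y] the polynomial is affine in [t]; at this [t] it equals -1. *)
  have := quad (- (ip x x + 1) / (2 * ip x y)).
  have -> : - (ip x x + 1) / (2 * ip x y) * ip x y *+ 2 = - (ip x x + 1).
    by field.
  by rewrite mulr0; lra.
have y1 : 0 < ip y y by rewrite lt_neqAle eq_sym yn0.
have := quad (- ip x y / ip y y).
have -> : ip x x + - ip x y / ip y y * ip x y *+ 2
    + (- ip x y / ip y y) ^+ 2 * ip y y
  = (ip x x * ip y y - ip x y ^+ 2) / ip y y by field.
by rewrite ler_pdivlMr // mul0r subr_ge0.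
Qed.

Lemma ip_le x y : ip x y <= N x * N y.
Proof. exact: le_trans (ler_norm _) (cauchy_schwarz x y). Qed.

Lemma ler_hnormD x y : N (x + y) <= N x + N y.
Proof.
rewrite -(@ler_pXn2r _ 2) ?nnegrE ?addr_ge0 ?hnorm_ge0 //.
rewrite sqr_hnorm ipDl // !ipDr (ipC H y x) sqrrD !sqr_hnorm.
by have := ip_le x y; lra.
Qed.

Lemma ler_hnormB x y z : N (x - z) <= N (x - y) + N (y - z).
Proof. by have := ler_hnormD (x - y) (y - z); rewrite subrKA. Qed.

Lemma ler_hnorm_sub x y : N x <= N y + N (x - y).
Proof. by have := ler_hnormD y (x - y); rewrite addrC subrK. Qed.

Lemma ler_hnorm_sum n (F : nat -> E) :
  N (\sum_(i < n) F i) <= \sum_(i < n) N (F i).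
Proof.
elim: n => [|n IH]; first by rewrite !big_ord0 hnorm0.
by rewrite !big_ord_recr /=; apply: le_trans (ler_hnormD _ _) _; rewrite lerD2r.
Qed.

Lemma hnorm_null x y : N (x - y) = 0 -> N x = N y.
Proof.
move=> xy; apply/eqP; rewrite eq_le.
have := ler_hnorm_sub x y; have := ler_hnorm_sub y x.
by rewrite (hnormBC y) xy !addr0 => -> ->.
Qed.

Lemma hnorm_lt e x : 0 < e -> (N x < e) = (ip x x < e ^+ 2).
Proof.
by move=> e0; rewrite -sqr_hnorm ltr_pXn2r // nnegrE ?hnorm_ge0 // ltW.
Qed.

Lemma hnorm_complete (x : nat -> E) :
  (forall e : R, 0 < e -> exists n, forall i j, (n <= i)%N -> (n <= j)%N ->
       N (x i - x j) < e) ->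
  exists y, forall e : R, 0 < e -> exists n, forall i, (n <= i)%N -> N (x i - y) < e.
Proof.
move=> xC; have [e e0|y hy] := ip_complete H (x := x).
  have [|n hn] := xC (Num.sqrt e); first by rewrite sqrtr_gt0.
  exists n => i j ni nj; have := hn i j ni nj.
  by rewrite hnorm_lt ?sqrtr_gt0 // sqr_sqrtr // ltW.
exists y => e e0; have [|n hn] := hy (e ^+ 2); first by rewrite exprn_gt0.
by exists n => i ni; rewrite hnorm_lt // hn.
Qed.

Lemma harmonic_lt (eps : R) : 0 < eps -> exists n, forall i, (n <= i)%N ->
  i.+1%:R^-1 < eps.
Proof.
move=> e0; exists (Num.truncn eps^-1) => i hi; rewrite -[eps]invrK ltf_pV2 ?posrE ?invr_gt0
    ?ltr0n //.
by apply: lt_le_trans (truncnS_gt _) _; rewrite ler_nat ltnS.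
Qed.

Section Projection.
Variable M : E -> Prop.
Hypothesis M0 : M 0.
Hypothesis ML : forall a x y, M x -> M y -> M (a *: x + y).

(* A sequence in M minimizing the distance to f is Cauchy, by the
   parallelogram identity. *)
Lemma projection f : exists p,
  (forall e : R, 0 < e -> exists2 m, M m & N (m - p) < e) /\
  (forall m, M m -> ip (f - p) m = 0).
Proof.
pose S := [set d | exists2 m, M m & d = ip (f - m) (f - m)].
have Sn0 : S !=set0 by exists (ip (f - 0) (f - 0)), 0.
have Slb : lbound S 0 by move=> _ [m _ ->]; exact: ip_ge0.
have Sinf : has_inf S by split => //; exists 0.
have [d dE] : exists d, d = inf S by exists (inf S).
have dle m : M m -> d <= ip (f - m) (f - m).
  by move=> Mm; rewrite dE; apply: ge_inf; [exists 0|exists m].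
have near n : exists m, M m /\ ip (f - m) (f - m) < d + n.+1%:R^-1.
  have [|_ [m Mm ->] hm] := inf_adherent (eps := n.+1%:R^-1) _ Sinf.
    by rewrite invr_gt0.
  by exists m; rewrite dE.
have {near} [x hx] := choice near.
have xC i j : ip (x i - x j) (x i - x j) <= (i.+1%:R^-1 + j.+1%:R^-1) *+ 2.
  have [Mi hi] := hx i; have [Mj hj] := hx j.
  have Mij : M (2^-1 *: x i + 2^-1 *: x j).
    by apply: ML => //; rewrite -[2^-1 *: _]addr0; apply: ML.
  have := dle _ Mij.
  have -> : f - (2^-1 *: x i + 2^-1 *: x j) = 2^-1 *: ((f - x i) + (f - x j)).
    module_eq R.
  have -> : x i - x j = (f - x j) - (f - x i) by module_eq R.
  move: (f - x i) (f - x j) hi hj => a b hi hj.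
  rewrite !ipDl // !ipDr !ipNl !ipNr !ipZl // !ipZr !ipDl // !ipDr.
  rewrite (ipC H b a); move: (ip a a) (ip b b) (ip a b) hi hj.
  by move: i.+1%:R^-1 j.+1%:R^-1 => u v aa bb ab; lra.
have [e e0|p hp] := ip_complete H (x := x).
  have [|n hn] := harmonic_lt (eps := e / 8); first by rewrite divr_gt0.
  exists n => i j ni nj; apply: le_lt_trans (xC i j) _.
  by have := hn i ni; have := hn j nj; move: i.+1%:R^-1 j.+1%:R^-1 => u v; lra.
have {}hp e : 0 < e -> exists n, forall i, (n <= i)%N -> N (x i - p) < e.
  move=> e0; have [|n hn] := hp (e ^+ 2); first by rewrite exprn_gt0.
  by exists n => i ni; rewrite hnorm_lt // hn.
exists p; split=> [e e0|m Mm].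
  by have [n hn] := hp _ e0; exists (x n); [case: (hx n)|exact: hn].
have d0 : 0 <= d by rewrite dE; apply: lb_le_inf.
(* The limit [p] may lie outside M, so its minimality is obtained by passing to the limit in two
   inequalities, this one and [lower]. *)
have upper : ip (f - p) (f - p) <= d.
  rewrite -sqr_hnorm -[leRHS]sqr_sqrtr // ler_pXn2r ?nnegrE ?hnorm_ge0 ?sqrtr_ge0 //.
  apply: le_eps => e e0.
  have [n1 h1] := hp (e / 2) ltac:(by rewrite divr_gt0).
  have [n2 h2] := harmonic_lt (eps := e ^+ 2 / 4) ltac:(by rewrite divr_gt0 // exprn_gt0).
  pose n := maxn n1 n2.
  have := h1 n (leq_maxl _ _); have := h2 n (leq_maxr _ _) => hn2 hn1.
  have [_ hn] := hx n.
  apply: le_trans (ler_hnormB f (x n) p) _.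
  suff : N (f - x n) <= Num.sqrt d + e / 2 by lra.
  rewrite -(@ler_pXn2r _ 2) ?nnegrE ?hnorm_ge0 ?addr_ge0 ?sqrtr_ge0 ?divr_ge0 ?ltW //.
  rewrite sqr_hnorm sqrrD sqr_sqrtr //.
  have : 0 <= Num.sqrt d * (e / 2) by rewrite mulr_ge0 ?sqrtr_ge0 ?divr_ge0 ?ltW.
  by move: hn hn2; rewrite expr_div_n -natrX; move: n.+1%:R^-1 => u; lra.
have lower t : d <= ip (f - p - t *: m) (f - p - t *: m).
  rewrite -[leRHS]sqr_hnorm -[leLHS]sqr_sqrtr // ler_pXn2r ?nnegrE ?hnorm_ge0 ?sqrtr_ge0 //.
  apply: le_eps => e e0.
  have [n hn] := hp _ e0; have {}hn := hn n (leqnn n).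
  have Mx : M (t *: m + x n) by apply: ML => //; case: (hx n).
  have := dle _ Mx; rewrite -sqr_hnorm -{1}(sqr_sqrtr d0).
  rewrite ler_pXn2r ?nnegrE ?hnorm_ge0 ?sqrtr_ge0 // => /le_trans; apply.
  have -> : f - (t *: m + x n) = (f - p - t *: m) + (p - x n) by module_eq R.
  apply: le_trans (ler_hnormD _ _) _.
  by rewrite lerD2l hnormBC ltW.
have quad t : 0 <= - (t * ip (f - p) m *+ 2) + t ^+ 2 * ip m m.
  have := le_trans upper (lower t).
  move: (f - p) => a.
  by rewrite !ipDl // !ipDr !ipNl !ipNr !ipZl // !ipZr (ipC H m a); lra.
have m0 := ip_ge0 H m; apply/eqP; apply: contraT => am.
move: (ip (f - p) m) (ip m m) am m0 quad => a b a0 b0 quad.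
(* The minimizer would be a / b; a / (b + 1) already makes the quadratic negative for nonzero a, and
   it covers b = 0. *)
have := quad (a / (b + 1)).
have -> : - (a / (b + 1) * a *+ 2) + (a / (b + 1)) ^+ 2 * b =
   - (a ^+ 2 * (b + 2) / (b + 1) ^+ 2) by field; lra.
have a2 : 0 < a ^+ 2 by rewrite lt_neqAle sqr_ge0 eq_sym sqrf_eq0 a0.
by rewrite oppr_ge0 leNgt divr_gt0 // ?exprn_gt0 ?(mulr_gt0 a2) //; lra.
Qed.

End Projection.

(* Lax-Milgram: the range of I + S is closed, since |x| <= |x + Sx|, and its
   orthogonal complement is null. *)
Lemma accretive_onto (S : E -> E) (C : R) :
  (forall a x y, S (a *: x + y) = a *: S x + S y) ->
  (forall x, N (S x) <= C * N x) -> (forall x, 0 <= ip (S x) x) ->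
  forall f, exists x, N (x + S x - f) = 0.
Proof.
move=> Slin Sbd Sacc f.
have S0 : S 0 = 0 by have := Slin (-1) 0 0; rewrite scaler0 addr0 scaleN1r addNr.
have [|a _ _ [x ->] [y ->]|p [pM porth]] :=
  @projection (fun y => exists x, y = x + S x) _ _ f.
- by exists 0; rewrite S0 addr0.
- by exists (a *: x + y); rewrite Slin; module_eq R.
have coer x : N x <= N (x + S x).
  have [x0|x0] := eqVneq (N x) 0; first by rewrite x0 hnorm_ge0.
  have x1 : 0 < N x by rewrite lt_neqAle eq_sym x0 hnorm_ge0.
  rewrite -(ler_pM2r x1) -expr2 sqr_hnorm; apply: le_trans (ip_le _ _).
  by rewrite ipDl // lerDl.
have SB x y : S (x - y) = S x - S y.
  by rewrite -[x - y]addrC -scaleN1r Slin scaleN1r addrC.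
have fp : N (f - p) = 0.
  have := porth _ (ex_intro _ (f - p) erefl).
  rewrite ipDr -sqr_hnorm (ipC H _ (S _)) => h; have := Sacc (f - p).
  have : 0 <= N (f - p) ^+ 2 by rewrite sqr_ge0.
  move=> h1 h2; apply/eqP; rewrite -sqrf_eq0; apply/eqP; lra.
have appr n : exists x, N (x + S x - p) < n.+1%:R^-1.
  by have [|_ [x ->] hx] := pM n.+1%:R^-1; [rewrite invr_gt0|exists x].
have [x hx] := choice appr.
have [e e0|y hy] := @hnorm_complete x.
  have [|n hn] := harmonic_lt (eps := e / 2); first by rewrite divr_gt0.
  exists n => i j ni nj; apply: le_lt_trans (coer _) _; rewrite SB.
  have -> : x i - x j + (S (x i) - S (x j)) =
    (x i + S (x i) - p) - (x j + S (x j) - p) by module_eq R.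
  apply: le_lt_trans (ler_hnormD _ _) _; rewrite hnormN.
  have := hx i; have := hx j; have := hn i ni; have := hn j nj.
  by move: i.+1%:R^-1 j.+1%:R^-1 => u v; lra.
exists y; apply/eqP; rewrite eq_le hnorm_ge0 andbT; apply: le_eps => e e0.
rewrite add0r.
(* The sign of [C] is unknown; a positive majorant can appear in denominators. *)
have [C' [C0 CC]] : exists C' : R, 0 < C' /\ C <= C'.
  by exists (`|C| + 1); rewrite ltr_wpDl // ler_wpDr // ler_norm.
have [n1 h1] := hy (e / (2 * (C' + 1))) ltac:(by rewrite divr_gt0 // mulr_gt0 // addr_gt0).
have [n2 h2] := harmonic_lt (eps := e / 2) ltac:(by rewrite divr_gt0).
pose n := maxn n1 n2.
have {}h1 := h1 n (leq_maxl _ _); have {}h2 := h2 n (leq_maxr _ _).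
have -> : y + S y - f = - (x n - y) + - S (x n - y) + (x n + S (x n) - p) - (f - p).
  by rewrite SB; module_eq R.
apply: le_trans (ler_hnormD _ _) _; rewrite hnormN fp addr0.
apply: le_trans (ler_hnormD _ _) _; apply: le_trans (lerD (ler_hnormD _ _) (lexx _)) _.
rewrite !hnormN.
have : N (S (x n - y)) <= C' * N (x n - y).
  apply: le_trans (Sbd _) _; apply: ler_wpM2r; first exact: hnorm_ge0.
  exact: CC.
have : (C' + 1) * N (x n - y) <= e / 2.
  have -> : e / 2 = (C' + 1) * (e / (2 * (C' + 1))) by field; rewrite gt_eqF // addr_gt0.
  by rewrite ler_pM2l ?addr_gt0 // ltW.
by have := hx n; move: n.+1%:R^-1 h2 => u h2; lra.
Qed.

End SemiHilbert.

(** * Generation of semigroups *)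

Section Generation.
Variables (R : realType) (E : lmodType R) (ip : E -> E -> R).
Hypothesis H : semi_hilbert ip.
Local Notation N := (hnorm ip).

(* the graph of an unbounded operator, single-valued up to null vectors *)
Variable G : E -> E -> Prop.
Variable w : R.

(** With [grL], the fields [gr_ext] and [gr_null] say that the values at a point of the domain form
    one class modulo null vectors. [gr_range] solves one implicit Euler step of length h started at
    f. *)
Record quasi_m_dissipative : Prop := QuasiMDissipative {
  gr0 : G 0 0;
  grL : forall a x y x' y', G x y -> G x' y' -> G (a *: x + x') (a *: y + y');
  gr_ext : forall x y y', G x y -> N (y - y') = 0 -> G x y';
  gr_null : forall x y, G x y -> N x = 0 -> N y = 0;
  gr_w0 : 0 <= w;
  gr_diss : forall x y, G x y -> ip y x <= w * ip x x;
  gr_range : forall h f, 0 < h -> exists x, G x (h^-1 *: (x - f)) }.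

Hypothesis HG : quasi_m_dissipative.
Implicit Types h t T : R.

Let GL := grL HG.
Let G0 := gr0 HG.
Let w0 := gr_w0 HG.
Let Nge0 := @hnorm_ge0 R E ip.
Let ND := ler_hnormD H.
Let NB := ler_hnormB H.
Let NZ := hnormZ H.

Lemma grD x y x' y' : G x y -> G x' y' -> G (x + x') (y + y').
Proof. by move=> h h'; have := GL 1 h h'; rewrite !scale1r. Qed.

Lemma grZ a x y : G x y -> G (a *: x) (a *: y).
Proof. by move=> h; have := GL a h G0; rewrite !addr0. Qed.

Lemma grB x y x' y' : G x y -> G x' y' -> G (x - x') (y - y').
Proof. by move=> h h'; rewrite -(scaleN1r x') -(scaleN1r y'); apply: grD => //; exact: grZ. Qed.

(** Steps below this threshold satisfy h w <= 1/2, where 1/(1 - h w) <= 1 + 2 h w <= exp(2 w h): the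
    origin of the factor 2 in [growth]. The added 1 covers w = 0. *)
Definition step0 : R := (2 * (w + 1))^-1.

Lemma step0_gt0 : 0 < step0.
Proof. by rewrite invr_gt0 mulr_gt0 // ltr_wpDl. Qed.

Lemma step0_small h : h <= step0 -> h * w <= 2^-1.
Proof.
move=> hh; apply: le_trans (ler_wpM2r w0 hh) _.
rewrite /step0 mulrC ler_pdivrMr ?mulr_gt0 ?ltr_wpDl //.
by move: w0; lra.
Qed.

Definition growth (t : R) : R := expR (2 * w * t).

Lemma growthD s t : growth (s + t) = growth s * growth t.
Proof. by rewrite /growth mulrDr expRD. Qed.

Lemma growth_gt0 t : 0 < growth t. Proof. exact: expR_gt0. Qed.
Lemma growth_ge0 t : 0 <= growth t. Proof. exact: expR_ge0. Qed.

Lemma growth_le s t : s <= t -> growth s <= growth t.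
Proof. by move=> st; rewrite /growth ler_expR ler_wpM2l // mulr_ge0. Qed.

Lemma growth_ge1 t : 0 <= t -> 1 <= growth t.
Proof. by move=> t0; apply: le_trans (growth_le t0); rewrite /growth mulr0 expR0. Qed.

(** Stability of one implicit step: pair [x - h *: y] with [x], use dissipativity and divide by the
    norm of [x]. *)
Lemma gr_contr h x y : 0 < h -> h <= step0 -> G x y ->
  N x <= growth h * N (x - h *: y).
Proof.
move=> h0 /step0_small hw Gxy; have [x0|x0] := eqVneq (N x) 0.
  by rewrite x0 mulr_ge0 ?growth_ge0.
have x1 : 0 < N x by rewrite lt_neqAle eq_sym x0 Nge0.
have h1 : (1 - h * w) * N x <= N (x - h *: y).
  rewrite -(ler_pM2r x1) -mulrA -expr2 (sqr_hnorm H).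
  apply: le_trans (ip_le H _ _); rewrite (ipDl H) (ipNl H) (ipZl H) mulrBl mul1r.
  by rewrite lerD2l lerN2 -mulrA ler_pM2l // gr_diss.
have h2 : N x <= (1 + 2 * w * h) * N (x - h *: y).
  apply: (@le_trans _ _ ((1 + 2 * w * h) * ((1 - h * w) * N x))); last first.
    by rewrite ler_wpM2l // addr_ge0 // !mulr_ge0 // ltW.
  rewrite mulrA -{1}[N x]mul1r ler_pM2r //.
  have : 0 <= h * w by rewrite mulr_ge0 // ltW.
  move: hw; rewrite (mulrC h w) -mulrA; move: (w * h) => s s1 s0.
  (* (1 + 2 s)(1 - s) - 1 = s (1 - 2 s), nonnegative because s = h w is at most 1/2. *)
  have : 0 <= s * (1 - 2 * s) by rewrite mulr_ge0 //; lra.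
  by rewrite -subr_ge0 => s2; rewrite -subr_ge0; apply: le_trans s2 _; lra.
apply: le_trans h2 _; apply: ler_wpM2r => //.
by rewrite /growth expR_ge1Dx.
Qed.

(* [x] is a sequence of implicit Euler steps of length [h] *)
Definition euler h (x : nat -> E) := forall n, G (x n.+1) (h^-1 *: (x n.+1 - x n)).

(** Discrete Gronwall estimate with a local error [e n] in each step. It serves to compare the
    schemes with steps h and h / 2, and later to compare a primitive with the scheme. *)
Lemma perturbed_euler h x e : 0 < h -> h <= step0 ->
  (forall n, G (x n.+1) (h^-1 *: (x n.+1 - x n - e n))) ->
  forall n, N (x n) <= growth (h * n%:R) * (N (x 0%N) + \sum_(i < n) N (e i)).
Proof.
move=> h0 hh xe; elim=> [|n IH].
  by rewrite mulr0 big_ord0 addr0 ler_peMl // growth_ge1.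
apply: le_trans (gr_contr h0 hh (xe n)) _.
rewrite scalerA divff ?gt_eqF // scale1r.
have -> : x n.+1 - (x n.+1 - x n - e n) = x n + e n by module_eq R.
have -> : h * n.+1%:R = h * n%:R + h by rewrite -natr1 mulrDr mulr1.
rewrite big_ord_recr /= growthD addrA.
rewrite [growth (h * n%:R) * _]mulrC -mulrA ler_pM2l ?growth_gt0 // mulrDr.
apply: le_trans (ND _ _) _; rewrite lerD // ler_peMl //.
by rewrite growth_ge1 // mulr_ge0 // ltW.
Qed.

Lemma euler_bound h x n : 0 < h -> h <= step0 -> euler h x ->
  N (x n) <= growth (h * n%:R) * N (x 0%N).
Proof.
move=> h0 hh xe; have := @perturbed_euler h x (fun=> 0) h0 hh _ n.
rewrite big1 ?addr0 => [|i _]; last by rewrite (hnorm0 H).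
by apply=> m; rewrite subr0.
Qed.

Lemma euler_exists h f : 0 < h -> exists x, x 0%N = f /\ euler h x.
Proof.
move=> h0; have [J hJ] := choice (fun f => gr_range HG f h0).
by exists (fun n => iter n J f); split => // n; exact: hJ.
Qed.

Lemma eulerB h x y : euler h x -> euler h y -> euler h (fun n => x n - y n).
Proof.
move=> hx hy n; have := grB (hx n) (hy n); congr (G _ _); module_eq R.
Qed.

Lemma euler_shift h x : euler h x -> euler h (fun n => x n.+1).
Proof. by move=> hx n; exact: hx. Qed.

Definition esum h (x : nat -> E) n := h *: \sum_(i < n) x i.+1.

Lemma esumS h x n : esum h x n.+1 = esum h x n + h *: x n.+1.
Proof. by rewrite /esum big_ord_recr /= scalerDr. Qed.

Lemma esum0 h x : esum h x 0 = 0.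
Proof. by rewrite /esum big_ord0 scaler0. Qed.

Lemma gr_esum h x n : 0 < h -> euler h x -> G (esum h x n) (x n - x 0%N).
Proof.
move=> h0 hx; elim: n => [|n IH]; first by rewrite esum0 subrr.
rewrite esumS; have := grD IH (grZ h (hx n)); congr (G _ _).
by rewrite scalerA divff ?gt_eqF // scale1r; module_eq R.
Qed.

(** Applied to f plus the sums of h y, the operator telescopes to y, which is also the difference
    quotient of that sequence. So the scheme from f is the integral of the scheme from A f. *)
Lemma euler_lift h y f : 0 < h -> euler h y -> G f (y 0%N) ->
  euler h (fun n => f + esum h y n).
Proof.
move=> h0 hy Gf n; have := grD Gf (gr_esum n.+1 h0 hy); congr (G _ _).
rewrite esumS; have -> : f + (esum h y n + h *: y n.+1) - (f + esum h y n) = h *: y n.+1.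
  by module_eq R.
by rewrite scalerA mulVf ?gt_eqF // scale1r addrC subrK.
Qed.

Section SmoothData.
Variables (h : R) (f f1 f2 : E) (x : nat -> E).
Hypotheses (h0 : 0 < h) (hh : h <= step0) (hx : euler h x) (x0 : x 0%N = f).
Hypothesis Gf : G f f1.

Lemma euler_first : N (x 1%N - x 0%N) <= growth h * (h * N f1).
Proof.
have := gr_contr h0 hh (grB (hx 0) (eq_ind_r (G^~ f1) Gf x0)).
have -> : x 1%N - x 0%N - h *: (h^-1 *: (x 1%N - x 0%N) - f1) = h *: f1.
  by rewrite scalerBr scalerA divff ?gt_eqF // scale1r; module_eq R.
by rewrite NZ gtr0_norm.
Qed.

Lemma euler_lip n : N (x n.+1 - x n) <= growth (h * n.+1%:R) * (h * N f1).
Proof.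
have := @euler_bound _ _ n h0 hh (eulerB (euler_shift hx) hx) => /le_trans; apply.
rewrite -natr1 mulrDr mulr1 growthD -mulrA ler_pM2l ?growth_gt0 //.
exact: euler_first.
Qed.

(** Second differences solve the scheme again, so it suffices to bound the first one. Two resolvent
    estimates do this: d1 - d0 is controlled by d0 - h f1, and d0 - h f1 by h^2 f2. *)
Lemma euler_second n : G f1 f2 ->
  N ((x n.+2 - x n.+1) - (x n.+1 - x n)) <= growth (h * n.+2%:R) * (h ^+ 2 * N f2).
Proof.
move=> Gf1; have hd := eulerB (euler_shift hx) hx.
have := @euler_bound _ _ n h0 hh (eulerB (euler_shift hd) hd) => /le_trans; apply.
rewrite -[n.+2]addn2 natrD mulrDr growthD -mulrA ler_pM2l ?growth_gt0 //.
have Gx0 : G (x 0%N) f1 by rewrite x0.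
have hn : h != 0 by rewrite gt_eqF.
set d0 := x 1%N - x 0%N; set d1 := x 2%N - x 1%N.
have Gd0 : G d0 (h^-1 *: d0 - f1) by exact: (grB (hx 0) Gx0).
have Gd1 : G d1 (h^-1 *: (d1 - d0)) by exact: (hd 0%N).
have hr := grB Gd0 (grZ h Gf1).
have := gr_contr h0 hh hr; have := gr_contr h0 hh (grB Gd1 Gd0).
have -> : d1 - d0 - h *: (h^-1 *: (d1 - d0) - (h^-1 *: d0 - f1)) = d0 - h *: f1.
  by module_eq R.
have -> : d0 - h *: f1 - h *: (h^-1 *: d0 - f1 - h *: f2) = h ^+ 2 *: f2.
  by module_eq R.
rewrite NZ normrX gtr0_norm // => h1 h2.
apply: le_trans h1 _; rewrite mulr_natr mulr2n growthD -mulrA.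
by rewrite ler_pM2l ?growth_gt0.
Qed.

End SmoothData.

Definition smooth f f1 f2 := G f f1 /\ G f1 f2.

(** Every second term of the fine scheme solves the coarse scheme with its second difference as
    local error, of order h^2; over at most T / h steps the errors add up to order h. *)
Lemma euler_halving h f f1 f2 x x' T n : 0 < h -> h <= step0 -> smooth f f1 f2 ->
  euler h x -> euler (h / 2) x' -> x 0%N = f -> x' 0%N = f -> h * n%:R <= T ->
  N (x n - x' n.*2) <= growth T ^+ 2 * T * N f2 * h.
Proof.
move=> h0 hh [Gf Gf1] hx hx' x0 x'0 hT.
have h20 : 0 < h / 2 by rewrite divr_gt0.
have hh2 : h / 2 <= step0 by move: hh h0; lra.
have hn : h != 0 by rewrite gt_eqF.
have T0 : 0 <= T by apply: le_trans hT; rewrite mulr_ge0 // ltW.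
pose e n := (x' n.*2.+2 - x' n.*2.+1) - (x' n.*2.+1 - x' n.*2).
have := @perturbed_euler h (fun n => x n - x' n.*2) e h0 hh _ n.
rewrite double0 x0 x'0 subrr (hnorm0 H) add0r => b.
apply: le_trans (b _) _ => [m|].
  have := grB (hx m) (hx' m.*2.+1); congr (G _ _).
  by rewrite /e doubleS; module_eq R.
have eb i : (i < n)%N -> N (e i) <= growth T * (h ^+ 2 * N f2).
  move=> iN; apply: le_trans (euler_second h20 hh2 hx' x'0 Gf i.*2 Gf1) _.
  apply: ler_pM; rewrite ?growth_ge0 ?(mulr_ge0 (sqr_ge0 _)) //.
    apply: growth_le; apply: le_trans hT.
    have -> : i.*2.+2 = (2 * i.+1)%N by rewrite -doubleS -mul2n.
    by rewrite natrM mulrA divfK // ler_pM2l // ler_nat.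
  by rewrite ler_wpM2r // expr_div_n ler_pdivrMr ?exprn_gt0 // ler_peMr ?sqr_ge0 // -natrX ler1n.
have sb : \sum_(i < n) N (e i) <= growth T * (T * N f2 * h).
  apply: (@le_trans _ _ (\sum_(i < n) growth T * (h ^+ 2 * N f2))).
    by apply: ler_sum => i _; exact: eb.
  rewrite sumr_const card_ord -mulr_natl.
  have -> : n%:R * (growth T * (h ^+ 2 * N f2)) = growth T * (h * n%:R * (N f2 * h)).
    by ring.
  apply: ler_wpM2l; rewrite ?growth_ge0 // -(mulrA T (N f2) h) ler_wpM2r //.
  by rewrite mulr_ge0 // ltW.
rewrite expr2 -!mulrA; apply: ler_pM; rewrite ?growth_ge0 ?sumr_ge0 //.
  exact: growth_le.
by move: sb; rewrite -!mulrA.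
Qed.

Lemma esum_halving h f f1 f2 x x' T n : 0 < h -> h <= step0 -> smooth f f1 f2 ->
  euler h x -> euler (h / 2) x' -> x 0%N = f -> x' 0%N = f -> h * n%:R <= T ->
  N (esum h x n - esum (h / 2) x' n.*2) <=
    T * (growth T ^+ 2 * T * N f2 + growth T * N f1) * h.
Proof.
move=> h0 hh sf hx hx' x0 x'0 hT.
have h20 : 0 < h / 2 by rewrite divr_gt0.
have hh2 : h / 2 <= step0 by move: hh h0; lra.
have T0 : 0 <= T by apply: le_trans hT; rewrite mulr_ge0 // ltW.
set C : R := growth T ^+ 2 * T * N f2 + growth T * N f1; have C0 : 0 <= C.
  by rewrite addr_ge0 // !mulr_ge0 ?growth_ge0 // exprn_ge0 ?growth_ge0.
(* The fine sum contains x' at the indices 2i+1 and 2i+2; the odd term is replaced by the even one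
   at the cost of a first difference. *)
pose F i := h *: (x i.+1 - x' i.+1.*2) + (h / 2) *: (x' i.*2.+2 - x' i.*2.+1).
have -> : esum h x n - esum (h / 2) x' n.*2 = \sum_(i < n) F i.
  elim: n {hT} => [|n IH]; first by rewrite !esum0 subrr big_ord0.
  by rewrite big_ord_recr /= -IH /F doubleS !esumS; module_eq R.
apply: le_trans (ler_hnorm_sum H n F) _.
apply: (@le_trans _ _ (\sum_(i < n) h * (C * h))).
  apply: ler_sum => i _; apply: le_trans (ND _ _) _; rewrite !NZ !gtr0_norm //.
  have hi : h * i.+1%:R <= T by apply: le_trans hT; rewrite ler_pM2l // ler_nat.
  rewrite mulrDl mulrDr; apply: lerD.
    by rewrite ler_pM2l //; exact: (euler_halving h0 hh sf hx hx' x0 x'0 hi).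
  apply: ler_pM => //; first by rewrite ltW.
    by move: h0; lra.
  apply: le_trans (euler_lip h20 hh2 hx' x'0 sf.1 i.*2.+1) _.
  have hg : growth (h / 2 * i.*2.+2%:R) <= growth T.
    apply: growth_le; apply: le_trans hi.
    have -> : i.*2.+2 = (2 * i.+1)%N by rewrite -doubleS -mul2n.
    by rewrite natrM mulrA divfK.
  apply: (@le_trans _ _ (growth T * (h / 2 * N f1))).
    by rewrite ler_wpM2r // mulr_ge0 // ltW.
  rewrite -[leRHS]mulrA ler_wpM2l ?growth_ge0 // (mulrC _ h) ler_wpM2r //.
  by move: h0; lra.
rewrite sumr_const card_ord -mulr_natl mulrA (mulrC _ h) -mulrA.
by rewrite ler_wpM2r // mulr_ge0 // ltW.
Qed.

End Generation.

(** * Convergence of Euler schemes; existence and uniqueness of mild solutions *)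

Section MildSolutions.
Variables (R : realType) (E : lmodType R) (ip : E -> E -> R).
Hypothesis H : semi_hilbert ip.
Local Notation N := (hnorm ip).
Variables (G : E -> E -> Prop) (w : R).
Hypothesis HG : quasi_m_dissipative ip G w.
Implicit Types (h t T a b c d e : R) (f : E) (Y : nat -> R -> E) (U W : R -> E).

Let Nge0 := @hnorm_ge0 R E ip.
Let ND := ler_hnormD H.
Let NB := ler_hnormB H.
Let NZ := hnormZ H.
Let NBC := hnormBC H.

Definition hstep k : R := step0 w / 2 ^+ k.

Lemma hstep_gt0 k : 0 < hstep k.
Proof. by rewrite divr_gt0 ?(step0_gt0 HG) ?exprn_gt0. Qed.

Lemma hstep_le k : hstep k <= step0 w.
Proof.
rewrite ler_pdivrMr ?exprn_gt0 // ler_peMr ?(ltW (step0_gt0 HG)) //.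
by rewrite -natrX ler1n expn_gt0.
Qed.

Lemma hstepS k : hstep k.+1 = hstep k / 2.
Proof. by rewrite /hstep exprSr invfM mulrA. Qed.

Lemma hstep_lt e : 0 < e -> exists K, forall k, (K <= k)%N -> hstep k < e.
Proof.
move=> e0; have s0 := step0_gt0 HG.
have [K hK] := @harmonic_lt R (e / step0 w) ltac:(by rewrite divr_gt0).
exists K => k /hK; rewrite ltr_pdivlMr // => h; apply: le_lt_trans h.
rewrite /hstep mulrC ler_pM2r // lef_pV2 ?posrE ?exprn_gt0 ?ltr0n //.
by rewrite -natrX ler_nat ltn_expl.
Qed.

Definition grid k t := Num.truncn (t / hstep k).

Lemma grid_le k t : 0 <= t -> hstep k * (grid k t)%:R <= t.
Proof.
move=> t0; rewrite mulrC -ler_pdivlMr ?hstep_gt0 //.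
by rewrite truncn_le // divr_ge0 // ltW ?hstep_gt0.
Qed.

Lemma grid_gt k t : t < hstep k * (grid k t).+1%:R.
Proof. by rewrite mulrC -ltr_pdivrMr ?hstep_gt0 // truncnS_gt. Qed.

Lemma grid_near k t : 0 <= t -> `|hstep k * (grid k t)%:R - t| <= hstep k.
Proof.
move=> t0; have := grid_le k t0; have := grid_gt k t.
rewrite -natr1 mulrDr mulr1 => h1 h2; rewrite distrC ger0_norm ?subr_ge0 //.
by rewrite lerBlDl ltW.
Qed.

Lemma grid_nat k n : grid k (hstep k * n%:R) = n.
Proof.
by rewrite /grid [hstep k * _]mulrC mulfK ?natrK // gt_eqF ?hstep_gt0.
Qed.

Lemma grid_mono k s t : s <= t -> (grid k s <= grid k t)%N.
Proof. by move=> st; apply: le_truncn; rewrite ler_pM2r // invr_gt0 hstep_gt0. Qed.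

(** Halving the step keeps the coarse grid points, so the last fine point before t is the last
    coarse one or its successor on the fine grid. *)
Lemma gridS k t : 0 <= t ->
  grid k.+1 t = (grid k t).*2 \/ grid k.+1 t = (grid k t).*2.+1.
Proof.
move=> t0; have h0 := hstep_gt0 k.
have h20 : 0 < hstep k / 2 by rewrite divr_gt0.
have a1 := grid_le k t0; have a2 := grid_gt k t.
have b1 := grid_le k.+1 t0; have b2 := grid_gt k.+1 t.
move: (grid k t) (grid k.+1 t) a1 a2 b1 b2 => n m; rewrite hstepS => a1 a2 b1 b2.
have c1 : (n.*2 < m.+1)%N.
  rewrite -(ltr_nat R) -(ltr_pM2l h20).
  by apply: le_lt_trans b2; rewrite -mul2n natrM mulrA divfK.
have c2 : (m < n.+1.*2)%N.
  rewrite -(ltr_nat R) -(ltr_pM2l h20).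
  by apply: le_lt_trans b1 _; rewrite -mul2n natrM mulrA divfK.
move: c1 c2; rewrite ltnS leq_eqVlt doubleS => /orP [/eqP ->|c1]; first by left.
by rewrite !ltnS leq_eqVlt ltnNge c1 orbF => /eqP ->; right.
Qed.

Definition ucauchy Y := forall T e, 0 < e -> exists K, forall k j t,
  (K <= k)%N -> (K <= j)%N -> 0 <= t -> t <= T -> N (Y k t - Y j t) <= e.

Definition ulim Y U := forall T e, 0 < e -> exists K, forall k t,
  (K <= k)%N -> 0 <= t -> t <= T -> N (Y k t - U t) <= e.

Lemma ucauchy_lim Y : ucauchy Y -> exists U, ulim Y U.
Proof.
move=> YC.
have [U hU] : exists U : R -> E, forall t, 0 <= t ->
    forall e, 0 < e -> exists K, forall k, (K <= k)%N -> N (Y k t - U t) < e.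
  suff /choice [U hU] : forall t, exists u, 0 <= t -> forall e, 0 < e ->
    exists K, forall k, (K <= k)%N -> N (Y k t - u) < e by exists U.
  move=> t; have [t0|t0] := leP 0 t; last by exists 0.
  have [|u hu] := @hnorm_complete _ _ _ H (Y^~ t); last by exists u.
  move=> e e0; have [K hK] := YC t (e / 2) ltac:(by rewrite divr_gt0).
  exists K => i j Ki Kj; apply: le_lt_trans (hK _ _ _ Ki Kj t0 (lexx _)) _.
  by rewrite ltr_pdivrMr // ltr_pMr // ltr1n.
exists U => T e e0; have [K hK] := YC T (e / 2) ltac:(by rewrite divr_gt0).
exists K => k t Kk t0 tT; have [K' hK'] := hU t t0 (e / 2) ltac:(by rewrite divr_gt0).
pose j := maxn K K'.
have := hK k j t Kk (leq_maxl _ _) t0 tT; have := hK' j (leq_maxr _ _).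
by have := NB (Y k t) (Y j t) (U t); lra.
Qed.

Lemma geometric_ucauchy Y :
  (forall T, exists C : R, 0 <= C /\ forall k t, 0 <= t -> t <= T ->
     N (Y k t - Y k.+1 t) <= C * hstep k) -> ucauchy Y.
Proof.
move=> YC T e e0; have [C [C0 hC]] := YC T.
have [K hK] := @hstep_lt (e / (4 * (C + 1))) ltac:(by rewrite divr_gt0 // mulr_gt0 // ltr_wpDl).
(* The steps halve, so that C h = 2 C h - 2 C (h / 2): the bound telescopes exactly in this form. *)
have tel k (d : nat) t : 0 <= t -> t <= T ->
    N (Y k t - Y (k + d)%N t) <= 2 * C * hstep k - 2 * C * hstep (k + d).
  move=> t0 tT; elim: d => [|d IH]; first by rewrite addn0 !subrr (hnorm0 H).
  apply: le_trans (NB _ (Y (k + d)%N t) _) _.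
  have := hC (k + d)%N t t0 tT; rewrite addnS hstepS.
  by move: (hstep (k + d)) (C) (hstep k) IH => p q r; lra.
have half k j t : (K <= k)%N -> (k <= j)%N -> 0 <= t -> t <= T -> N (Y k t - Y j t) <= e / 2.
  move=> Kk kj t0 tT; rewrite -(subnKC kj); apply: le_trans (tel _ _ _ t0 tT) _.
  apply: (@le_trans _ _ (2 * C * hstep k)).
    have hp := ltW (hstep_gt0 (k + (j - k))).
    by rewrite gerBl; apply: mulr_ge0 => //; apply: mulr_ge0.
  have := hK k Kk; rewrite ltr_pdivlMr ?mulr_gt0 ?ltr_wpDl // => h.
  by have := hstep_gt0 k; nra.
exists K => k j t Kk Kj t0 tT.
have e2 : e / 2 <= e by lra.
have [kj|jk] := leqP k j; first exact: le_trans (half _ _ _ Kk kj t0 tT) e2.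
by rewrite NBC; apply: le_trans (half _ _ _ Kj (ltnW jk) t0 tT) e2.
Qed.

Lemma approx_ucauchy Y :
  (forall T e, 0 < e -> exists Y', ucauchy Y' /\
     forall k t, 0 <= t -> t <= T -> N (Y k t - Y' k t) <= e) -> ucauchy Y.
Proof.
move=> YA T e e0; have [Y' [Y'C hY']] := YA T (e / 3) ltac:(by rewrite divr_gt0).
have [K hK] := Y'C T (e / 3) ltac:(by rewrite divr_gt0).
exists K => k j t Kk Kj t0 tT.
have := NB (Y k t) (Y' k t) (Y j t); have := NB (Y' k t) (Y' j t) (Y j t).
have := hY' k t t0 tT; have := hY' j t t0 tT; rewrite (NBC (Y j t)).
by have := hK k j t Kk Kj t0 tT; lra.
Qed.

Definition family f (xi : nat -> nat -> E) :=
  forall k, xi k 0%N = f /\ euler G (hstep k) (xi k).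

Definition fcurve (xi : nat -> nat -> E) k t := xi k (grid k t).
Definition fsum (xi : nat -> nat -> E) k t := esum (hstep k) (xi k) (grid k t).

Lemma family_exists f : exists xi, family f xi.
Proof.
by have [xi hxi] := choice (fun k => euler_exists HG f (hstep_gt0 k)); exists xi.
Qed.

Lemma euler_le h x n T : 0 < h -> h <= step0 w -> euler G h x -> h * n%:R <= T ->
  N (x n) <= growth w T * N (x 0%N).
Proof.
move=> h0 hh hx hT; apply: le_trans (euler_bound H HG n h0 hh hx) _.
by rewrite ler_wpM2r // (growth_le HG).
Qed.

Lemma esum_le h x n T : 0 < h -> h <= step0 w -> euler G h x -> h * n%:R <= T ->
  N (esum h x n) <= T * (growth w T * N (x 0%N)).
Proof.
move=> h0 hh hx hT; rewrite NZ gtr0_norm //.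
have b : \sum_(i < n) N (x i.+1) <= n%:R * (growth w T * N (x 0%N)).
  rewrite mulr_natl -[X in _ *+ X]card_ord -sumr_const; apply: ler_sum => i _.
  apply: (euler_le h0 hh hx); apply: le_trans hT.
  by rewrite ler_pM2l // ler_nat.
have := ler_hnorm_sum H n (fun i => x i.+1) => /le_trans /(_ b) c.
apply: (@le_trans _ _ (h * (n%:R * (growth w T * N (x 0%N))))).
  by rewrite ler_pM2l.
by rewrite mulrA ler_wpM2r // mulr_ge0 // growth_ge0.
Qed.

Lemma smooth_ucauchy f f1 f2 xi : smooth G f f1 f2 -> family f xi ->
  ucauchy (fcurve xi) /\ ucauchy (fsum xi).
Proof.
move=> sf hxi; split; apply: geometric_ucauchy => T0;
  pose T := Num.max T0 0; have T_ge0 : 0 <= T by rewrite le_max lexx orbT.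
- exists (growth w T ^+ 2 * T * N f2 + growth w T * N f1).
  have pos : 0 <= growth w T * N f1 by rewrite mulr_ge0 ?growth_ge0.
  split=> [|k t t0 tT0].
    by rewrite addr_ge0 // !mulr_ge0 // growth_ge0.
  have tT : t <= T by rewrite le_max tT0.
  have [x0 hx] := hxi k; have [x'0 hx'] := hxi k.+1.
  have h0 := hstep_gt0 k; have hh := hstep_le k.
  have h0' := hstep_gt0 k.+1; have hh' := hstep_le k.+1.
  have gT : hstep k * (grid k t)%:R <= T by exact: le_trans (grid_le k t0) tT.
  have gT' : hstep k.+1 * (grid k.+1 t)%:R <= T by exact: le_trans (grid_le k.+1 t0) tT.
  rewrite /fcurve; have half : N (xi k (grid k t) - xi k.+1 (grid k t).*2) <=
      growth w T ^+ 2 * T * N f2 * hstep k.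
    by apply: (euler_halving H HG h0 hh sf hx _ x0 x'0 gT); rewrite -hstepS.
  have [gE|gE] := gridS k t0.
    by rewrite gE; apply: le_trans half _; rewrite ler_pM2r // lerDl.
  rewrite gE mulrDl; apply: le_trans (NB _ (xi k.+1 (grid k t).*2) _) (lerD half _).
  rewrite NBC; apply: le_trans (euler_lip H HG h0' hh' hx' x'0 sf.1 _) _.
  rewrite -gE; apply: (@le_trans _ _ (growth w T * (hstep k.+1 * N f1))).
    by rewrite ler_wpM2r ?(growth_le HG) // mulr_ge0 // ltW.
  rewrite -[leRHS]mulrA ler_wpM2l ?growth_ge0 // mulrC ler_wpM2l // hstepS.
  by lra.
- exists (T * (growth w T ^+ 2 * T * N f2 + growth w T * N f1) + growth w T * N f).
  have pos : 0 <= growth w T * N f by rewrite mulr_ge0 ?growth_ge0.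
  split=> [|k t t0 tT0].
    by rewrite addr_ge0 // mulr_ge0 // addr_ge0 // !mulr_ge0 // growth_ge0.
  have tT : t <= T by rewrite le_max tT0.
  have [x0 hx] := hxi k; have [x'0 hx'] := hxi k.+1.
  have h0 := hstep_gt0 k; have hh := hstep_le k.
  have h0' := hstep_gt0 k.+1; have hh' := hstep_le k.+1.
  have gT : hstep k * (grid k t)%:R <= T by exact: le_trans (grid_le k t0) tT.
  have gT' : hstep k.+1 * (grid k.+1 t)%:R <= T by exact: le_trans (grid_le k.+1 t0) tT.
  rewrite /fsum; have half : N (esum (hstep k) (xi k) (grid k t) -
      esum (hstep k.+1) (xi k.+1) (grid k t).*2) <=
      T * (growth w T ^+ 2 * T * N f2 + growth w T * N f1) * hstep k.
    rewrite hstepS.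
    by apply: (esum_halving H HG h0 hh sf hx _ x0 x'0 gT); rewrite -hstepS.
  have [gE|gE] := gridS k t0.
    by rewrite gE; apply: le_trans half _; rewrite ler_pM2r // lerDl.
  rewrite gE mulrDl; apply: le_trans (NB _ (esum (hstep k.+1) (xi k.+1) (grid k t).*2) _)
      (lerD half _).
  rewrite esumS NBC; set S := esum _ _ _.
  have -> : S + hstep k.+1 *: xi k.+1 (grid k t).*2.+1 - S
     = hstep k.+1 *: xi k.+1 (grid k t).*2.+1 by module_eq R.
  rewrite -gE NZ gtr0_norm // mulrC ler_pM //.
  + by rewrite ltW.
  + by apply: le_trans (euler_le h0' hh' hx' gT') _; rewrite x'0.
  + by rewrite hstepS; lra.
Qed.

(** Let f - p be orthogonal to the domain, and take x in the domain with A x = (x - (f - p)) / s.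
    Pairing with x gives |x|^2 <= s w |x|^2 <= |x|^2 / 2, so x is null, then A x, then f - p. *)
Lemma dense_domain f e : 0 < e -> exists x y, G x y /\ N (f - x) < e.
Proof.
move=> e0.
have [|a x x' [y hy] [y' hy']|p [pD porth]] :=
    @projection _ _ _ H (fun x => exists y, G x y) _ _ f.
- by exists 0; exact: gr0 HG.
- by exists (a *: y + y'); exact: (grL HG).
have s0 := step0_gt0 HG.
have [x hx] := gr_range HG (f - p) s0.
have x0 : N x = 0.
  have := porth x (ex_intro _ _ hx) => fpx.
  have := gr_diss HG hx; rewrite (ipZl H) (ipDl H) (ipNl H) fpx subr0.
  have := ip_ge0 H x; rewrite mulrC ler_pdivrMr // => x0 h.
  have := step0_small HG (lexx (step0 w)) => sw.
  have x1 : ip x x = 0 by apply/eqP; rewrite eq_le x0 andbT; nra.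
  by rewrite /hnorm x1 sqrtr0.
have fp : N (f - p) = 0.
  have := gr_null HG hx x0; rewrite NZ => /eqP; rewrite mulf_eq0 normr_eq0 invr_eq0.
  rewrite (gt_eqF s0) /= NBC => /eqP h.
  by have := hnorm_null H h; rewrite x0.
have [x' [y hy] hx'] := pD e e0; exists x', y; split => //.
apply: le_lt_trans (NB _ p _) _; by rewrite fp add0r NBC.
Qed.

(** For x in the domain the resolvent image x' tends to x as h tends to 0, and A x' = (x' - x) / h
    lies in the domain again. *)
Lemma dense_smooth f e : 0 < e -> exists x y z, smooth G x y z /\ N (f - x) < e.
Proof.
move=> e0; have [x [y [hxy hx]]] := @dense_domain f (e / 2) ltac:(by rewrite divr_gt0).
have gs : 0 < growth w (step0 w) * (N y + 1).
  by rewrite mulr_gt0 ?growth_gt0 // ltr_wpDl.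
have [K hK] := @hstep_lt (e / (2 * (growth w (step0 w) * (N y + 1)))) ltac:(by rewrite
    divr_gt0 // mulr_gt0).
have h0 := hstep_gt0 K; have hh := hstep_le K.
have [x' hx'] := gr_range HG x h0.
have hd := grB HG hx' hxy.
exists x', ((hstep K)^-1 *: (x' - x)), ((hstep K)^-1 *: ((hstep K)^-1 *: (x' - x) - y)).
split; first by split => //; exact: (grZ HG).
have := gr_contr H HG h0 hh hd.
have -> : x' - x - hstep K *: ((hstep K)^-1 *: (x' - x) - y) = hstep K *: y.
  have hn : hstep K != 0 by rewrite gt_eqF.
  module_eq R.
rewrite NZ gtr0_norm // => b.
have b2 : N (x' - x) < e / 2.
  apply: le_lt_trans b _.
  have := hK K (leqnn K); rewrite ltr_pdivlMr; last by rewrite mulr_gt0.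
  have g1 := growth_le HG hh; have y0 := Nge0 y.
  have : growth w (hstep K) * (hstep K * N y) <= hstep K * (growth w (step0 w) * (N y + 1)).
    rewrite mulrCA ler_pM2l // ler_pM ?growth_ge0 //.
    by rewrite lerDl.
  by move: (growth w (step0 w) * _) (growth w (hstep K) * _) => p q; lra.
by have := NB f x x'; rewrite (NBC x); lra.
Qed.

Lemma family_approx f xi T e : family f xi -> 0 < e -> exists f' f1 f2 xi',
  [/\ smooth G f' f1 f2, family f' xi',
   forall k n, hstep k * n%:R <= T -> N (xi k n - xi' k n) <= e &
   forall k n, hstep k * n%:R <= T ->
     N (esum (hstep k) (xi k) n - esum (hstep k) (xi' k) n) <= e].
Proof.
move=> hxi e0; pose T' := Num.max T 0.
have T'0 : 0 <= T' by rewrite le_max lexx orbT.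
have TT' : T <= T' by rewrite le_max lexx.
(* One constant for both estimates: [growth] bounds the curves, T' times [growth] their sums. *)
pose C := growth w T' * (1 + T').
have C0 : 0 < C by rewrite mulr_gt0 ?growth_gt0 // ltr_pwDl.
have [f' [f1 [f2 [sf ff']]]] := @dense_smooth f (e / C) ltac:(by rewrite divr_gt0).
have [xi' hxi'] := family_exists f'.
exists f', f1, f2, xi'; split => // k n hT; have {}hT := le_trans hT TT';
  have [x0 hx] := hxi k; have [x'0 hx'] := hxi' k;
  have hd := eulerB HG hx hx'; have h0 := hstep_gt0 k; have hh := hstep_le k;
  have {}ff' : growth w T' * N (f - f') * (1 + T') <= e by
    move: ff'; rewrite ltr_pdivlMr // /C mulrA (mulrC (N _)) => /ltW.
- apply: le_trans (euler_le h0 hh hd hT) _; rewrite /= x0 x'0; apply: le_trans ff'.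
  by rewrite ler_peMr ?lerDl // mulr_ge0 ?growth_ge0.
- have -> : esum (hstep k) (xi k) n - esum (hstep k) (xi' k) n =
    esum (hstep k) (fun n => xi k n - xi' k n) n.
    by rewrite /esum -scalerBr sumrB.
  apply: le_trans (esum_le h0 hh hd hT) _; rewrite /= x0 x'0; apply: le_trans ff'.
  by rewrite mulrC ler_wpM2l ?lerDr // mulr_ge0 ?growth_ge0.
Qed.

Lemma family_ucauchy f xi : family f xi -> ucauchy (fcurve xi) /\ ucauchy (fsum xi).
Proof.
move=> hxi; split; apply: approx_ucauchy => T e e0;
  have [f' [f1 [f2 [xi' [sf hxi' h1 h2]]]]] := family_approx T hxi e0;
  have [c1 c2] := smooth_ucauchy sf hxi'.
- by exists (fcurve xi'); split => // k t t0 tT; apply: h1; exact: le_trans (grid_le k t0) tT.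
- by exists (fsum xi'); split => // k t t0 tT; apply: h2; exact: le_trans (grid_le k t0) tT.
Qed.

(** Closedness comes from the resolvent: the solution z of z - s A z = x - s y is compared with x'
    by the stability estimate. The limit x may lie outside the domain, but z is at null distance
    from it. *)
Lemma gr_closed x y :
  (forall e, 0 < e -> exists x' y', [/\ G x' y', N (x' - x) <= e & N (y' - y) <= e]) ->
  exists2 z, N (z - x) = 0 & G z y.
Proof.
move=> h; have s0 := step0_gt0 HG; set s := step0 w in s0.
have sn : s != 0 by rewrite gt_eqF.
have [z hz] := gr_range HG (x - s *: y) s0.
suff zx : N (z - x) = 0.
  exists z => //; apply: (gr_ext HG hz).
  have -> : s^-1 *: (z - (x - s *: y)) - y = s^-1 *: (z - x) by module_eq R.
  by rewrite NZ zx mulr0.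
apply/eqP; rewrite eq_le Nge0 andbT; apply: le_eps => e e0; rewrite add0r.
(* The first summand bounds [x' - z], the last unit accounts for [x' - x]. *)
pose C := growth w s * (1 + s) + 1.
have C0 : 0 < C by rewrite ltr_wpDl // mulr_ge0 ?growth_ge0 // addr_ge0 // ltW.
have [x' [y' [hxy hx hy]]] := h (e / C) ltac:(by rewrite divr_gt0).
have := gr_contr H HG s0 (lexx _) (grB HG hxy hz).
have -> : x' - z - s *: (y' - s^-1 *: (z - (x - s *: y))) = (x' - x) - s *: (y' - y).
  by module_eq R.
move=> b; have := ND (x' - x) (- (s *: (y' - y))); rewrite (hnormN H) NZ gtr0_norm // => b'.
have : N (x' - z) <= growth w s * ((1 + s) * (e / C)).
  apply: le_trans b _; rewrite ler_wpM2l ?growth_ge0 //; apply: le_trans b' _.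
  by rewrite mulrDl mul1r lerD // ler_pM2l.
have := NB z x' x; rewrite (NBC z x') => h2 h3.
have eC : e = growth w s * ((1 + s) * (e / C)) + e / C.
  by rewrite /C in C0 *; field; rewrite gt_eqF.
by rewrite eC; apply: le_trans h2 _; rewrite lerD -?eC.
Qed.

Definition ucontinuous U := forall T e, 0 < e -> exists2 d, 0 < d &
  forall a b, 0 <= a -> a <= T -> 0 <= b -> b <= T -> `|a - b| < d ->
  N (U a - U b) <= e.

(** The relation W' = U with an error uniform on [0, T] and U taken at any intermediate point. This
    one form yields Riemann sums, differentiability and the small local errors of the uniqueness
    proof. *)
Definition primitive U W := forall T e, 0 < e -> exists2 d, 0 < d &
  forall a c b, 0 <= a -> a <= c -> c <= b -> b <= T -> b - a < d ->
  N (W b - W a - (b - a) *: U c) <= e * (b - a).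

Lemma euler_lipschitz h f f1 x T n m : 0 < h -> h <= step0 w -> euler G h x ->
  x 0%N = f -> G f f1 -> h * n%:R <= T -> h * m%:R <= T ->
  N (x n - x m) <= `|h * n%:R - h * m%:R| * (growth w T * N f1).
Proof.
move=> h0 hh hx x0 Gf; wlog mn : n m / (m <= n)%N.
  move=> hw hn hm; have [mn|nm] := leqP m n; first exact: hw.
  by rewrite NBC distrC; apply: hw => //; exact: ltnW.
move=> hn _; rewrite ger0_norm; last by rewrite subr_ge0 ler_pM2l // ler_nat.
elim: n mn hn => [|n IH]; first by rewrite leqn0 => /eqP -> _; rewrite !subrr (hnorm0 H) mul0r.
rewrite leq_eqVlt => /orP [/eqP -> _|mn hn]; first by rewrite !subrr (hnorm0 H) mul0r.
have hn' : h * n%:R <= T by apply: le_trans hn; rewrite ler_pM2l // ler_nat.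
apply: le_trans (NB _ (x n) _) _.
have -> : h * n.+1%:R - h * m%:R = h + (h * n%:R - h * m%:R) by rewrite -natr1; ring.
rewrite mulrDl lerD ?IH //.
apply: le_trans (euler_lip H HG h0 hh hx x0 Gf n) _.
rewrite mulrCA ler_pM2l // ler_wpM2r //; exact: (growth_le HG).
Qed.

(** After replacing the datum by a smooth one, with an error uniform in k, the schemes are Lipschitz
    on their grids with a constant independent of k. *)
Lemma family_ucontinuous f xi U : family f xi -> ulim (fcurve xi) U -> ucontinuous U.
Proof.
move=> hxi hU T e e0.
have [f' [f1 [f2 [xi' [sf hxi' h1 _]]]]] := @family_approx f xi T (e / 8) hxi ltac:(by
    rewrite divr_gt0).
pose C := growth w T * N f1 + 1.
have C0 : 0 < C by rewrite ltr_wpDl // mulr_ge0 ?growth_ge0.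
(* The grid points of a and b are at distance at most |a - b| + 2 [hstep k], below 3 (e / 8 / C);
   with four approximation errors e / 8 the total stays below e. *)
exists (e / 8 / C) => [|a b a0 aT b0 bT ab]; first by rewrite !divr_gt0.
have [K1 hK1] := hU T (e / 8) ltac:(by rewrite divr_gt0).
have [K2 hK2] := @hstep_lt (e / 8 / C) ltac:(by rewrite !divr_gt0).
pose k := maxn K1 K2; have kK1 : (K1 <= k)%N := leq_maxl _ _.
have hk := hK2 k (leq_maxr _ _).
have ha := hK1 k a kK1 a0 aT; have hb := hK1 k b kK1 b0 bT.
have ga := le_trans (grid_le k a0) aT; have gb := le_trans (grid_le k b0) bT.
have na := grid_near k a0; have nb := grid_near k b0.
rewrite /fcurve in ha hb.
have fa := h1 _ _ ga; have fb := h1 _ _ gb.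
have [x0 hx] := hxi' k.
have := euler_lipschitz (hstep_gt0 k) (hstep_le k) hx x0 sf.1 ga gb.
have dist : `|hstep k * (grid k a)%:R - hstep k * (grid k b)%:R| <= 3 * (e / 8 / C).
  move: na nb hk ab; rewrite !ler_norml !ltr_norml => /andP[p1 p2] /andP[p3 p4] p5 /andP[p6 p7].
  by apply/andP; split; lra.
have C1 : growth w T * N f1 <= C by rewrite lerDl.
have := ler_pM (normr_ge0 _) (mulr_ge0 (growth_ge0 _ _) (Nge0 _)) dist C1.
have -> : 3 * (e / 8 / C) * C = 3 * (e / 8) by field; rewrite gt_eqF.
move=> l1 l2; have lip := le_trans l2 l1.
set u := xi k _ in ha fa; set v := xi k _ in hb fb.
set u' := xi' k _ in fa lip; set v' := xi' k _ in fb lip.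
have := NB (U a) u (U b); have := NB u u' (U b); have := NB u' v' (U b).
have := NB v' v (U b); rewrite (NBC v' v) (NBC (U a) u).
by lra.
Qed.

Lemma esum_diff h x n (d : nat) v e : 0 < h ->
  (forall i, (i < d)%N -> N (x (n + i).+1 - v) <= e) ->
  N (esum h x (n + d)%N - esum h x n - (h * d%:R) *: v) <= h * d%:R * e.
Proof.
move=> h0; elim: d => [|d IH] hd.
  by rewrite addn0 mulr0 scale0r subr0 subrr (hnorm0 H) mul0r.
rewrite addnS esumS -natr1 mulrDr mulr1.
have -> : esum h x (n + d)%N + h *: x (n + d).+1 - esum h x n - (h * d%:R + h) *: v =
  (esum h x (n + d)%N - esum h x n - (h * d%:R) *: v) + h *: (x (n + d).+1 - v).
  by module_eq R.
apply: le_trans (ND _ _) _; rewrite mulrDl lerD ?IH //.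
  by move=> i id; apply: hd; rewrite ltnS ltnW.
by rewrite NZ gtr0_norm // ler_pM2l // hd.
Qed.

Lemma family_primitive xi U W : ucontinuous U ->
  ulim (fcurve xi) U -> ulim (fsum xi) W -> primitive U W.
Proof.
move=> cU hU hW T e e0; have [d d0 hd] := cU T e e0.
exists d => // a c b a0 ac cb bT ba.
have c0 := le_trans a0 ac; have b0 := le_trans c0 cb; have aT := le_trans (le_trans ac cb) bT.
have cT := le_trans cb bT; have ab := le_trans ac cb.
(* [h] bounds the grid spacing and both approximation errors; it tends to zero at the end, for fixed
   a, b, c. *)
have key h : 0 < h -> N (W b - W a - (b - a) *: U c) <=
    2 * h + (b - a + h) * (h + e) + h * N (U c).
  move=> h0; have [K1 hK1] := hU T h h0; have [K2 hK2] := hW T h h0.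
  have [K3 hK3] := hstep_lt h0.
  pose k := maxn K1 (maxn K2 K3).
  have kK1 : (K1 <= k)%N := leq_maxl _ _.
  have kK2 : (K2 <= k)%N by rewrite leq_max leq_maxl orbT.
  have kK3 : (K3 <= k)%N by rewrite leq_max leq_maxr orbT.
  have hk := hK3 k kK3; have hk0 := hstep_gt0 k.
  have nm := grid_mono k ab; set n := grid k a in nm; set m := grid k b in nm.
  have sb := hK2 k b kK2 b0 bT; have sa := hK2 k a kK2 a0 aT; rewrite /fsum -/n -/m in sa sb.
  have p1 := grid_le k a0; have p2 := grid_gt k a; have p3 := grid_le k b0; have p4 := grid_gt k b.
  rewrite -/n -/m in p1 p2 p3 p4.
  have := @esum_diff (hstep k) (xi k) n (m - n) (U c) (h + e) hk0.
  rewrite subnKC // natrB // => /(_ _) hs.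
  have {}hs : N (esum (hstep k) (xi k) m - esum (hstep k) (xi k) n - (hstep k * (m%:R -
      n%:R)) *: U c)
      <= hstep k * (m%:R - n%:R) * (h + e).
    apply: hs => i; rewrite ltn_subRL => im.
    (* The increments from [n] to [m] sample U at grid times in ]a, b], all closer to c than d. *)
    pose t := hstep k * (n + i).+1%:R.
    have ta : a < t.
      by apply: lt_le_trans p2 _; rewrite ler_pM2l // ler_nat ltnS leq_addr.
    have tb : t <= b by apply: le_trans p3; rewrite ler_pM2l // ler_nat.
    have t0 : 0 <= t by apply: le_trans a0 (ltW ta).
    have := hK1 k t kK1 t0 (le_trans tb bT); rewrite /fcurve grid_nat => u1.
    have u2 : N (U t - U c) <= e.
      apply: hd => //; first exact: le_trans tb bT.
      by rewrite ltr_norml; apply/andP; split; lra.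
    by apply: le_trans (NB _ (U t) _) (lerD u1 u2).
  move: p2 p4 hs; rewrite -(natr1 n) -(natr1 m) !(mulrDr (hstep k) _ 1) !mulr1 mulrBr => p2 p4.
  set q := hstep k * m%:R - hstep k * n%:R => hs.
  have q1 : `|q - (b - a)| <= h by rewrite /q ler_norml; apply/andP; split; lra.
  have q2 : q <= b - a + h by move: q1; rewrite ler_norml => /andP[]; lra.
  have -> : W b - W a - (b - a) *: U c =
     - (esum (hstep k) (xi k) m - W b) + (esum (hstep k) (xi k) n - W a) +
     (esum (hstep k) (xi k) m - esum (hstep k) (xi k) n - q *: U c) +
     (q - (b - a)) *: U c by module_eq R.
  apply: le_trans (ND _ _) _; apply: lerD; last first.
    by rewrite NZ ler_wpM2r.
  apply: le_trans (ND _ _) _; apply: lerD; last first.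
    apply: le_trans hs _; apply: ler_wpM2r q2.
    by apply: addr_ge0; exact: ltW.
  apply: le_trans (ND _ _) _; rewrite (hnormN H); lra.
apply: le_eps => s s0.
pose C := 3 + (b - a) + e + N (U c).
have C0 : 0 < C by have := Nge0 (U c); rewrite /C; lra.
pose h := Num.min 1 (s / C).
have h0 : 0 < h by rewrite lt_min ltr01 divr_gt0.
have h1 : h <= 1 by rewrite ge_min lexx.
have hC : h * C <= s by rewrite -ler_pdivlMr // ge_min lexx orbT.
apply: le_trans (key h h0) _; rewrite /C in hC.
have : h * h <= h by rewrite ger_pMr.
by move: hC; rewrite !mulrDr !mulrDl; lra.
Qed.

Theorem mild_family f xi : family f xi -> exists U W,
  [/\ ulim (fcurve xi) U, ulim (fsum xi) W, ucontinuous U, primitive U W &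
      forall t, 0 <= t -> G (W t) (U t - f)].
Proof.
move=> hxi; have [c1 c2] := family_ucauchy hxi.
have [U hU] := ucauchy_lim c1; have [W0 hW0] := ucauchy_lim c2.
(* The limit [W0] of the sums may lie outside the domain; it is corrected by null vectors. *)
have [W hW] : exists W : R -> E, forall t, 0 <= t ->
    N (W t - W0 t) = 0 /\ G (W t) (U t - f).
  suff /choice [W hW] : forall t, exists z, 0 <= t ->
    N (z - W0 t) = 0 /\ G z (U t - f) by exists W.
  move=> t; have [t0|t0] := leP 0 t; last by exists 0.
  have [|z zW Gz] := @gr_closed (W0 t) (U t - f); last by exists z.
  move=> e e0; have [K1 hK1] := hU t e e0; have [K2 hK2] := hW0 t e e0.
  pose k := maxn K1 K2.
  exists (fsum xi k t), (fcurve xi k t - f); split.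
  - by have [<- hx] := hxi k; apply: (gr_esum HG) => //; exact: hstep_gt0.
  - by apply: hK2 => //; exact: leq_maxr.
  - rewrite opprB addrA subrK; apply: hK1 => //; exact: leq_maxl.
have hW' : ulim (fsum xi) W.
  move=> T e e0; have [K hK] := hW0 T e e0; exists K => k t Kk t0 tT.
  apply: le_trans (NB _ (W0 t) _) _; rewrite (NBC (W0 t)) (hW t t0).1 addr0.
  exact: hK.
have cU := family_ucontinuous hxi hU.
exists U, W; split => //; first exact: family_primitive hW'.
by move=> t t0; case: (hW t t0).
Qed.

Lemma fsum0 xi W : ulim (fsum xi) W -> N (W 0) = 0.
Proof.
move=> hW; apply/eqP; rewrite eq_le Nge0 andbT; apply: le_eps => e e0.
have [K hK] := hW 0 e e0; have := hK K 0 (leqnn _) (lexx _) (lexx _).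
have g0 : grid K 0 = 0%N by have := grid_nat K 0; rewrite mulr0.
by rewrite /fsum g0 esum0 sub0r (hnormN H) add0r.
Qed.

Lemma ulim_unique Y U U' t : ulim Y U -> ulim Y U' -> 0 <= t -> N (U t - U' t) = 0.
Proof.
move=> h h' t0; apply/eqP; rewrite eq_le Nge0 andbT; apply: le_eps => e e0.
have [K hK] := h t (e / 2) ltac:(by rewrite divr_gt0).
have [K' hK'] := h' t (e / 2) ltac:(by rewrite divr_gt0).
pose k := maxn K K'.
have := hK k t (leq_maxl _ _) t0 (lexx _); have := hK' k t (leq_maxr _ _) t0 (lexx _).
by have := NB (U t) (Y k t) (U' t); rewrite (NBC (U t) (Y k t)); lra.
Qed.

(* For f in the domain, f + int U' is a limit of Euler schemes when U' is the
   limit of the schemes started at Af. *)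
Theorem generation f : exists U W, [/\ ucontinuous U, primitive U W, N (W 0) = 0,
  forall t, 0 <= t -> G (W t) (U t - f) &
  forall g, G f g -> exists U', [/\ ucontinuous U', primitive U' U &
    forall t, 0 <= t -> G (U t) (U' t)]].
Proof.
have [[g Gfg]|nD] := pselect (exists g, G f g); last first.
  have [xi hxi] := family_exists f; have [U [W [hU hW cU pU GW]]] := mild_family hxi.
  exists U, W; split => //; first exact: fsum0 hW.
  by move=> g Gfg; case: nD; exists g.
have [eta heta] := family_exists g; have [U' [W' [hU' hW' cU' pU' GW']]] := mild_family heta.
pose xi k n := f + esum (hstep k) (eta k) n.
have hxi : family f xi.
  move=> k; have [e0 he] := heta k; rewrite /xi esum0 addr0; split => //.
  by apply: (euler_lift HG) => //; [exact: hstep_gt0|rewrite e0].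
have [U1 [W [hU1 hW cU1 pU1 GW]]] := mild_family hxi.
(* [U1] and this curve are limits of the same schemes, hence equal up to null vectors; here the
   increments are exactly those of W'. *)
pose U t := f + W' t.
have hU : ulim (fcurve xi) U.
  move=> T e e0; have [K hK] := hW' T e e0; exists K => k t Kk t0 tT.
  rewrite /fcurve /xi /U.
  have -> : f + esum (hstep k) (eta k) (grid k t) - (f + W' t) = fsum eta k t - W' t.
    by rewrite /fsum; module_eq R.
  exact: hK.
have UU1 t : 0 <= t -> N (U1 t - U t) = 0 by move=> t0; exact: ulim_unique hU1 hU t0.
have cU := family_ucontinuous hxi hU.
exists U, W; split => //.
- exact: family_primitive hW.
- exact: fsum0 hW.
- move=> t t0; apply: (gr_ext HG (GW t t0)); rewrite opprB addrA subrK; exact: UU1.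
move=> g' Gfg'; exists U'; split => //.
- move=> T e e0; have [d d0 hd] := pU' T e e0; exists d => // a c b a0 ac cb bT ba.
  have -> : U b - U a = W' b - W' a by rewrite /U; module_eq R.
  exact: hd.
- move=> t t0; rewrite /U; have := grD HG Gfg (GW' t t0).
  by rewrite [g + _]addrC subrK.
Qed.

(** As W is a primitive, the samples W(i h) solve the implicit scheme from W 0 with local errors
    o(h), uniformly in i. Their sum tends to zero, so W t is null, and U t with it. *)
Theorem mild_unique U W t : primitive U W -> N (W 0) = 0 ->
  (forall t, 0 <= t -> G (W t) (U t)) -> 0 <= t -> N (U t) = 0.
Proof.
move=> pU W0 GW t0; apply: (gr_null HG (GW t t0)).
have [->//|tn] := eqVneq t 0.
have {t0 tn} t0 : 0 < t by rewrite lt_neqAle eq_sym tn.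
apply/eqP; rewrite eq_le Nge0 andbT; apply: le_eps => e e0; rewrite add0r.
pose C := growth w t * t; have C0 : 0 < C by rewrite mulr_gt0 ?growth_gt0.
have [d d0 hd] := pU t (e / C) ltac:(by rewrite divr_gt0).
(* With h = t / (K+1) and 1 / (K+1) < d', the step is below both the modulus d and [step0]. *)
pose d' := Num.min d (step0 w) / t.
have d'0 : 0 < d' by rewrite divr_gt0 // lt_min d0 (step0_gt0 HG).
have [K hK] := harmonic_lt d'0; have {hK} := hK K (leqnn K).
rewrite ltr_pdivlMr // lt_min => /andP[].
set h := _ * t => hd0 hs.
have h0 : 0 < h by rewrite mulr_gt0 // invr_gt0.
have hK : h * K.+1%:R = t by rewrite /h mulrAC mulVf ?mul1r // pnatr_eq0.
pose x i := W (h * (minn i K.+1)%:R).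
pose e' i := if (i < K.+1)%N then x i.+1 - x i - h *: U (h * i.+1%:R)
             else 0.
have [y [y0 hy]] := euler_exists HG (x K.+1) h0.
(* [perturbed_euler] wants an infinite sequence: past time t the samples are continued by an exact
   scheme with zero error. *)
pose x' i := if (i <= K.+1)%N then x i else y (i - K.+1)%N.
have := @perturbed_euler _ _ _ H _ _ HG h x' e' h0 (ltW hs) _ K.+1.
have -> : x' K.+1 = W t by rewrite /x' leqnn /x minnn hK.
have -> : x' 0%N = W 0 by rewrite /x' /x min0n mulr0.
rewrite W0 add0r hK => b.
have {b} : N (W t) <= growth w t * (\sum_(i < K.+1) N (e' i)).
  apply: b => n; rewrite /x' /e'; case: ltnP => nK.
    rewrite (ltnW nK) (_ : x n.+1 = W (h * n.+1%:R)); last by rewrite /x (minn_idPl nK).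
    have -> : h^-1 *: (W (h * n.+1%:R) - x n - (W (h * n.+1%:R) - x n - h *: U (h * n.+1%:R)))
      = U (h * n.+1%:R).
      have hn : h != 0 by rewrite gt_eqF.
      module_eq R.
    by apply: GW; rewrite mulr_ge0 // ltW.
  rewrite subSn // subr0; case: leqP => [nK'|nK'].
    have -> : n = K.+1 by apply/eqP; rewrite eqn_leq nK nK'.
    by rewrite subnn -y0; exact: hy.
  exact: hy.
move=> /le_trans; apply.
have b i : (i < K.+1)%N -> N (e' i) <= e / C * h.
  move=> iK; rewrite /e' iK /x (minn_idPl iK) (minn_idPl (ltnW iK)).
  have dh : h * i.+1%:R - h * i%:R = h by rewrite -natr1; ring.
  have := hd (h * i%:R) (h * i.+1%:R) (h * i.+1%:R); rewrite dh; apply => //.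
  - by rewrite mulr_ge0 // ltW.
  - by rewrite ler_pM2l // ler_nat.
  - by rewrite -hK ler_pM2l // ler_nat.
have : \sum_(i < K.+1) N (e' i) <= \sum_(i < K.+1) (e / C * h).
  by apply: ler_sum => i _; exact: b.
rewrite sumr_const card_ord -[X in _ <= X -> _]mulr_natr -mulrA hK => s1.
apply: (@le_trans _ _ (growth w t * (e / C * t))); first by rewrite ler_pM2l ?growth_gt0.
by rewrite mulrCA -/C divfK // gt_eqF.
Qed.

End MildSolutions.

(** * Curves in seminormed spaces *)

Section Curves.
Variables (R : realType) (V : lmodType R) (M : V -> R).
Hypothesis M_ge0 : forall x, 0 <= M x.
Implicit Types (t s e d : R) (U : R -> V).

Lemma continuous_curveP U : continuous_curve M U <->
  (forall t e, 0 <= t -> 0 < e -> exists2 d, 0 < d &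
     forall s, 0 <= s -> `|s - t| < d -> M (U s - U t) < e).
Proof.
split=> [h t e t0 e0|h t t0].
  have := h t t0; move=> /cvgrPdist_lt /(_ e e0).
  rewrite near_withinE => /nbhs_ballP[d /= d0 hd]; exists d => // s s0 st.
  have := hd s; rewrite /ball /= distrC => /(_ st).
  rewrite in_itv /= andbT s0 => /(_ isT).
  by rewrite sub0r normrN ger0_norm.
apply/cvgrPdist_lt => e e0; rewrite near_withinE; apply/nbhs_ballP.
have [d d0 hd] := h t e t0 e0; exists d => //= s; rewrite /ball /= distrC => st.
rewrite in_itv /= andbT => s0; rewrite sub0r normrN ger0_norm //.
exact: hd.
Qed.

Lemma derivative_curveP U U' :
  (forall t e, 0 <= t -> 0 < e -> exists2 d, 0 < d &
     forall s, 0 <= s -> s != t -> `|s - t| < d ->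
       M ((s - t)^-1 *: (U s - U t) - U' t) < e) -> derivative_curve M U U'.
Proof.
move=> h t t0; apply/cvgrPdist_lt => e e0; rewrite near_withinE; apply/nbhs_ballP.
have [d d0 hd] := h t e t0 e0; exists d => //= s; rewrite /ball /= distrC => st.
move=> [/=]; rewrite in_itv /= andbT => s0 /eqP sn; rewrite sub0r normrN ger0_norm //.
exact: hd.
Qed.

(** Heine's theorem from compactness of [0, T] in near-covering form, with the modulus running along
    [0^'+]. *)
Lemma continuous_curve_uniform U : (forall x y, M (x + y) <= M x + M y) ->
  (forall x, M (- x) = M x) -> continuous_curve M U ->
  forall T e, 0 < e -> exists2 d, 0 < d &
  forall a b, 0 <= a -> a <= T -> 0 <= b -> b <= T -> `|a - b| < d ->
  M (U a - U b) <= e.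
Proof.
move=> MD MN /continuous_curveP cU T e e0.
have := @segment_compact R 0 T; move=> /compact_near_coveringP.
move=> /(_ R (0^'+) (fun d x => 0 <= x -> forall y, 0 <= y -> `|x - y| < d ->
   M (U x - U y) <= e)) [].
  move=> x /=; rewrite in_itv /= => /andP[x0 xT].
  have [d d0 hd] := cU x (e / 2) x0 ltac:(by rewrite divr_gt0).
  near=> x' i => /= x'0 y y0 x'y.
  have h1 : `|x' - x| < d / 2.
    rewrite distrC; near: x'; apply: (@cvgr_dist_lt _ _ _ _ _ id) => //.
    by rewrite divr_gt0.
  have h2 : i < d / 2 by near: i; apply: nbhs_right_lt; rewrite divr_gt0.
  have k1 := hd x' x'0 ltac:(by move: h1; lra).
  have yx : `|y - x| < d.
    have := ler_normD (y - x') (x' - x); rewrite subrKA (distrC y x') => h3.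
    by apply: le_lt_trans h3 _; lra.
  have k2 := hd y y0 yx.
  have -> : U x' - U y = (U x' - U x) + - (U y - U x) by module_eq R.
  by apply: le_trans (MD _ _) _; rewrite MN; lra.
move=> d /= d0 hd; exists (d / 2); first by rewrite divr_gt0.
move=> a b a0 aT b0 bT ab; apply: (hd (d / 2)) => //.
- by rewrite /= sub0r normrN ger0_norm ?divr_ge0 // ?ltW //; lra.
- by rewrite divr_gt0.
- by rewrite /= in_itv /= a0.
Unshelve. all: by end_near. Qed.

End Curves.

(** * Transfer of curves along a linear map with two-sided norm bounds *)

Section Transfer.
Variables (R : realType) (E V : lmodType R) (ip : E -> E -> R) (M : V -> R).
Hypothesis H : semi_hilbert ip.
Local Notation N := (hnorm ip).
Variables (phi : {linear E -> V}) (C : R).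
Hypothesis M_ge0 : forall x, 0 <= M x.
Hypothesis C0 : 0 < C.
Hypothesis MN : forall x, M (phi x) <= C * N x.
Hypothesis NM : forall x, N x <= C * M (phi x).
Implicit Types (U W : R -> E) (X Y : R -> V) (T t s e d a b c : R).

Let NB := ler_hnormB H.
Let ND := ler_hnormD H.
Let NZ := hnormZ H.
Let NBC := hnormBC H.

Lemma ucontinuous_curve U : ucontinuous ip U -> continuous_curve M (fun t => phi (U t)).
Proof.
move=> cU; apply/continuous_curveP => // t e t0 e0.
have [d d0 hd] := cU (t + 1) (e / (2 * C)) ltac:(by rewrite divr_gt0 // mulr_gt0).
exists (Num.min d 1); first by rewrite lt_min d0 ltr01.
move=> s s0; rewrite lt_min => /andP[sd s1]; rewrite -linearB.
apply: le_lt_trans (MN _) _; rewrite mulrC -ltr_pdivlMr //.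
apply: le_lt_trans (hd s t s0 _ t0 _ sd) _.
- by move: s1; rewrite ltr_norml => /andP[]; lra.
- by rewrite lerDl.
- by rewrite ltr_pM2l // ltf_pV2 ?posrE ?mulr_gt0 // ltr_pMl // ltr1n.
Qed.

(** The intermediate point in [primitive] may be an endpoint, so the choice c = t covers both s < t
    and s > t. *)
Lemma primitive_derivative U W : primitive ip U W ->
  derivative_curve M (fun t => phi (W t)) (fun t => phi (U t)).
Proof.
move=> pU; apply: derivative_curveP => // t e t0 e0.
have [d d0 hd] := pU (t + 1) (e / (2 * C)) ltac:(by rewrite divr_gt0 // mulr_gt0).
exists (Num.min d 1); first by rewrite lt_min d0 ltr01.
move=> s s0 sn; rewrite lt_min => /andP[sd s1].
rewrite -linearB -linearZ -linearB.
apply: le_lt_trans (MN _) _; rewrite mulrC -ltr_pdivlMr //.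
suff le : N ((s - t)^-1 *: (W s - W t) - U t) <= e / (2 * C).
  by apply: le_lt_trans le _; rewrite ltr_pM2l // ltf_pV2 ?posrE ?mulr_gt0 // ltr_pMl // ltr1n.
have st0 : s - t != 0 by rewrite subr_eq0.
have -> : (s - t)^-1 *: (W s - W t) - U t = (s - t)^-1 *: (W s - W t - (s - t) *: U t).
  by module_eq R.
rewrite NZ normfV -ler_pdivlMl ?invr_gt0 ?normr_gt0 // invrK mulrC.
have [st|ts] := ltP s t.
  rewrite ltr0_norm ?subr_lt0 //.
  have -> : W s - W t - (s - t) *: U t = - (W t - W s - (t - s) *: U t) by module_eq R.
  rewrite (hnormN H) opprB; apply: hd => //.
  - exact: ltW.
  - by rewrite lerDl.
  - by move: sd; rewrite ltr_norml => /andP[]; lra.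
rewrite ger0_norm ?subr_ge0 //; apply: hd => //.
- by move: s1; rewrite ltr_norml => /andP[]; lra.
- by move: sd; rewrite ltr_norml => /andP[]; lra.
Qed.

Lemma primitive_integral U W t : primitive ip U W -> N (W 0) = 0 -> 0 <= t ->
  is_integral M (fun t => phi (U t)) t (phi (W t)).
Proof.
(* t + 1 instead of t keeps the denominator positive at t = 0 and the final inequality strict. *)
move=> pU W0 t0 e e0; pose e' := e / (C * (t + 1)).
have Ct : 0 < C * (t + 1) by rewrite mulr_gt0 // ltr_wpDl.
have e'0 : 0 < e' by rewrite divr_gt0.
have [d d0 hd] := pU t e' e'0; exists d => // n s c s0 sn hs.
have smono i : (i <= n)%N -> 0 <= s i /\ s i <= t.
  move=> iN; split.
    elim: i iN => [|i IH] iN; first by rewrite s0.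
    by have [h1 h2 _] := hs i iN; apply: le_trans (le_trans (IH (ltnW iN)) h1) h2.
  have mono k : (i + k <= n)%N -> s i <= s (i + k)%N.
    elim: k => [|k IH]; first by rewrite addn0.
    rewrite addnS => ikn; apply: le_trans (IH (ltnW ikn)) _.
    by have [h1 h2 _] := hs _ ikn; exact: le_trans h1 h2.
  by have := mono (n - i)%N; rewrite subnKC // sn; exact.
have -> : \sum_(i < n) (s i.+1 - s i) *: phi (U (c i)) - phi (W t) =
    phi (\sum_(i < n) (s i.+1 - s i) *: U (c i) - W t).
  by rewrite linearB linear_sum; congr (_ - _); apply: eq_bigr => i _; rewrite linearZ.
apply: le_lt_trans (MN _) _; rewrite mulrC -ltr_pdivlMr //.
have tel k : (k <= n)%N ->
    N (\sum_(i < k) (s i.+1 - s i) *: U (c i) - (W (s k) - W 0)) <= e' * s k.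
  elim: k => [|k IH] kn.
    by rewrite big_ord0 s0 subrr subr0 (hnorm0 H) mulr0.
  rewrite big_ord_recr /=; set S := \sum_(_ < _) _ in IH *.
  have -> : S + (s k.+1 - s k) *: U (c k) - (W (s k.+1) - W 0) =
    (S - (W (s k) - W 0)) + - (W (s k.+1) - W (s k) - (s k.+1 - s k) *: U (c k)).
    by module_eq R.
  apply: le_trans (ND _ _) _; rewrite (hnormN H).
  have [h1 h2 h3] := hs k kn.
  have := hd (s k) (c k) (s k.+1) (smono k (ltnW kn)).1 h1 h2 (smono _ kn).2 h3.
  by have := IH (ltnW kn); rewrite mulrBr; lra.
have := tel n (leqnn n); rewrite sn => le1.
set S := \sum_(_ < _) _ in le1 *.
have := ND (S - (W t - W 0)) (- W 0); rewrite (hnormN H) W0 addr0.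
have -> : S - (W t - W 0) + - W 0 = S - W t by module_eq R.
move=> le2; apply: le_lt_trans (le_trans le2 le1) _.
by rewrite /e' invfM mulrA -mulrA gtr_pMr ?divr_gt0 // ltr_pdivrMl ?ltr_wpDl // mulr1 ltrDl.
Qed.

Lemma curve_ucontinuous X U : (forall t, 0 <= t -> X t = phi (U t)) ->
  continuous_curve M X -> ucontinuous ip U.
Proof.
move=> XU cX; apply: continuous_curve_uniform => //.
- exact: hnorm_ge0.
- exact: hnormN.
apply/continuous_curveP; first exact: hnorm_ge0.
move=> t e t0 e0; move/continuous_curveP : cX => /(_ M_ge0 t (e / C) t0).
case; first by rewrite divr_gt0.
move=> d d0 hd; exists d => // s s0 st; apply: le_lt_trans (NM _) _.
by rewrite linearB mulrC -ltr_pdivlMr // -!XU // hd.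
Qed.

(** Only integrals over [0, t] are given. The increment over [a, b] is read off Riemann sums over
    [0, a] and [0, b] that share their partition of [0, a]. *)
Lemma integral_primitive X Y U W : (forall t, 0 <= t -> X t = phi (U t)) ->
  (forall t, 0 <= t -> Y t = phi (W t)) -> ucontinuous ip U ->
  (forall t, 0 <= t -> is_integral M X t (Y t)) -> primitive ip U W /\ N (W 0) = 0.
Proof.
move=> XU YW cU hI; split; last first.
  apply/eqP; rewrite eq_le hnorm_ge0 andbT; apply: le_eps => e e0; rewrite add0r.
  have [d d0 hd] := hI 0 (lexx _) (e / C) ltac:(by rewrite divr_gt0).
  (* At t = 0 the partition without intervals is admissible and its sum is zero, so Y 0 is null. *)
  have := hd 0%N (fun=> 0) (fun=> 0) erefl erefl => /(_ ltac:(by [])).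
  rewrite big_ord0 sub0r YW // -linearN ltr_pdivlMr // mulrC => /ltW h.
  by apply: le_trans h; rewrite -(hnormN H).
move=> T e e0; have [d d0 hd] := cU T e e0; exists d => // a c b a0 ac cb bT ba.
have c0 := le_trans a0 ac; have b0 := le_trans c0 cb; have ab := le_trans ac cb.
have aT := le_trans ab bT; have cT := le_trans cb bT.
apply: le_eps => eta eta0.
have [d1 d10 hd1] := hI a a0 (eta / (2 * C)) ltac:(by rewrite divr_gt0 // mulr_gt0).
have [d2 d20 hd2] := hI b b0 (eta / (2 * C)) ltac:(by rewrite divr_gt0 // mulr_gt0).
pose dm := Num.min d1 d2; have dm0 : 0 < dm by rewrite lt_min d10.
have b10 : 0 < b + 1 by rewrite ltr_wpDl.
have [K hK] := @harmonic_lt R (dm / (b + 1)) ltac:(by rewrite divr_gt0).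
have {hK} := hK K (leqnn K); rewrite ltr_pdivlMr // => hK.
set n := K.+1 in hK; have n0 : (n%:R : R) != 0 by rewrite pnatr_eq0.
have ni0 : 0 < n%:R^-1 :> R by rewrite invr_gt0 ltr0n.
(* n equal intervals on [0, a] followed by n equal intervals on [a, b]. *)
pose s i := if (i <= n)%N then a * i%:R / n%:R else a + (b - a) * (i - n)%:R / n%:R.
have s_lo i : (i <= n)%N -> s i = a * i%:R / n%:R by move=> h; rewrite /s h.
have s_hi i : s (n + i)%N = a + (b - a) * i%:R / n%:R.
  rewrite /s; case: ifP => h; last by rewrite addKn.
  have -> : i = 0%N by move: h; rewrite -{2}(addn0 n) leq_add2l leqn0 => /eqP.
  by rewrite addn0 mulfK // mulr0 mul0r addr0.
have ds_lo i : (i < n)%N -> s i.+1 - s i = a / n%:R.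
  by move=> h; rewrite !s_lo // ?(ltnW h) // -natr1; field.
have ds_hi i : s (n + i).+1 - s (n + i)%N = (b - a) / n%:R.
  by rewrite -addnS !s_hi -natr1; field.
have small x : 0 <= x -> x <= b -> x / n%:R < dm.
  move=> x0 xb; apply: le_lt_trans hK; rewrite mulrC ler_pM2l //.
  by apply: le_trans xb _; rewrite lerDl.
have hmesh x : x / n%:R < dm -> x / n%:R < d1 /\ x / n%:R < d2.
  by rewrite lt_min => /andP.
have s0 : s 0%N = 0 by rewrite s_lo // mulr0 mul0r.
have I1 := hd1 n s s s0; have I2 := hd2 (n + n)%N s s s0.
have {}I1 := I1 ltac:(by rewrite s_lo // mulfK).
have {}I2 := I2 ltac:(by rewrite s_hi mulfK // addrC subrK).
have {}I1 : M (\sum_(i < n) (s i.+1 - s i) *: X (s i) - Y a) < eta / (2 * C).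
  apply: I1 => i iN; rewrite lexx ds_lo //; split => //.
    by rewrite -subr_ge0 ds_lo // divr_ge0.
  exact: (hmesh a (small a a0 ab)).1.
have {}I2 : M (\sum_(i < n + n) (s i.+1 - s i) *: X (s i) - Y b) < eta / (2 * C).
  apply: I2 => i iN; rewrite lexx; have [iln|nli] := ltnP i n.
    rewrite ds_lo //; split => //.
      by rewrite -subr_ge0 ds_lo // divr_ge0.
    exact: (hmesh a (small a a0 ab)).2.
  rewrite -(subnKC nli) ds_hi; split => //.
    by rewrite -subr_ge0 ds_hi divr_ge0 // subr_ge0.
  apply: (hmesh (b - a) (small _ _ _)).2; first by rewrite subr_ge0.
  by rewrite gerBl.
have sge0 i : 0 <= s i.
  rewrite /s; case: ifP => _; first by rewrite divr_ge0 // mulr_ge0.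
  by rewrite addr_ge0 // divr_ge0 // mulr_ge0 // subr_ge0.
have toE k (x : R -> E) (y : R -> V) t : 0 <= t -> (forall t, 0 <= t -> y t = phi (x t)) ->
  N (\sum_(i < k) (s i.+1 - s i) *: U (s i) - x t) <=
  C * M (\sum_(i < k) (s i.+1 - s i) *: X (s i) - y t).
  move=> t0 yx; apply: le_trans (NM _) _; rewrite linearB linear_sum yx //.
  rewrite (eq_bigr (fun i : 'I_k => (s i.+1 - s i) *: X (s i))) // => i _.
  by rewrite linearZ /= XU.
have eta2 : C * (eta / (2 * C)) = eta / 2 by field; rewrite gt_eqF.
have {}I1 : N (\sum_(i < n) (s i.+1 - s i) *: U (s i) - W a) <= eta / 2.
  by apply: le_trans (toE n W Y a a0 YW) _; rewrite -eta2 ler_pM2l // ltW.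
have {}I2 : N (\sum_(i < n + n) (s i.+1 - s i) *: U (s i) - W b) <= eta / 2.
  by apply: le_trans (toE _ W Y b b0 YW) _; rewrite -eta2 ler_pM2l // ltW.
rewrite big_split_ord /= in I2; set S1 := \sum_(i < n) _ in I1 I2.
set S2 := \sum_(i < n) _ in I2.
have I3 : N (S2 - (b - a) *: U c) <= e * (b - a).
  have -> : S2 - (b - a) *: U c =
      \sum_(i < n) ((b - a) / n%:R) *: (U (s (n + i)%N) - U c).
    rewrite -scaler_sumr sumrB scalerBr scaler_sumr sumr_const card_ord.
    rewrite -[U c *+ n]scaler_nat scalerA divfK //; congr (_ - _).
    by apply: eq_bigr => i _; rewrite ds_hi.
  apply: le_trans (ler_hnorm_sum H n (fun i => ((b - a) / n%:R) *: (U (s (n + i)%N) - U c))) _.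
  have -> : e * (b - a) = \sum_(i < n) (b - a) / n%:R * e.
    by rewrite sumr_const card_ord -mulr_natr; field.
  apply: ler_sum => i _; have ba0 : 0 <= (b - a) / n%:R by rewrite divr_ge0 // subr_ge0.
  rewrite NZ ger0_norm // ler_wpM2l //.
  have sa : a <= s (n + i)%N by rewrite s_hi lerDl divr_ge0 // mulr_ge0 // subr_ge0.
  have sb : s (n + i)%N <= b.
    rewrite s_hi -lerBrDl ler_pdivrMr ?ltr0n // ler_wpM2l ?subr_ge0 //.
    by rewrite ler_nat ltnW.
  apply: hd => //; first exact: le_trans sb bT.
  by rewrite ltr_norml; apply/andP; split; lra.
have -> : W b - W a - (b - a) *: U c =
  - (S1 + S2 - W b) + (S1 - W a) + (S2 - (b - a) *: U c) by module_eq R.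
have := ND (- (S1 + S2 - W b) + (S1 - W a)) (S2 - (b - a) *: U c).
have := ND (- (S1 + S2 - W b)) (S1 - W a); rewrite (hnormN H).
by lra.
Qed.

End Transfer.

(** * Square-integrable functions *)

Section SquareIntegrable.
Context d (T : measurableType d) (R : realType) (m : {measure set T -> \bar R}).
Variable D : set T.
Hypotheses (mD : measurable D) (fD : (m D < +oo)%E).
Implicit Types f g : T -> R.
Local Notation L := (L2 m D).

Lemma L2P f : L f <-> measurable_fun D f /\ m.-integrable D (EFin \o (fun x => f x ^+ 2)).
Proof.
have sqE : (fun x => (f \_ D) x ^+ 2) = (fun x => f x ^+ 2) \_ D.
  by apply/funext => x; rewrite !patchE; case: ifP => // _; rewrite expr0n.
split=> [Lf|[mf If]].
  split.
    apply/(measurable_restrictT _ mD).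
    by move: Lf; rewrite /L2 inE => /andP[]; rewrite inE.
  apply/(integrable_mkcond _ mD); rewrite restrict_EFin -sqE.
  exact: Lfun2_integrable_sqr.
rewrite /L2 inE; apply/andP; split; first by rewrite inE; apply/(measurable_restrictT _ mD).
rewrite inE /= /finite_norm unlock; apply: poweR_lty.
have /integrableP[_] : m.-integrable setT (EFin \o (fun x => (f \_ D) x ^+ 2)).
  by rewrite sqE -restrict_EFin; apply/(integrable_mkcond _ mD).
congr (_ < _)%E; apply: eq_integral => x _ /=.
by rewrite powR_mulrn // normrX.
Qed.

Lemma L2_measurable f : L f -> measurable_fun D f.
Proof. by case/L2P. Qed.

Lemma L2_sqr f : L f -> m.-integrable D (EFin \o (fun x => f x ^+ 2)).
Proof. by case/L2P. Qed.

Lemma integrable_linear (f g : T -> R) (a b : R) : m.-integrable D (EFin \o f) ->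
    m.-integrable D (EFin \o g) ->
  m.-integrable D (EFin \o (fun x => a * f x + b * g x)).
Proof.
move=> If Ig; rewrite (_ : _ \o _ = (fun x => a%:E * (EFin \o f) x + b%:E * (EFin \o g) x)%E) //.
by apply: integrableD => //; exact: integrableZl.
Qed.

Lemma integrable_dom (f g : T -> R) : measurable_fun D f -> m.-integrable D (EFin \o g) ->
  (forall x, D x -> `|f x| <= g x) -> m.-integrable D (EFin \o f).
Proof.
move=> mf Ig fg; apply: (le_integrable mD _ _ Ig); first exact/measurable_EFinP.
by move=> x Dx /=; rewrite lee_fin; apply: le_trans (fg x Dx) (ler_norm _).
Qed.

Lemma L2_dom f (g : T -> R) : measurable_fun D f -> m.-integrable D (EFin \o g) ->
  (forall x, D x -> f x ^+ 2 <= g x) -> L f.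
Proof.
move=> mf Ig fg; apply/L2P; split => //; apply: integrable_dom Ig _ => [|x Dx].
  exact: measurable_funX.
by rewrite ger0_norm ?sqr_ge0 // fg.
Qed.

Lemma L2_mul f g : L f -> L g -> m.-integrable D (EFin \o (fun x => f x * g x)).
Proof.
move=> Lf Lg; apply: integrable_dom (integrable_linear 1 1 (L2_sqr Lf) (L2_sqr Lg)) _.
  by apply: measurable_funM; exact: L2_measurable.
move=> x _; rewrite ler_norml; apply/andP; split.
  by have := sqr_ge0 (f x + g x); have := sqr_ge0 (f x); have := sqr_ge0 (g x); nra.
by have := sqr_ge0 (f x - g x); have := sqr_ge0 (f x); have := sqr_ge0 (g x); nra.
Qed.

Lemma L2_linear a f g : L f -> L g -> L (a *: f + g).
Proof.
move=> Lf Lg.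
apply: L2_dom (integrable_linear (2 * a ^+ 2) 2 (L2_sqr Lf) (L2_sqr Lg)) _.
  by apply: measurable_funD; [apply: measurable_funM => //|]; exact: L2_measurable.
move=> x _; rewrite !fctE; have := sqr_ge0 (a * f x - g x).
by rewrite /GRing.scale /=; nra.
Qed.

Lemma L2_cst (c : R) : L (cst c).
Proof.
have cE : (fun x : T => cst c x ^+ 2) = cst (c ^+ 2) by [].
apply/L2P; split => //; rewrite cE; apply/integrableP; split.
  by apply/measurable_EFinP; exact: measurable_cst.
by rewrite /= (integral_cst _ mD) lte_mul_pinfty.
Qed.

Lemma L2_zero : L 0. Proof. exact: (L2_cst 0). Qed.

Lemma L2_scale a f : L f -> L (a *: f).
Proof. by move=> Lf; rewrite -[_ *: f]addr0; apply: L2_linear => //; exact: L2_zero. Qed.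

Lemma L2_add f g : L f -> L g -> L (f + g).
Proof. by move=> Lf Lg; rewrite -[f]scale1r; exact: L2_linear. Qed.

Lemma L2_opp f : L f -> L (- f).
Proof. by move=> Lf; rewrite -scaleN1r; exact: L2_scale. Qed.

Lemma L2_sub f g : L f -> L g -> L (f - g).
Proof. by move=> Lf Lg; apply: L2_add => //; exact: L2_opp. Qed.

Lemma L2_integrable f : L f -> m.-integrable D (EFin \o f).
Proof.
move=> Lf; have := L2_mul Lf (L2_cst 1).
by congr (_.-integrable D _); apply/funext => x /=; rewrite mulr1.
Qed.

Lemma L2_bounded f (b : T -> R) (C : R) : measurable_fun D b ->
  (forall x, D x -> `|b x| <= C) -> L f -> L (fun x => b x * f x).
Proof.
move=> mb bC Lf; apply: L2_dom (integrable_linear (C ^+ 2) 0 (L2_sqr Lf) (L2_sqr Lf)) _.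
  by apply: measurable_funM => //; exact: L2_measurable.
move=> x Dx; rewrite mul0r addr0 exprMn ler_wpM2r ?sqr_ge0 //.
rewrite -real_normK ?num_real // ler_pXn2r ?nnegrE ?bC //.
exact: le_trans (normr_ge0 _) (bC x Dx).
Qed.

Lemma ae_eq_Rintegral f g : measurable_fun D f -> measurable_fun D g ->
  f = g %[ae m in D] -> \int[m]_(x in D) f x = \int[m]_(x in D) g x.
Proof.
move=> mf mg fg; congr fine; apply: ae_eq_integral => //; try exact/measurable_EFinP.
by move: fg; apply: filterS => x h Dx /=; rewrite h.
Qed.

Definition ipL f g := \int[m]_(x in D) (f x * g x).

Lemma ipLC f g : ipL f g = ipL g f.
Proof. by apply: eq_Rintegral => x _; rewrite mulrC. Qed.

Lemma ipL_linear a f g h : L f -> L g -> L h -> ipL (a *: f + g) h = a * ipL f h + ipL g h.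
Proof.
move=> Lf Lg Lh; rewrite /ipL -RintegralZl //; last exact: L2_mul.
rewrite -RintegralD //; [|exact: (integrableZl mD a (L2_mul Lf Lh))|exact: L2_mul].
by apply: eq_Rintegral => x _; rewrite !fctE mulrDl mulrA.
Qed.

Lemma ipL0 h : ipL 0 h = 0.
Proof. by rewrite /ipL; under eq_Rintegral do rewrite mul0r; rewrite Rintegral_cst // mul0r. Qed.

Lemma ipL_scale a f h : L f -> L h -> ipL (a *: f) h = a * ipL f h.
Proof.
move=> Lf Lh; rewrite -[a *: f]addr0 ipL_linear //; last exact: L2_zero.
by rewrite ipL0 addr0.
Qed.

Lemma ipL_add f g h : L f -> L g -> L h -> ipL (f + g) h = ipL f h + ipL g h.
Proof. by move=> Lf Lg Lh; rewrite -[f]scale1r ipL_linear // mul1r scale1r. Qed.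

Lemma ipL_ge0 f : 0 <= ipL f f.
Proof. by apply: Rintegral_ge0 => x _; rewrite -expr2 sqr_ge0. Qed.

Lemma ipL_ae f f' g g' : L f -> L f' -> L g -> L g' ->
  f = f' %[ae m in D] -> g = g' %[ae m in D] -> ipL f g = ipL f' g'.
Proof.
move=> Lf Lf' Lg Lg' ff' gg'; apply: ae_eq_Rintegral.
- by apply: measurable_funM; exact: L2_measurable.
- by apply: measurable_funM; exact: L2_measurable.
by apply: filterS2 ff' gg' => x h1 h2 Dx; rewrite h1 // h2.
Qed.

Lemma ipL_EFin f : L f -> (ipL f f)%:E = (\int[m]_(x in D) (f x ^+ 2)%:E)%E.
Proof.
move=> Lf; rewrite /ipL /Rintegral fineK.
  by apply: eq_integral => x _; rewrite expr2.
by apply: integrable_fin_num => //; exact: (L2_mul Lf Lf).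
Qed.

Lemma ipL_null f : L f -> ipL f f = 0 -> f = 0 %[ae m in D].
Proof.
move=> Lf f0; have mf := L2_measurable Lf.
have : ae_eq m D (fun x => (f x ^+ 2)%:E) (cst 0).
  apply: (proj1 (ae_eq_integral_abs m mD _)); first by apply/measurable_EFinP;
      exact: measurable_funX.
  rewrite -[RHS]/(0%:E) -f0 ipL_EFin //; apply: eq_integral => x _.
  by rewrite gee0_abs // lee_fin sqr_ge0.
apply: filterS => x h Dx; have [/eqP] := h Dx.
by rewrite sqrf_eq0 => /eqP.
Qed.

Lemma ipL_null_ae f : L f -> f = 0 %[ae m in D] -> ipL f f = 0.
Proof.
by move=> Lf f0; rewrite (ipL_ae Lf L2_zero Lf L2_zero f0 f0) ipL0.
Qed.

Let geometric_cvg (a : nat -> R) (C : R) :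
  (forall k, `|a k.+1 - a k| <= C * 2^-1 ^+ k) -> cvgn a.
Proof.
move=> aC; have C0 : 0 <= C by have := le_trans (normr_ge0 _) (aC 0%N); rewrite mulr1.
have : cvgn (series (telescope a)).
  apply: normed_cvg; apply: (series_le_cvg (v_ := fun k => C * 2^-1 ^+ k)) => //.
  - by move=> n; exact: normr_ge0.
  - by move=> n; rewrite mulr_ge0 // exprn_ge0.
  - by apply: is_cvg_geometric_series; rewrite ger0_norm // invf_lt1 // ltr1n.
move=> /cvg_ex[s hs]; apply/cvg_ex; exists (a 0%N + s).
have aE : (fun n => a 0%N + series (telescope a) n) = a.
  by apply/funext => n; rewrite -eq_sum_telescope.
rewrite -[X in X @ _ --> _]aE.
apply: cvgD hs; exact: cvg_cst.
Qed.

(** Gaps 8^-k make the sum of 4^k times the squared increments integrable; where this sum is finite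
    the increments are O(2^-k). *)
Let fast_ae_cvg (g : nat -> T -> R) : (forall k, L (g k)) ->
  (forall k, ipL (g k.+1 - g k) (g k.+1 - g k) <= 8^-1 ^+ k) ->
  {ae m, forall x, D x -> cvgn (fun k => g k x)}.
Proof.
move=> Lg hg.
have Ld k : L (g k.+1 - g k) by apply: L2_sub.
pose u k x : \bar R := (4 ^+ k * (g k.+1 x - g k x) ^+ 2)%:E.
have mu' k : measurable_fun D (u k).
  apply/measurable_EFinP; apply: measurable_funM => //; apply: measurable_funX.
  exact: (L2_measurable (Ld k)).
have u0 k x : D x -> (0 <= u k x)%E by move=> _; rewrite lee_fin; apply: mulr_ge0;
    [exact: exprn_ge0|exact: sqr_ge0].
pose S x := (\sum_(k <oo) u k x)%E.
have IS : m.-integrable D S.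
  apply/integrableP; split; first by apply: ge0_emeasurable_sum => // k x Dx _; exact: u0.
  rewrite (eq_integral S); last first.
    by move=> x; rewrite inE => Dx; rewrite gee0_abs // nneseries_ge0 // => k _ _; exact: u0.
  rewrite integral_nneseries //.
  apply: (@le_lt_trans _ _ 2%:E); last by rewrite ltry.
  apply: lime_le; first by apply: is_cvg_nneseries => k _ _; apply: integral_ge0 => x Dx; exact: u0.
  apply: nearW => n; apply: (@le_trans _ _ (\sum_(0 <= k < n) (2^-1 ^+ k)%:E)%E).
    apply: lee_sum => k _; rewrite /u.
    under eq_integral do rewrite EFinM.
    rewrite ge0_integralZl //; last first.
    - by move=> x _; rewrite lee_fin sqr_ge0.
    - by apply/measurable_EFinP; apply: measurable_funX; exact: (L2_measurable (Ld k)).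
    have := ipL_EFin (Ld k) => <-; rewrite -EFinM lee_fin.
    apply: (@le_trans _ _ (4 ^+ k * 8^-1 ^+ k)); first by rewrite ler_pM2l ?exprn_gt0.
    by rewrite -exprMn; apply: lerXn2r; rewrite ?nnegrE; lra.
  rewrite sumEFin lee_fin.
  suff : \sum_(0 <= k < n) (2^-1 ^+ k : R) = 2 - 2 * 2^-1 ^+ n.
    by move=> ->; rewrite gerBl mulr_ge0 // exprn_ge0.
  elim: n => [|n IH]; first by rewrite big_geq // expr0; lra.
  by rewrite big_nat_recr //= IH exprS; lra.
have := integrable_ae mD IS; apply: filterS => x hx Dx.
have {}hx := hx Dx; pose B := fine (S x).
have B0 : 0 <= B by rewrite fine_ge0 // nneseries_ge0 // => k _ _; exact: u0.
apply: (@geometric_cvg _ (Num.sqrt B)) => k.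
rewrite -(@ler_pXn2r _ 2) ?nnegrE ?mulr_ge0 ?sqrtr_ge0 ?exprn_ge0 //.
rewrite real_normK ?num_real // exprMn sqr_sqrtr // -!exprM mulnC exprM.
rewrite -(ler_pM2l (_ : 0 < 4 ^+ k)) ?exprn_gt0 //.
rewrite [leRHS]mulrCA -exprMn (_ : 4 * _ = 1) ?expr1n ?mulr1; last first.
  by rewrite expr2; field.
rewrite -lee_fin /B fineK //.
have -> : (4 ^+ k * (g k.+1 x - g k x) ^+ 2)%:E = u k x by [].
apply: le_trans (nneseries_lim_ge k.+1 _); last by move=> i _ _; exact: u0.
rewrite big_nat_recr //= leeDr // sume_ge0 // => i _; exact: u0.
Qed.

(** Riesz-Fischer: a fast subsequence converges almost everywhere, and Fatou's lemma bounds the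
    distance from a term of the sequence to the limit. *)
Lemma L2_complete (f : nat -> T -> R) : (forall n, L (f n)) ->
  (forall e : R, 0 < e -> exists n, forall i j, (n <= i)%N -> (n <= j)%N ->
       ipL (f i - f j) (f i - f j) < e) ->
  exists2 g, L g & forall e : R, 0 < e -> exists n, forall i, (n <= i)%N ->
       ipL (f i - g) (f i - g) < e.
Proof.
move=> Lf fC.
have e8 k : 0 < 8^-1 ^+ k :> R by rewrite exprn_gt0.
have [n0 hn0] := choice (fun k => fC _ (e8 k)).
(* Strictly increasing indices, the k-th one beyond the Cauchy threshold for 8^-k. *)
pose n := fix n k := if k is k'.+1 then maxn (n k').+1 (n0 k) else n0 0%N.
have nS k : (n k <= n k.+1)%N by rewrite ltnW // leq_maxl.
have nn0 k : (n0 k <= n k)%N by case: k => [//|k]; rewrite leq_maxr.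
pose g k := f (n k).
have Lg k : L (g k) by exact: Lf.
have gcvg := fast_ae_cvg Lg (fun k => ltW (hn0 k _ _ (leq_trans (nn0 k) (nS k)) (nn0 k))).
(* The limsup is measurable whether or not the sequence converges, and it agrees with the limit
   where a finite one exists. *)
pose F x := fine (limn_esup (fun k => (g k x)%:E)).
have mF : measurable_fun D F.
  apply: measurableT_comp => //; apply: measurable_fun_limn_esup => k.
  by apply/measurable_EFinP; exact: L2_measurable.
have cF : {ae m, forall x, D x -> g k x @[k --> \oo] --> F x}.
  apply: filterS gcvg => x h Dx; have /cvg_ex[s hs] := h Dx.
  have : (g k x)%:E @[k --> \oo] --> s%:E by apply: cvg_EFin => //; exact: nearW.
  by move=> /cvg_limn_einf_sup[_]; rewrite /F => ->.
have key (e : R) p : (forall j, (p <= j)%N -> ipL (f p - f j) (f p - f j) < e) ->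
    L (f p - F) /\ ipL (f p - F) (f p - F) <= e.
  move=> hp; pose h k x := ((f p x - g k x) ^+ 2)%:E.
  have mh k : measurable_fun D (h k).
    apply/measurable_EFinP; apply: measurable_funX; apply: measurable_funB;
      exact: L2_measurable.
  have h0 k x : D x -> (0 <= h k x)%E by rewrite lee_fin sqr_ge0.
  have mfF : measurable_fun D (f p - F) by apply: measurable_funB => //; exact: L2_measurable.
  have Ih k : (p <= n k)%N -> (\int[m]_(x in D) h k x <= e%:E)%E.
    move=> pk; have <- := ipL_EFin (L2_sub (Lf p) (Lf (n k))).
    by rewrite lee_fin ltW // hp.
  have le : (\int[m]_(x in D) (((f p - F) x) ^+ 2)%:E <= e%:E)%E.
    apply: (@le_trans _ _ (\int[m]_(x in D) limn_einf (h^~ x))%E).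
      rewrite le_eqVlt; apply/orP; left; apply/eqP; apply: ge0_ae_eq_integral => //.
      - by apply/measurable_EFinP; exact: measurable_funX.
      - apply: measurableT_comp => //; apply: measurable_fun_limn_esup => k.
        exact: measurableT_comp.
      - by move=> x _; rewrite lee_fin sqr_ge0.
      - move=> x Dx; rewrite limn_einf_lim; apply: lime_ge; first exact: is_cvg_einfs.
        apply: nearW => k; apply: le_ereal_inf_tmp => _ [j _ <-]; exact: h0.
      - apply: filterS cF => x hx Dx.
        have : h k x @[k --> \oo] --> (((f p - F) x) ^+ 2)%:E.
          apply: cvg_EFin; first exact: nearW.
          apply: cvgM; apply: cvgB; by [exact: cvg_cst|exact: hx].
        by move=> /cvg_limn_einf_sup[-> _].
    apply: le_trans (fatou m mD mh h0) _.
    rewrite limn_einf_lim; apply: lime_le; first exact: is_cvg_einfs.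
    exists p => // k /= pk.
    apply: le_trans (Ih k _); last first.
      apply: leq_trans pk _; elim: (k) => [//|j IH]; apply: leq_ltn_trans IH _.
      exact: leq_maxl.
    by apply: ereal_inf_lbound; exists k => /=.
  have LF : L (f p - F).
    apply/L2P; split => //; apply/integrableP; split.
      by apply/measurable_EFinP; exact: measurable_funX.
    apply: le_lt_trans (_ : _ <= e%:E)%E _; last by rewrite ltry.
    apply: le_trans le; rewrite le_eqVlt; apply/orP; left; apply/eqP.
    by apply: eq_integral => x _ /=; rewrite ger0_norm ?sqr_ge0.
  by split => //; rewrite -lee_fin ipL_EFin.
have [p1 hp1] := fC 1 ltr01.
have [LF1 _] := key 1 p1 (fun j => hp1 p1 j (leqnn _)).
have LF : L F by have := L2_sub (Lf p1) LF1; rewrite opprB addrC subrK.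
exists F => // e e0; have [q hq] := fC (e / 2) ltac:(by rewrite divr_gt0).
exists q => i qi; have [_ le] := key (e / 2) i (fun j ij => hq i j qi (leq_trans qi ij)).
by apply: le_lt_trans le _; rewrite ltr_pdivrMr // ltr_pMr // ltr1n.
Qed.

End SquareIntegrable.

(** * Submodules as module types, and the semi-Hilbert space L^2 *)

Record submodule (R : realType) (V : lmodType R) := Submodule {
  spred :> V -> Prop;
  spred0 : spred 0;
  spredL : forall a x y, spred x -> spred y -> spred (a *: x + y) }.

Section SubmoduleType.
Variables (R : realType) (V : lmodType R) (S : submodule V).

Definition smem : {pred V} := fun x => `[< spred S x >].

Lemma smem_closed : submod_closed smem.
Proof.
split; first by apply/asboolP; exact: spred0.
by move=> a x y /asboolP hx /asboolP hy; apply/asboolP; exact: spredL.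
Qed.

HB.instance Definition _ := GRing.isSubmodClosed.Build R V smem smem_closed.

(** [semi_hilbert] speaks about a whole module, so function spaces given by predicates are turned
    into types. *)
Record smod := SMod { smval : V; _ : smval \in smem }.
HB.instance Definition _ := [isSub for smval].
HB.instance Definition _ := [Choice of smod by <:].
HB.instance Definition _ := [SubChoice_isSubLmodule of smod by <:].

Lemma smodP (x : smod) : spred S (val x).
Proof. by apply/asboolP; exact: (valP x). Qed.

Lemma smod_exists x : spred S x -> exists y : smod, val y = x.
Proof. by move=> /asboolP h; exists (@SMod x h). Qed.

End SubmoduleType.
Arguments smod_exists {R V} S {x}.

Section L2Hilbert.
Context d (T : measurableType d) (R : realType) (m : {measure set T -> \bar R}).
Variable D : set T.
Hypotheses (mD : measurable D) (fD : (m D < +oo)%E).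

Definition L2_submodule := Submodule (L2_zero mD fD) (fun a f g => @L2_linear _ _ _ m D mD a f g).

Lemma L2_semi_hilbert : semi_hilbert (fun f g : smod L2_submodule => ipL m D (val f) (val g)).
Proof.
split.
- by move=> x y; exact: ipLC.
- move=> x y z; rewrite linearD; exact: (ipL_add mD (smodP x) (smodP y) (smodP z)).
- move=> a x z; rewrite linearZ; exact: (ipL_scale mD fD a (smodP x) (smodP z)).
- by move=> x; exact: ipL_ge0.
- move=> x xC; have [e e0|g Lg hg] := L2_complete mD fD (fun n => smodP (x n)) _.
    have [n hn] := xC e e0; exists n => i j ni nj.
    by have := hn i j ni nj; rewrite linearB.
  have [y yE] := smod_exists L2_submodule Lg; exists y => e e0.
  have [n hn] := hg e e0; exists n => i ni.
  by have := hn i ni; rewrite -yE -linearB.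
Qed.

Lemma L2_cauchy_schwarz f g : L2 m D f -> L2 m D g ->
  `|ipL m D f g| <= Num.sqrt (ipL m D f f) * Num.sqrt (ipL m D g g).
Proof.
move=> Lf Lg; have [x <-] := smod_exists L2_submodule Lf.
have [y <-] := smod_exists L2_submodule Lg.
exact: (cauchy_schwarz L2_semi_hilbert x y).
Qed.

End L2Hilbert.

(** * Integration over a rectangle *)

Section ProductIntegral.
Context d1 d2 (T1 : measurableType d1) (T2 : measurableType d2) (R : realType).
Variables (m1 : {sigma_finite_measure set T1 -> \bar R}).
Variables (m2 : {sigma_finite_measure set T2 -> \bar R}).
Variables (D1 : set T1) (D2 : set T2).
Hypotheses (mD1 : measurable D1) (mD2 : measurable D2).

Lemma patch_rect (F : T1 * T2 -> R) x y :
  (F \_ (D1 `*` D2)) (x, y) = ((fun x => ((fun y => F (x, y)) \_ D2) y) \_ D1) x.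
Proof.
rewrite !patchE; case: ifP => [|h].
  by rewrite inE => -[/= h1 h2]; rewrite !mem_set.
case: ifP => // h1; case: ifP => // h2; suff : (x, y) \in D1 `*` D2 by rewrite h.
by rewrite inE; split; [move: h1|move: h2]; rewrite inE.
Qed.

Lemma rect_section_patch (F : T1 * T2 -> R) x : D1 x ->
  (fun y => (F \_ (D1 `*` D2)) (x, y)) = (fun y => F (x, y)) \_ D2.
Proof. by move=> D1x; apply/funext => y; rewrite patch_rect patchE mem_set. Qed.

Lemma integrable_rectT (F : T1 * T2 -> R) :
  (m1 \x m2)%E.-integrable (D1 `*` D2) (EFin \o F) ->
  (m1 \x m2)%E.-integrable setT (EFin \o (F \_ (D1 `*` D2))).
Proof.
by move=> IF; rewrite -restrict_EFin; exact: (integrable_mkcond _ (measurableX mD1 mD2)).1.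
Qed.

Lemma rect_section_integrable (F : T1 * T2 -> R) :
  (m1 \x m2)%E.-integrable (D1 `*` D2) (EFin \o F) ->
  {ae m1, forall x, D1 x -> m2.-integrable D2 (EFin \o (fun y => F (x, y)))}.
Proof.
move=> /integrable_rectT IF; have := ae_integrable1 IF; apply: filterS => x h D1x.
by apply: (integrable_mkcond _ mD2).2; rewrite restrict_EFin -rect_section_patch.
Qed.

Lemma rect_int_measurable (F : T1 * T2 -> R) :
  (m1 \x m2)%E.-integrable (D1 `*` D2) (EFin \o F) ->
  measurable_fun D1 (fun x => \int[m2]_(y in D2) F (x, y)).
Proof.
move=> /integrable_rectT IF; have mF := measurable_fubini_F IF.
have : measurable_fun D1 (fun x => fine (fubini_F m2 (EFin \o (F \_ (D1 `*` D2))) x)).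
  by apply: measurableT_comp => //; exact: measurable_funTS.
apply: eq_measurable_fun => x; rewrite inE => D1x.
rewrite /fubini_F /Rintegral [in RHS]integral_mkcond; congr fine.
by apply: eq_integral => y _; rewrite restrict_EFin -rect_section_patch.
Qed.

(** Fubini on the whole product for the extension by zero. Sections are integrable for almost every
    x only, hence the comparison of inner integrals almost everywhere. *)
Lemma Rintegral_rect (F : T1 * T2 -> R) :
  (m1 \x m2)%E.-integrable (D1 `*` D2) (EFin \o F) ->
  \int[m1]_(x in D1) \int[m2]_(y in D2) F (x, y) =
  \int[(m1 \x m2)%E]_(z in D1 `*` D2) F z.
Proof.
move=> IF; have IFT := integrable_rectT IF.
rewrite [in RHS]Rintegral_mkcond [RHS]/Rintegral -(integral12_prod_meas1 IFT).
rewrite [LHS]Rintegral_mkcond; congr fine; apply: ae_eq_integral => //.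
- apply/measurable_EFinP; apply/(measurable_restrictT _ mD1).
  exact: rect_int_measurable.
- exact: (measurable_fubini_F IFT).
have := ae_integrable1 IFT; apply: filterS => x h _; rewrite /fubini_F.
rewrite -[RHS]fineK; last exact: integrable_fin_num.
congr EFin; rewrite patchE; case: ifP => [|hx].
  rewrite inE => D1x; rewrite [LHS]Rintegral_mkcond /Rintegral; congr fine.
  by apply: eq_integral => y _; rewrite /= -rect_section_patch.
rewrite (eq_integral (cst 0%E)) ?integral0 //= => y _.
by rewrite /= patch_rect patchE hx.
Qed.

Lemma Rintegral_rect_swap (F : T1 * T2 -> R) :
  (m1 \x m2)%E.-integrable (D1 `*` D2) (EFin \o F) ->
  \int[m2]_(y in D2) \int[m1]_(x in D1) F (x, y) =
  \int[(m1 \x m2)%E]_(z in D1 `*` D2) F z.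
Proof.
move=> IF; have IFT := integrable_rectT IF.
have patchS y : D2 y -> (fun x => (F \_ (D1 `*` D2)) (x, y)) = (fun x => F (x, y)) \_ D1.
  by move=> D2y; apply/funext => x; rewrite patch_rect !patchE (mem_set D2y).
rewrite [in RHS]Rintegral_mkcond [RHS]/Rintegral -(integral21_prod_meas1 IFT).
rewrite [LHS]Rintegral_mkcond; congr fine; apply: ae_eq_integral => //.
- apply/measurable_EFinP; apply/(measurable_restrictT _ mD2).
  have : measurable_fun D2 (fun y => fine (fubini_G m1 (EFin \o (F \_ (D1 `*` D2))) y)).
    by apply: measurableT_comp => //; apply: measurable_funTS; exact: (measurable_fubini_G IFT).
  apply: eq_measurable_fun => y; rewrite inE => D2y.
  rewrite /fubini_G /Rintegral [in RHS]integral_mkcond; congr fine.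
  by apply: eq_integral => x _; rewrite restrict_EFin -patchS.
- exact: (measurable_fubini_G IFT).
have := ae_integrable2 IFT; apply: filterS => y h _; rewrite /fubini_G.
rewrite -[RHS]fineK; last exact: integrable_fin_num.
congr EFin; rewrite patchE; case: ifP => [|hy].
  rewrite inE => D2y; rewrite [LHS]Rintegral_mkcond /Rintegral; congr fine.
  by apply: eq_integral => x _; rewrite /= -patchS.
rewrite (eq_integral (cst 0%E)) ?integral0 //= => x _.
by rewrite /= patch_rect !patchE hy; case: ifP.
Qed.

Lemma integrable_tensor (f : T1 -> R) (g : T2 -> R) :
  m1.-integrable D1 (EFin \o f) -> m2.-integrable D2 (EFin \o g) ->
  (m1 \x m2)%E.-integrable (D1 `*` D2) (EFin \o (fun z => f z.1 * g z.2)).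
Proof.
move=> If Ig.
have IfT : m1.-integrable setT (EFin \o (f \_ D1)) by rewrite -restrict_EFin;
    exact: (integrable_mkcond _ mD1).1.
have IgT : m2.-integrable setT (EFin \o (g \_ D2)) by rewrite -restrict_EFin;
    exact: (integrable_mkcond _ mD2).1.
have mf := measurable_int _ IfT; have mg := measurable_int _ IgT.
apply: (integrable_mkcond _ (measurableX mD1 mD2)).2.
have -> : (EFin \o (fun z => f z.1 * g z.2)) \_ (D1 `*` D2) =
    (fun z => (EFin \o (f \_ D1)) z.1 * (EFin \o (g \_ D2)) z.2)%E.
  apply/funext => -[x y]; rewrite restrict_EFin /= patch_rect /= !patchE.
  by case: ifP => _; rewrite ?patchE /=; case: ifP => _; rewrite -EFinM ?mulr0 ?mul0r.
apply/integrable12ltyP.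
  by apply: emeasurable_funM; apply: (measurableT_comp _ _) => //; exact: measurable_fst ||
      exact: measurable_snd.
have [_ Lf] := integrableP _ _ _ IfT; have [_ Lg] := integrableP _ _ _ IgT.
rewrite (eq_integral (fun x => `|(EFin \o (f \_ D1)) x| *
    \int[m2]_y `|(EFin \o (g \_ D2)) y|)%E); last first.
  move=> x _; under eq_integral do rewrite abseM.
  by rewrite -ge0_integralZl //; exact: measurableT_comp.
rewrite ge0_integralZr //; last 2 first.
- exact: measurableT_comp.
- exact: integral_ge0.
by rewrite lte_mul_pinfty ?integral_ge0 // ge0_fin_numE ?integral_ge0.
Qed.

End ProductIntegral.

(** * Primitives and weak derivatives on an interval *)

Section Primitives.
Variables (R : realType) (c : R).
Hypothesis c0 : 0 < c.
Local Notation mu := (@lebesgue_measure R).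
Local Notation D := (`]0, c[%classic : set (measurableTypeR R)).
Local Notation L := (L2 mu D).
Local Notation ip := (ipL mu D).
Local Notation RR := (measurableTypeR R * measurableTypeR R)%type.
Implicit Types (f g : R -> R) (x y : R).

Lemma mD : measurable D. Proof. exact: measurable_itv. Qed.

Lemma muD : mu D = c%:E.
Proof. by rewrite lebesgue_measure_itv /= lte_fin c0 sube0. Qed.

Lemma fD : (mu D < +oo)%E. Proof. by rewrite muD ltry. Qed.
Local Hint Resolve mD fD : core.

Lemma Rint_cst k : \int[mu]_(x in D) cst k x = k * c.
Proof. by rewrite Rintegral_cst //; congr (_ * _); exact: (congr1 fine muD). Qed.

(** The indicator makes this an inner product ([primE]), so linearity, invariance under null changes
    and continuity in x come from [ipL]. The function lives on the whole line and is constant on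
    each side of ]0, c[. *)
Definition prim f x := \int[mu]_(s in D) (f s * \1_(`]-oo, x]) s).

Lemma indic_L2 (A : set (measurableTypeR R)) : measurable A -> L (\1_A : R -> R).
Proof.
move=> mA; have := @L2_bounded _ _ _ mu D mD (cst 1) (\1_A) 1 _ _ (L2_cst mD fD 1).
rewrite (_ : (fun x => _) = (\1_A : R -> R)); last by apply/funext => s /=; rewrite mulr1.
apply; first exact: measurable_indic.
by move=> s _; rewrite indicE; case: (_ \in _); rewrite ?normr1 ?normr0.
Qed.

Lemma step_L2 x : L (\1_(`]-oo, x]) : R -> R).
Proof. by apply: indic_L2; exact: measurable_itv. Qed.
Local Hint Resolve step_L2 : core.

Lemma primE f x : prim f x = ip f (\1_(`]-oo, x])). Proof. by []. Qed.

Lemma prim_linear a f g : L f -> L g -> prim (a *: f + g) = a *: prim f + prim g.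
Proof.
by move=> Lf Lg; apply/funext => x; rewrite primE ipL_linear.
Qed.

Lemma prim_ae f g : L f -> L g -> f = g %[ae mu in D] -> prim f = prim g.
Proof. by move=> Lf Lg fg; apply/funext => x; rewrite !primE; apply: ipL_ae => //;
    exact: ae_eq_refl. Qed.

Lemma prim_le0 f x : x <= 0 -> prim f x = 0.
Proof.
move=> x0; rewrite /prim (@eq_Rintegral _ _ _ mu D (cst 0)) ?Rintegral_cst ?mul0r // => s.
rewrite inE /= in_itv /= => /andP[s0 _]; rewrite indicE memNset ?mulr0 //=.
by rewrite in_itv /= => sx; have := lt_le_trans s0 (le_trans sx x0); rewrite ltxx.
Qed.

Lemma prim_ge f x : c <= x -> prim f x = \int[mu]_(s in D) f s.
Proof.
move=> cx; apply: eq_Rintegral => s.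
rewrite inE /= in_itv /= => /andP[_ sc]; rewrite indicE mem_set ?mulr1 //=.
by rewrite in_itv /=; exact: le_trans (ltW sc) cx.
Qed.

Lemma prim0 f : prim f 0 = 0. Proof. exact: prim_le0. Qed.
Lemma primc f : prim f c = \int[mu]_(s in D) f s. Proof. exact: prim_ge. Qed.

Lemma prim_itv f x : prim f x = \int[mu]_(s in `]-oo, x]) (f \_ D) s.
Proof.
rewrite /prim Rintegral_mkcond [RHS]Rintegral_mkcond; apply: eq_Rintegral => s _.
rewrite !patchE indicE; case: ifP => _; case: ifP => _; rewrite ?mulr1 ?mulr0 //.
Qed.

Definition nrm f := Num.sqrt (ip f f).

Lemma int_le_nrm f : L f -> `|\int[mu]_(s in D) f s| <= nrm f * Num.sqrt c.
Proof.
move=> Lf; have := L2_cauchy_schwarz mD fD Lf (L2_cst mD fD 1).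
rewrite /ipL; under eq_Rintegral do rewrite mulr1.
congr (_ <= _ * Num.sqrt _); under eq_Rintegral do rewrite mulr1.
exact: etrans (Rint_cst 1) (mul1r c).
Qed.

(** Cauchy-Schwarz against the indicator of ]y, x]. *)
Lemma prim_holder f x y : L f -> `|prim f x - prim f y| <= nrm f * Num.sqrt `|x - y|.
Proof.
move=> Lf; wlog yx : x y / y <= x.
  move=> hw; have [yx|xy] := leP y x; first exact: hw.
  by rewrite distrC (distrC x); apply: hw; exact: ltW.
have Lxy : L (\1_(`]y, x]) : R -> R) by apply: indic_L2; exact: measurable_itv.
have sE : (\1_(`]-oo, y]) : R -> R) + \1_(`]y, x]) = \1_(`]-oo, x]).
  apply/funext => s; rewrite !fctE !indicE !mem_setE !in_itv /=.
  case: (leP s y) => sy /=; last by rewrite add0r.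
  by rewrite (le_trans sy yx) addr0.
have -> : prim f x = prim f y + ip f (\1_(`]y, x])).
  by rewrite !primE !(ipLC mu D f) -sE; exact: (ipL_add mD (step_L2 y) Lxy Lf).
rewrite addrAC subrr add0r.
apply: le_trans (L2_cauchy_schwarz mD fD Lf Lxy) _.
rewrite ler_wpM2l ?sqrtr_ge0 // ler_wsqrtr // ger0_norm ?subr_ge0 //.
rewrite /ipL -lee_fin.
have -> : (fun s => \1_(`]y, x]) s * \1_(`]y, x]) s) = (\1_(`]y, x]) : R -> R).
  by apply/funext => s; rewrite indicE; case: (_ \in _); rewrite ?mulr1 ?mulr0.
rewrite /Rintegral fineK; last first.
  by apply: integrable_fin_num => //; exact: L2_integrable.
rewrite integral_indic //; apply: (@le_trans _ _ (mu `]y, x])).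
  by apply: le_measure; rewrite ?inE; [apply: measurableI|exact: measurable_itv|exact: subIsetl].
by rewrite lebesgue_measure_itv /=; case: ifP => // _; rewrite lee_fin subr_ge0.
Qed.

Lemma nrm_ge0 f : 0 <= nrm f. Proof. exact: sqrtr_ge0. Qed.

Lemma prim_continuous f : L f -> continuous (prim f).
Proof.
move=> Lf x; apply/cvgrPdist_lt => e e0; apply/nbhs_ballP.
exists ((e / (nrm f + 1)) ^+ 2) => /=.
  by rewrite exprn_gt0 // divr_gt0 // ltr_wpDl // nrm_ge0.
move=> y /= xy; apply: le_lt_trans (prim_holder x y Lf) _.
have n1 : 0 < nrm f + 1 by rewrite ltr_wpDl // nrm_ge0.
apply: (@le_lt_trans _ _ ((nrm f + 1) * Num.sqrt `|x - y|)).
  by rewrite ler_wpM2r ?sqrtr_ge0 // lerDl.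
rewrite mulrC -ltr_pdivlMr // -[ltRHS]ger0_norm ?divr_ge0 ?ltW //.
rewrite -[X in _ < `|X|]mulr1 -[ltRHS]sqrtr_sqr mulr1 ltr_sqrt //.
by rewrite exprn_gt0 // divr_gt0.
Qed.

Lemma continuous_L2 f : continuous f -> L f.
Proof.
move=> cf; apply/L2P => //; split.
  by apply: measurable_funTS; exact: continuous_measurable_fun.
apply: (@integrableS _ _ _ mu `[0, c]) => //; first exact: subset_itv_oo_cc.
apply: continuous_compact_integrable; first exact: segment_compact.
by apply: continuous_subspaceT => x; apply: cvgM; exact: cf.
Qed.

Lemma prim_L2 f : L f -> L (prim f).
Proof. by move=> Lf; apply: continuous_L2; exact: prim_continuous. Qed.

Lemma prim_le f x : L f -> D x -> `|prim f x| <= nrm f * Num.sqrt c.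
Proof.
move=> Lf; rewrite /= in_itv /= => /andP[x0 xc].
have := prim_holder x 0 Lf; rewrite prim0 !subr0 => /le_trans; apply.
by rewrite ler_wpM2l ?nrm_ge0 // ler_wsqrtr // ger0_norm ?ltW.
Qed.

Lemma le_nrm f (C : R) : L f -> 0 <= C -> (forall x, D x -> `|f x| <= C) ->
  nrm f <= C * Num.sqrt c.
Proof.
move=> Lf C0 fC; rewrite /nrm -[C]ger0_norm // -sqrtr_sqr -sqrtrM ?sqr_ge0 //.
rewrite ler_wsqrtr //; have -> : C ^+ 2 * c = \int[mu]_(x in D) (cst (C ^+ 2) x).
  by rewrite Rint_cst.
apply: le_Rintegral => //; first exact: L2_mul.
  exact: (L2_integrable mD fD (L2_cst mD fD _)).
move=> x Dx; rewrite -expr2 -real_normK ?num_real //.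
by rewrite ler_pXn2r ?nnegrE ?fC.
Qed.

Lemma nrm_prim f : L f -> nrm (prim f) <= c * nrm f.
Proof.
move=> Lf; have := le_nrm (prim_L2 Lf) (mulr_ge0 (nrm_ge0 f) (sqrtr_ge0 c))
  (fun x Dx => prim_le Lf Dx).
by rewrite -mulrA -expr2 (sqr_sqrtr (ltW c0)) mulrC.
Qed.

(* Fubini on the triangle s <= x *)
Lemma prim_parts f g : L f -> L g ->
  ip (prim f) g + ip f (prim g) = (\int[mu]_(s in D) f s) * (\int[mu]_(s in D) g s).
Proof.
move=> Lf Lg; have If := L2_integrable mD fD Lf; have Ig := L2_integrable mD fD Lg.
pose F (z : RR) := g z.1 * (f z.2 * \1_(`]-oo, z.1]) z.2).
have mE : measurable [set z : RR | z.2 <= z.1].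
  rewrite -[X in measurable X]setTI.
  by apply: measurable_fun_le.
have IF : (mu \x mu)%E.-integrable (D `*` D) (EFin \o F).
  have mF0 : measurable_fun (D `*` D) (fun z : RR => g z.1 * f z.2).
    have := integrable_tensor mD mD Ig If.
    by move=> /(measurable_int _) /measurable_EFinP.
  have FE : F = (fun z : RR => (g z.1 * f z.2) * \1_[set z : RR | z.2 <= z.1] z).
    apply/funext => -[x s]; rewrite /F /= -mulrA !indicE; congr (_ * (_ * _%:R)).
  rewrite FE; apply: (le_integrable (measurableX mD mD) _ _ (integrable_tensor mD mD Ig If)).
    apply/measurable_EFinP; apply: measurable_funM => //; exact: measurable_indic.
  move=> z _ /=; rewrite lee_fin normrM; rewrite -[leRHS]mulr1 ler_wpM2l //.
  by rewrite indicE; case: (_ \in _); rewrite ?normr1 ?normr0.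
have h1 : ip (prim f) g = \int[mu]_(x in D) \int[mu]_(s in D) F (x, s).
  apply: eq_Rintegral => x _; rewrite /F /= RintegralZl //; last exact: L2_mul.
  by rewrite mulrC.
rewrite h1 (Rintegral_rect mD mD IF) -(Rintegral_rect_swap mD mD IF).
(* For fixed s the inner integral runs over x >= s, the complement of x <= s up to the point s. *)
have h2 s : \int[mu]_(x in D) F (x, s) = f s * (\int[mu]_(x in D) g x - prim g s).
  have -> : (fun x => F (x, s)) = (fun x => f s * (g x * \1_(`[s, +oo[) x)).
    apply/funext => x; rewrite /F /= mulrCA; congr (_ * (_ * _)).
    by rewrite !indicE !mem_setE /= !in_itv /= andbT.
  have Ls : L (\1_(`[s, +oo[) : R -> R) by apply: indic_L2; exact: measurable_itv.
  rewrite RintegralZl //; last exact: L2_mul.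
  congr (_ * _); rewrite -RintegralB //; last exact: L2_mul.
  apply: ae_eq_Rintegral => //.
  - by apply: measurable_funM; [exact: (L2_measurable mD Lg)|exact: (L2_measurable mD Ls)].
  - apply: measurable_funB; first exact: (L2_measurable mD Lg).
    by apply: measurable_funM; [exact: (L2_measurable mD Lg)|exact: (L2_measurable mD (step_L2 s))].
  have : {ae mu, forall x, x <> s}.
    exists [set s]; split; rewrite ?lebesgue_measure_set1 // => x /=.
    by move=> /contrapT.
  apply: filterS; first exact: (ae_filter_ringOfSetsType mu).
  move=> x xs _; rewrite !indicE !mem_setE /= !in_itv /= andbT.
  case: (ltgtP x s) => [||//]; rewrite ?mulr0 ?mulr1 ?subrr ?subr0 //.
rewrite [X in X + _](_ : _ =
    \int[mu]_(s in D) ((\int[mu]_(x in D) g x) * f s - f s * prim g s)); last first.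
  by apply: eq_Rintegral => s _; apply: etrans (h2 s) _; rewrite mulrBr (mulrC (f s)).
rewrite RintegralB //; first last.
- exact: (L2_mul mD Lf (prim_L2 Lg)).
- exact: (integrableZl mD (\int[mu]_(x in D) g x) If).
by rewrite RintegralZl // subrK mulrC.
Qed.

End Primitives.

(** * Weak derivatives and the du Bois-Reymond lemma *)

Section WeakDerivatives.
Variables (R : realType) (c : R).
Hypothesis c0 : 0 < c.
Local Notation mu := (@lebesgue_measure R).
Local Notation D := (`]0, c[%classic : set (measurableTypeR R)).
Local Notation L := (L2 mu D).
Local Notation ip := (ipL mu D).
Local Notation P := (prim c).
Local Notation nrm := (nrm c).
Local Notation weak := (weak_derivative 0 c).
Implicit Types (f g w psi phi : R -> R) (x y : R).
Let mD := mD c.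
Let fD := fD c0.
Local Hint Resolve mD fD : core.

Lemma subset_openE (I : set R) x y : x < y -> `]x, y[ `<=` I ->
  (forall N, measurable (N : set (measurableTypeR R)) -> mu N = 0%E -> ~ (I `<=` N)).
Proof.
move=> xy xyI N mN N0 IN.
have : (mu `]x, y[ <= mu N)%E.
  by apply: le_measure; rewrite ?inE //; exact: subset_trans IN.
rewrite N0 lebesgue_measure_itv /= lte_fin xy -EFinB lee_fin.
by rewrite leNgt subr_gt0 xy.
Qed.

(** A difference that is nonzero at x stays nonzero near x in [0, c], hence on a nonempty open
    interval even when x is an endpoint; such an interval is not null. *)
Lemma ae_continuous_eq f g : {within `[0, c], continuous f} ->
  {within `[0, c], continuous g} -> f = g %[ae mu in D] ->
  forall x, 0 <= x <= c -> f x = g x.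
Proof.
move=> cf cg fg x xc; apply/eqP; rewrite -subr_eq0; apply/eqP; apply: contrapT => /eqP h0.
have /subspace_continuousP ch : {within `[0, c], continuous (fun x => f x - g x)}.
  by move=> z; apply: cvgB; [exact: cf|exact: cg].
have xI : `[0, c]%classic x by rewrite /= in_itv.
have := ch x xI; move=> /cvgrPdist_lt /(_ `|f x - g x| ltac:(by rewrite normr_gt0)).
rewrite near_withinE => /nbhs_ballP[d /= d0 hd].
have [N [mN N0 sN]] := fg.
apply: (@subset_openE _ (Num.max 0 (x - d)) (Num.min c (x + d)) _ (@subset_refl _ _) N mN N0).
- case/andP: xc => x0 xc; rewrite gt_max !lt_min c0 /=; apply/and3P; split; lra.
move=> y /=; rewrite in_itv /= gt_max lt_min => /andP[/andP[y0 yd] /andP[yc dy]].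
apply: sN => /= fgy; have Dy : D y by rewrite /= in_itv /= y0.
have fgy0 : f y - g y = 0 by rewrite fgy ?subrr.
have xy : ball x d y by rewrite /ball /= ltr_distlC; apply/andP; split; lra.
have yI : y \in `[0, c] by rewrite in_itv /= !ltW.
by have := hd y xy yI; rewrite /from_subspace fgy0 subr0 ltxx.
Qed.

(** By Lebesgue differentiation P f has derivative f almost everywhere, and a constant has
    derivative zero. *)
Lemma prim_const_null f (k : R) : L f -> (forall x, D x -> P f x = k) -> f = 0 %[ae mu in D].
Proof.
move=> Lf hk; have If := L2_integrable mD fD Lf.
have IfT : mu.-integrable setT (EFin \o (f \_ D)).
  by rewrite -restrict_EFin; exact: (integrable_mkcond _ mD).1.
have loc : locally_integrable [set: R] (f \_ D).
  by apply: integrable_locally => //; exact: openT.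
have Iy y : mu.-integrable `]-oo, y] (EFin \o (f \_ D)).
  exact: (@integrableS _ _ _ mu setT).
have := FTC1Ny Iy loc; apply: filterS; first exact: (ae_filter_ringOfSetsType mu).
move=> x [_ dx] Dx.
have <- : (f \_ D) x = f x by rewrite patchE mem_set.
rewrite -dx derive1E (@near_eq_derive _ _ _ _ (cst k)) ?derive_cst //.
near=> y; rewrite -prim_itv hk //=.
by near: y; exact: near_in_itvoo.
Unshelve. all: by end_near. Qed.

(** Bumps of mean zero serve as derivatives of test functions: [prim_bump] recovers the test
    function as the primitive. *)
Definition bump psi := continuous psi /\
  exists2 d : R, 0 < d & forall x, x < d \/ c - d < x -> psi x = 0.

Lemma bump_L2 psi : bump psi -> L psi.
Proof. by move=> [cpsi _]; exact: continuous_L2. Qed.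

Lemma bump_patch psi : bump psi -> psi \_ D = psi.
Proof.
move=> [_ [d d0 hd]]; apply/funext => x; rewrite patchE; case: ifPn => //.
rewrite mem_setE in_itv /= negb_and -!leNgt => /orP h; apply/esym/hd.
by case: h => h; [left|right]; lra.
Qed.

Lemma prim_bump psi : bump psi -> \int[mu]_(x in D) psi x = 0 ->
  test_fun 0 c (P psi) /\ derive1 (P psi) = psi.
Proof.
move=> bpsi psi0; have [cpsi [d d0 hd]] := bpsi.
have Lpsi := bump_L2 bpsi; have Ipsi := L2_integrable mD fD Lpsi.
have IT : mu.-integrable setT (EFin \o psi).
  by rewrite -(bump_patch bpsi) -restrict_EFin; exact: (integrable_mkcond _ mD).1.
have PE : P psi = (fun x => \int[mu]_(s in [set` Interval -oo%O (BRight x)]) psi s).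
  by apply/funext => x; rewrite prim_itv bump_patch.
have dP x : derivable (P psi) x 1 /\ derive1 (P psi) x = psi x.
  rewrite PE; apply: (@continuous_FTC1 R psi -oo%O x (x + 1)) => //.
  - by rewrite ltrDl.
  - exact: (@integrableS _ _ _ mu setT).
  - by rewrite ltNyr.
  - exact: cpsi.
have dE : derive1 (P psi) = psi by apply/funext => x; case: (dP x).
split=> //; split; first by move=> x; case: (dP x).
  by rewrite dE.
(* Left of d nothing has been integrated yet; right of c - d the whole integral, zero, has. *)
have sub : [set x | P psi x != 0] `<=` `[d, c - d].
  move=> x /= Px; rewrite in_itv /=; apply/andP; split; rewrite leNgt;
    apply: contra Px => hx; apply/eqP.
    rewrite /prim (@eq_Rintegral _ _ _ mu D (cst 0)) ?Rintegral_cst ?mul0r // => s _.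
    rewrite indicE mem_setE in_itv /=; case: leP => sx; last by rewrite mulr0.
    by rewrite hd ?mul0r //; left; exact: le_lt_trans sx hx.
  rewrite -[RHS]psi0; apply: eq_Rintegral => s _.
  rewrite indicE mem_setE in_itv /=; case: leP => sx; first by rewrite mulr1.
  by rewrite mulr0 hd //; right; exact: lt_trans hx sx.
have cl : closed (`[d, c - d]%classic : set R) by exact: itv_closed.
move=> x hx; have := (proj1 (closure_id _) cl) => clE.
have : `[d, c - d]%classic x by rewrite clE; exact: closure_subset hx.
rewrite /= !in_itv /=.
by move=> /andP[h1 h2]; apply/andP; split; lra.
Qed.

Lemma test_continuous phi : test_fun 0 c phi -> continuous phi.
Proof.
by move=> [dphi _ _] x; apply: differentiable_continuous; apply/derivable1_diffP.
Qed.

Lemma test_L2 phi : test_fun 0 c phi -> L phi /\ L (derive1 phi).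
Proof.
move=> tphi; split; first exact: continuous_L2 (test_continuous tphi).
by case: tphi => _ cphi _; exact: continuous_L2.
Qed.

Lemma test_out phi x : test_fun 0 c phi -> ~ D x -> phi x = 0.
Proof.
move=> [_ _ sphi] Dx; apply/eqP; apply: contrapT => /negP h; apply: Dx.
by apply: sphi; apply: subset_closure.
Qed.

Lemma test_FTC phi x : test_fun 0 c phi -> 0 < x ->
  \int[mu]_(s in `[0, x]) derive1 phi s = phi x.
Proof.
move=> tphi x0; have [dphi cphi _] := tphi; have cf := test_continuous tphi.
have phi0 : phi 0 = 0 by apply: test_out => //=; rewrite in_itv /= ltxx.
have FTC := @continuous_FTC2 _ (derive1 phi) phi 0 x x0.
apply: etrans (congr1 fine (FTC _ _ _)) _; last by rewrite phi0 sube0.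
- by apply: continuous_subspaceT.
- split; first by move=> z _.
  + by apply: cvg_at_right_filter; exact: cf.
  + by apply: cvg_at_left_filter; exact: cf.
- by [].
Qed.

Lemma test_prim phi x : test_fun 0 c phi -> D x -> P (derive1 phi) x = phi x.
Proof.
move=> tphi; rewrite /= in_itv /= => /andP[x0 xc].
have [_ L'] := test_L2 tphi.
have I' : mu.-integrable `]0, x] (EFin \o derive1 phi).
  apply: (@integrableS _ _ _ mu D) => //; last exact: L2_integrable.
  by move=> s /=; rewrite !in_itv /= => /andP[-> /=] /le_lt_trans; apply.
rewrite -(test_FTC tphi x0) -Rintegral_itv_obnd_cbnd // /prim.
rewrite Rintegral_mkcond [RHS]Rintegral_mkcond; apply: eq_Rintegral => s _.
rewrite !patchE indicE !mem_setE !in_itv /=.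
case: (ltP 0 s) => s0 //=; case: (leP s x) => sx /=; last by rewrite mulr0 if_same.
by rewrite (le_lt_trans sx xc) mulr1.
Qed.

Lemma test_mean phi : test_fun 0 c phi -> \int[mu]_(s in D) derive1 phi s = 0.
Proof.
move=> tphi; have [_ L'] := test_L2 tphi; have I' := L2_integrable mD fD L'.
have phic : phi c = 0 by apply: test_out => //=; rewrite in_itv /= ltxx andbF.
rewrite -[RHS]phic -(test_FTC tphi c0) Rintegral_itv_bndo_bndc // Rintegral_itv_obnd_cbnd //.
by apply: (@integrableS _ _ _ mu `[0, c]) => //;
  [exact: subset_itv_oc_cc|apply: continuous_compact_integrable;
   [exact: segment_compact|apply: continuous_subspaceT; by case: tphi]].
Qed.

(** For p < q this is continuous and positive exactly on ]p, q[. Multiplied by n and cut at height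
    1, it increases to the indicator of that interval. *)
Definition trap (p q x : R) := Num.max 0 ((x - p) * (q - x)).
Definition ramp (p q : R) (n : nat) x := Num.min 1 (n%:R * trap p q x).

Lemma trap_in p q x : p < x -> x < q -> 0 < trap p q x.
Proof. by move=> px xq; rewrite /trap lt_max mulr_gt0 ?orbT // subr_gt0. Qed.

Lemma trap_out p q x : p < q -> x <= p \/ q <= x -> trap p q x = 0.
Proof.
move=> pq h; rewrite /trap max_l //; case: h => h.
  by apply: mulr_le0_ge0; rewrite ?subr_le0 ?subr_ge0 // (le_trans h (ltW pq)).
by apply: mulr_ge0_le0; rewrite ?subr_le0 ?subr_ge0 // (le_trans (ltW pq) h).
Qed.

Lemma trap_continuous p q : continuous (trap p q).
Proof.
have -> : trap p q = (fun x => (0 + (x - p) * (q - x) + `|0 - (x - p) * (q - x)|) / 2).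
  by apply/funext => x; rewrite /trap maxr_absE.
move=> x; have h : (z - p) * (q - z) @[z --> x] --> (x - p) * (q - x).
  by apply: cvgM; apply: cvgB => //; exact: cvg_cst.
apply: cvgM; last exact: cvg_cst.
by apply: cvgD; [|apply: cvg_norm; apply: cvgB => //; exact: cvg_cst];
  apply: cvgD => //; exact: cvg_cst.
Qed.

Lemma ramp_continuous p q n : continuous (ramp p q n).
Proof.
have -> : ramp p q n = (fun x => (1 + n%:R * trap p q x - `|1 - n%:R * trap p q x|) / 2).
  by apply/funext => x; rewrite /ramp minr_absE.
move=> x; have h : n%:R * trap p q z @[z --> x] --> n%:R * trap p q x.
  by apply: cvgM; [exact: cvg_cst|exact: trap_continuous].
apply: cvgM; last exact: cvg_cst.
by apply: cvgB; [apply: cvgD => //; exact: cvg_cst|apply: cvg_norm; apply: cvgB => //;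
    exact: cvg_cst].
Qed.

Lemma bump_ramp p q n : 0 < p -> p < q -> q < c -> bump (ramp p q n).
Proof.
move=> p0 pq qc; split; first exact: ramp_continuous.
exists (Num.min p (c - q)); first by rewrite lt_min p0 subr_gt0.
move=> x hx; rewrite /ramp trap_out ?mulr0 ?min_r //.
case: hx; rewrite ?lt_min; first by move=> /andP[/ltW ? _]; left.
by rewrite ltrBlDl -ltrBlDr lt_min => /andP[_ h]; right; lra.
Qed.

(** The point q is excluded because every ramp vanishes there, while ]p, q] is the interval cut out
    by a difference of two primitives. *)
Lemma ramp_cvg p q x : p < q -> x <> q ->
  ramp p q n x @[n --> \oo] --> (\1_(`]p, q]) x : R).
Proof.
move=> pq xq; rewrite indicE mem_setE in_itv /=.
case: (ltP p x) => px /=; last first.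
  have -> : (fun n => ramp p q n x) = cst 0.
    by apply/funext => n; rewrite /ramp trap_out ?mulr0 ?min_r //; left.
  exact: cvg_cst.
case: (leP x q) => hq /=; last first.
  have -> : (fun n => ramp p q n x) = cst 0.
    by apply/funext => n; rewrite /ramp trap_out ?mulr0 ?min_r //; right; exact: ltW.
  exact: cvg_cst.
have {xq}hq : x < q by rewrite lt_neqAle hq andbT; apply/eqP.
have t0 := trap_in px hq.
apply: cvg_near_cst; exists (Num.truncn (trap p q x)^-1).+1 => // n /= hn.
rewrite /ramp min_l // -ler_pdivrMr // div1r.
by apply: le_trans (ltW (truncnS_gt _)) _; rewrite ler_nat.
Qed.

(** Testing with ramps, dominated convergence gives g zero integral over every ]p, q], so its
    primitive is constant on ]0, c[. *)
Lemma bump_null g : L g -> (forall psi, bump psi -> ip g psi = 0) -> g = 0 %[ae mu in D].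
Proof.
move=> Lg h; have Ig := L2_integrable mD fD Lg; have mg := L2_measurable mD Lg.
have inc p q : 0 < p -> p < q -> q < c -> P g p = P g q.
  move=> p0 pq qc; apply/eqP; rewrite eq_sym -subr_eq0; apply/eqP.
  have -> : P g q - P g p = ip g (\1_(`]p, q])).
    have L1 : L (\1_(`]p, q]) : R -> R) by apply: indic_L2 => //; exact: measurable_itv.
    rewrite !primE !(ipLC mu D g); apply/eqP; rewrite subr_eq addrC; apply/eqP.
    rewrite -(ipL_add mD (step_L2 c0 p) L1 Lg); congr ipL; apply/funext => s.
    rewrite !fctE !indicE !mem_setE !in_itv /=.
    case: (leP s p) => sy /=; last by rewrite add0r.
    by rewrite (le_trans sy (ltW pq)) addr0.
  pose F n s : \bar R := (g s * ramp p q n s)%:E.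
  have Lr n : L (ramp p q n) by apply: bump_L2; exact: bump_ramp.
  have m1 n : measurable_fun D (F n).
    by apply/measurable_EFinP; apply: measurable_funM => //; exact: (L2_measurable mD (Lr n)).
  have m2 : measurable_fun D (EFin \o (fun s => g s * \1_(`]p, q]) s)).
    by apply/measurable_EFinP; apply: measurable_funM => //; exact: measurable_indic.
  have ae : {ae mu, forall x, D x -> F ^~ x @ \oo --> (EFin \o (fun s => g s * \1_(`]p, q]) s)) x}.
    have : {ae mu, forall x, x <> q}.
      exists [set q]; split; rewrite ?lebesgue_measure_set1 // => x /=.
      by move=> /contrapT.
    apply: filterS; first exact: (ae_filter_ringOfSetsType mu).
    move=> x xq _; apply: cvg_EFin; first exact: nearW.
    by apply: cvgM; [exact: cvg_cst|exact: ramp_cvg].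
  have dom : {ae mu, forall x n, D x -> (`|F n x| <= `|(EFin \o g) x|)%E}.
    apply: aeW => x n _; rewrite /F lee_fin normrM ler_piMr //.
    rewrite ger0_norm /ramp ?ge_min ?lexx // le_min ler01 mulr_ge0 //.
    by rewrite /trap le_max lexx.
  have [_ _ hF] := dominated_convergence mD m1 m2 ae (integrable_abse Ig) dom.
  have F0 n : (\int[mu]_(s in D) F n s = 0)%E.
    have Igr := L2_mul mD Lg (Lr n).
    rewrite -[LHS]fineK; last exact: integrable_fin_num.
    by congr EFin; exact: h (bump_ramp _ _ _ _).
  have -> : ip g (\1_(`]p, q])) = fine (\int[mu]_(s in D) (g s * \1_(`]p, q]) s)%:E) by [].
  have := cvg_lim _ hF => <- //.
  by under eq_fun do rewrite F0; rewrite lim_cst.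
apply: (prim_const_null (k := P g (c / 2))) => // x; rewrite /= in_itv /= => /andP[x0 xc].
case: (ltgtP x (c / 2)) => [xl|xl|-> //]; [|symmetry]; apply: inc => //; lra.
Qed.

Lemma prim_sub f g : L f -> L g -> P (f - g) = P f - P g.
Proof.
move=> Lf Lg; have := prim_linear c0 (-1) Lg Lf.
by rewrite !scaleN1r addrC => ->; rewrite addrC.
Qed.

Lemma bump_linear a psi1 psi2 : bump psi1 -> bump psi2 -> bump (a *: psi1 + psi2).
Proof.
move=> [c1 [d1 d10 h1]] [c2 [d2 d20 h2]]; split.
  by move=> x; apply: cvgD; [apply: cvgM; [exact: cvg_cst|exact: c1]|exact: c2].
exists (Num.min d1 d2); first by rewrite lt_min d10.
move=> x hx.
have [a1 a2] : (x < d1 \/ c - d1 < x) /\ (x < d2 \/ c - d2 < x).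
  case: hx => hx.
    by move: hx; rewrite lt_min => /andP[? ?]; split; left.
  have : c - x < Num.min d1 d2 by lra.
  by rewrite lt_min => /andP[? ?]; split; right; lra.
by rewrite !fctE h1 // h2 // scaler0 addr0.
Qed.

(** Subtracting from a bump a multiple of a fixed bump [eta] of nonzero mean leaves a bump of mean
    zero; this reduces the claim to [bump_null] and determines the constant. *)
Lemma du_bois_reymond f : L f ->
  (forall psi, bump psi -> \int[mu]_(x in D) psi x = 0 -> ip f psi = 0) ->
  exists k, f = cst k %[ae mu in D].
Proof.
move=> Lf h.
have [p [q [p0 pq qc pm mq]]] : exists p q : R, [/\ 0 < p, p < q, q < c, p < c / 2 & c / 2 < q].
  have c4 : 0 < c / 4 by rewrite divr_gt0.
  have -> : c / 2 = 2 * (c / 4) by field.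
  exists (c / 4), (3 * (c / 4)); have : c = 4 * (c / 4) by field.
  by move: (c / 4) c4 => e e0 ->; split; lra.
pose eta := ramp p q 1; have beta : bump eta by exact: bump_ramp.
have Leta := bump_L2 beta.
pose I psi := \int[mu]_(x in D) psi x.
have Ieta : I eta != 0.
  (* [ipL_null] speaks about squares, so the nonnegative [eta] is written as the square of [r]. *)
  apply/eqP => I0; pose r (x : R) : R := Num.sqrt (eta x).
  have eta0 x : 0 <= eta x.
    by rewrite /eta /ramp le_min ler01 mul1r /trap le_max lexx.
  have rE : (fun x => r x ^+ 2) = eta by apply/funext => x; rewrite sqr_sqrtr.
  have Lr : L r.
    apply/(L2P _ mD); split; last by rewrite rE; exact: L2_integrable.
    apply: measurable_funTS; apply: continuous_measurable_fun => x.
    by apply: continuous_comp; [exact: ramp_continuous|exact: sqrt_continuous].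
  have r0 : ip r r = 0.
    by rewrite -[RHS]I0; apply: eq_Rintegral => x _; rewrite -expr2 -rE.
  have etaz : eta = 0 %[ae mu in D].
    have := ipL_null mD Lr r0; apply: filterS => x hx Dx.
    by rewrite -rE /= hx // expr0n.
  have := @ae_continuous_eq eta 0 _ _ etaz (c / 2).
  have -> : 0 <= c / 2 <= c by apply/andP; split; lra.
  move=> h2; have {h2} : eta (c / 2) = 0.
    by apply: h2 => //; apply: continuous_subspaceT => x; [exact: ramp_continuous|exact: cvg_cst].
  rewrite /eta /ramp mul1r => e0.
  have : 0 < Num.min 1 (trap p q (c / 2)).
    by rewrite lt_min ltr01 trap_in.
  by rewrite e0 ltxx.
exists (ip f eta / I eta); set k := _ / _.
have Lk : L (cst k) by exact: L2_cst.
have := @bump_null (f - cst k) (L2_sub mD fD Lf Lk) _.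
move=> h0; have : f - cst k = 0 %[ae mu in D].
  apply: h0 => psi bpsi; have Lpsi := bump_L2 bpsi.
  pose a := I psi / I eta; pose chi := (- a) *: eta + psi.
  have bchi : bump chi by exact: bump_linear.
  have Ichi : I chi = 0.
    have := ipL_linear mD (- a) Leta Lpsi (L2_cst mD fD 1).
    have ip1 g : ip g (cst 1) = I g by apply: eq_Rintegral => x _; rewrite mulr1.
    by rewrite !ip1 -/chi => ->; rewrite /a; field.
  have := h _ bchi Ichi; rewrite ipLC ipL_linear // -/chi.
  rewrite (ipLC mu D eta) (ipLC mu D psi) => hf.
  have := ipL_linear mD (-1) Lk Lf Lpsi; rewrite scaleN1r addrC => ->.
  have -> : ip (cst k) psi = k * I psi.
    by rewrite /I -RintegralZl //; exact: L2_integrable.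
  by move: hf; rewrite /a /k => hf; rewrite -[RHS]hf; field.
by apply: filterS => x hx Dx; apply/eqP; rewrite -subr_eq0; apply/eqP; exact: hx.
Qed.

(** In [prim_parts] for g and phi', both the boundary term and the constant k meet the mean of phi',
    which is zero. *)
Lemma weak_prim f g (k : R) : L f -> L g -> f = cst k + P g %[ae mu in D] -> weak f g.
Proof.
move=> Lf Lg fE; split => // phi tphi; have [Lphi Ldphi] := test_L2 tphi.
have LP := prim_L2 c0 Lg.
rewrite -/(ip f (derive1 phi)) -/(ip g phi).
rewrite (ipL_ae mD Lf (L2_add mD (L2_cst mD fD k) LP) Ldphi Ldphi fE (ae_eq_refl _ _ _)).
rewrite ipL_add //; last exact: L2_cst.
have -> : ip (cst k) (derive1 phi) = 0.
  by rewrite /ipL RintegralZl //; [rewrite test_mean // mulr0|exact: L2_integrable].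
have := prim_parts c0 Lg Ldphi; rewrite test_mean // mulr0.
have -> : ip g (P (derive1 phi)) = ip g phi.
  by apply: eq_Rintegral => x; rewrite inE => Dx; rewrite test_prim.
by move=> h; lra.
Qed.

(** [f - P g] is orthogonal to derivatives of test functions, in particular to bumps of mean zero,
    hence constant. *)
Lemma weak_rep f g : weak f g -> exists k, f = cst k + P g %[ae mu in D].
Proof.
move=> [Lf Lg h]; have LP := prim_L2 c0 Lg.
have [_ _ h'] := @weak_prim (P g) g 0 LP Lg ltac:(by apply: aeW => x _; rewrite !fctE add0r).
have [|k hk] := @du_bois_reymond (f - P g) (L2_sub mD fD Lf LP).
  move=> psi bpsi psi0; have [tphi <-] := prim_bump bpsi psi0; have [Lphi Ldphi] := test_L2 tphi.
  have := ipL_linear mD (-1) LP Lf Ldphi; rewrite scaleN1r addrC => ->.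
  by have := h _ tphi; have := h' _ tphi; rewrite /ipL => -> ->; rewrite mulN1r opprK subrr.
exists k; apply: filterS hk => x hx Dx.
by have := hx Dx; rewrite !fctE => /eqP; rewrite subr_eq => /eqP.
Qed.

Lemma prim_rep_unique f (k k' : R) g g' : L g -> L g' ->
  f = cst k + P g %[ae mu in D] -> f = cst k' + P g' %[ae mu in D] ->
  k = k' /\ g = g' %[ae mu in D].
Proof.
move=> Lg Lg' h h'.
have eqx : forall x, 0 <= x <= c -> k + P g x = k' + P g' x.
  apply: (@ae_continuous_eq (fun x => k + P g x) (fun x => k' + P g' x)).
  - by apply: continuous_subspaceT => x; apply: cvgD; [exact: cvg_cst|exact: prim_continuous].
  - by apply: continuous_subspaceT => x; apply: cvgD; [exact: cvg_cst|exact: prim_continuous].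
  by apply: filterS2 h h' => x hx hx' Dx; have := hx Dx; rewrite hx'.
have kk : k = k'.
  by have := eqx 0 ltac:(by rewrite lexx ltW); rewrite !prim0 !addr0.
split => //.
have : g - g' = 0 %[ae mu in D].
  apply: (prim_const_null (k := 0)); first exact: L2_sub.
  move=> x Dx; rewrite prim_sub // !fctE; have := eqx x.
  have -> : 0 <= x <= c by move: Dx; rewrite /= in_itv /= => /andP[? ?]; rewrite !ltW.
  by move=> /(_ isT); rewrite kk => /addrI ->; rewrite subrr.
by apply: filterS => x hx Dx; apply/eqP; rewrite -subr_eq0; apply/eqP; exact: hx.
Qed.

Lemma weak_unique f g g' : weak f g -> weak f g' -> g = g' %[ae mu in D].
Proof.
move=> h h'; have [k hk] := weak_rep h; have [k' hk'] := weak_rep h'.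
by case: h h' => [_ Lg _] [_ Lg' _]; have [] := prim_rep_unique Lg Lg' hk hk'.
Qed.

Lemma wderivP f g : weak f g -> weak f (wderiv 0 c f) /\ wderiv 0 c f = g %[ae mu in D].
Proof.
move=> h; have h' : weak f (wderiv 0 c f) by apply: (xgetPex _ (ex_intro _ g h)).
by split => //; exact: weak_unique h' h.
Qed.

Lemma point_value_rep f g (k x y : R) : L g -> f = cst k + P g %[ae mu in D] ->
  0 <= x <= c -> point_value 0 c f x y <-> y = k + P g x.
Proof.
move=> Lg fE xc.
have cont : {within `[0, c], continuous (fun x => k + P g x)}.
  by apply: continuous_subspaceT => z; apply: cvgD; [exact: cvg_cst|exact: prim_continuous].
split=> [[h [ch fh <-]]|->].
  apply: (@ae_continuous_eq h (fun x => k + P g x)) => //.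
  have {}fh : f = h %[ae mu in D] := fh.
  by apply: filterS2 fh fE => z h1 h2 Dz; rewrite -h1 // h2.
by exists (fun x => k + P g x); split.
Qed.

End WeakDerivatives.

(** * The space H^1_0 as primitives of mean-zero functions *)

Section ZeroTrace.
Variables (R : realType) (c : R).
Hypothesis c0 : 0 < c.
Local Notation mu := (@lebesgue_measure R).
Local Notation D := (`]0, c[%classic : set (measurableTypeR R)).
Local Notation L := (L2 mu D).
Local Notation ip := (ipL mu D).
Local Notation P := (prim c).
Local Notation nrm := (nrm c).
Local Notation weak := (weak_derivative 0 c).
Implicit Types (f g w psi phi : R -> R) (x y : R).
Let mD := mD c.
Let fD := fD c0.
Local Hint Resolve mD fD : core.

Lemma sqr_nrm f : nrm f ^+ 2 = ip f f.
Proof. by rewrite sqr_sqrtr // ipL_ge0. Qed.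

Lemma nrm_ae f g : L f -> L g -> f = g %[ae mu in D] -> nrm f = nrm g.
Proof. by move=> Lf Lg fg; congr Num.sqrt; exact: (ipL_ae mD Lf Lg Lf Lg fg fg). Qed.

Lemma nrm_null f : L f -> nrm f = 0 -> f = 0 %[ae mu in D].
Proof. by move=> Lf f0; apply: (ipL_null mD Lf); rewrite -sqr_nrm f0 expr0n. Qed.

Lemma nrm_triangle f g : L f -> L g -> nrm (f + g) <= nrm f + nrm g.
Proof.
move=> Lf Lg; have [x <-] := smod_exists (L2_submodule mD fD) Lf.
have [y <-] := smod_exists (L2_submodule mD fD) Lg.
have := ler_hnormD (L2_semi_hilbert mD fD) x y.
by rewrite /hnorm linearD.
Qed.

Lemma int_linear (a : R) f g : L f -> L g ->
  \int[mu]_(x in D) (a *: f + g) x = a * \int[mu]_(x in D) f x + \int[mu]_(x in D) g x.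
Proof.
move=> Lf Lg; have := ipL_linear mD a Lf Lg (L2_cst mD fD 1).
have ip1 h : ip h (cst 1) = \int[mu]_(x in D) h x.
  by apply: eq_Rintegral => x _; rewrite mulr1.
by rewrite !ip1.
Qed.

Lemma int_sub f g : L f -> L g ->
  \int[mu]_(x in D) (f - g) x = \int[mu]_(x in D) f x - \int[mu]_(x in D) g x.
Proof.
move=> Lf Lg; rewrite (_ : f - g = (-1) *: g + f); last by rewrite scaleN1r addrC.
by rewrite int_linear // mulN1r addrC.
Qed.

Lemma H1norm_eq f g : weak f g -> H1norm 0 c f = Num.sqrt (ip f f + ip g g).
Proof.
move=> h; have [[_ Lw _] wE] := wderivP c0 h; have [Lf Lg _] := h.
rewrite /H1norm -(ipL_ae mD Lw Lg Lw Lg wE wE) -RintegralD //.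
- exact: (L2_mul mD Lf Lf).
- exact: (L2_mul mD Lw Lw).
Qed.

(** Density by orthogonality instead of mollification: w minus its projection onto mean-zero bumps
    is constant by du Bois-Reymond, and zero because its mean is. *)
Lemma bump_dense w (e : R) : L w -> \int[mu]_(x in D) w x = 0 -> 0 < e ->
  exists psi, [/\ bump c psi, \int[mu]_(x in D) psi x = 0 & nrm (w - psi) < e].
Proof.
move=> Lw w0 e0; have H := L2_semi_hilbert mD fD.
have [w' wE] := smod_exists (L2_submodule mD fD) Lw.
pose M (m : smod (L2_submodule mD fD)) :=
  bump c (val m) /\ \int[mu]_(x in D) (val m x) = 0.
have M0 : M 0.
  split; last by apply: etrans (Rint_cst c0 0) _; rewrite mul0r.
  by split; [move=> x; exact: cvg_cst|exists 1].
have ML a (x y : smod (L2_submodule mD fD)) : M x -> M y -> M (a *: x + y).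
  move=> [bx ix] [by' iy]; rewrite /M linearP; split; first exact: bump_linear.
  by rewrite (int_linear a (smodP x) (smodP y)) ix iy mulr0 addr0.
have [p [pM pO]] := projection H M0 ML w'.
have Lp := smodP p.
have p0 : \int[mu]_(x in D) val p x = 0.
  apply/eqP; rewrite -normr_le0; apply: le_eps => d d0; rewrite add0r.
  have sc : 0 < Num.sqrt c by rewrite sqrtr_gt0.
  have [m [bm m0] hm] := pM (d / Num.sqrt c) ltac:(by rewrite divr_gt0).
  have := int_le_nrm c0 (L2_sub mD fD (smodP m) Lp).
  rewrite int_sub //; last exact: (smodP m).
  rewrite m0 sub0r normrN => /le_trans; apply.
  by rewrite -ler_pdivlMr // ltW //; move: hm; rewrite /hnorm linearB.
have [|k hk] := @du_bois_reymond _ c c0 (w - val p) (L2_sub mD fD Lw Lp).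
  move=> psi bpsi psi0; have [m mE] := smod_exists (L2_submodule mD fD) (bump_L2 bpsi).
  rewrite -wE -[val w' - val p]linearB -mE; apply: pO.
  by split; rewrite mE.
have Lk := L2_cst mD fD k.
have k0 : k = 0.
  have := ae_eq_Rintegral mD (L2_measurable mD (L2_sub mD fD Lw Lp)) (L2_measurable mD Lk) hk.
  rewrite Rint_cst // int_sub // w0 p0 subrr => /esym/eqP.
  by rewrite mulf_eq0 (gt_eqF c0) orbF => /eqP.
have [m [bm m0] hm] := pM e e0; exists (val m); split => //.
have Lm := smodP m.
rewrite (nrm_ae (g := val p - val m)); first by move: hm; rewrite (hnormBC H) /hnorm linearB.
- exact: (L2_sub mD fD Lw Lm).
- exact: (L2_sub mD fD Lp Lm).
apply: filterS hk => x hx Dx; have := hx Dx; rewrite k0 !fctE => /eqP.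
by rewrite subr_eq add0r => /eqP ->.
Qed.

(** A vanishing constant in [weak_rep] encodes f(0) = 0, and the zero mean of w then encodes f(c) =
    0; both hold for test functions and pass to H^1 limits. Conversely, mean-zero bumps
    approximating w have test functions as primitives. *)
Lemma H10P f : H10 0 c f <-> L f /\
  exists w, [/\ L w, \int[mu]_(x in D) w x = 0 & f = P w %[ae mu in D]].
Proof.
split=> [[[g hg] happ]|[Lf [w [Lw w0 fE]]]].
  have [Lf Lg _] := hg; split => //; exists g.
  have [k hk] := weak_rep c0 hg.
  have approx (e : R) : 0 < e -> exists phi, [/\ test_fun 0 c phi,
      nrm (f - phi) < e & nrm (g - derive1 phi) < e].
    move=> e0; have [phi tphi hphi] := happ e e0; exists phi.
    have [Lphi Ldphi] := test_L2 tphi.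
    have wk : weak (f \- phi) (g - derive1 phi).
      apply: (@weak_prim _ _ c0 _ _ k); [exact: (L2_sub mD fD Lf Lphi)|exact: (L2_sub mD fD
          Lg Ldphi)|].
      apply: filterS hk => x hx Dx /=; rewrite hx // prim_sub //.
      by rewrite !fctE (test_prim c0 tphi Dx) addrA.
    move: hphi; rewrite (H1norm_eq wk) => hphi; split => //.
      by apply: le_lt_trans hphi; rewrite ler_wsqrtr // lerDl ipL_ge0.
    by apply: le_lt_trans hphi; rewrite ler_wsqrtr // lerDr ipL_ge0.
  have sc : 0 < Num.sqrt c by rewrite sqrtr_gt0.
  split => //.
    apply/eqP; rewrite -normr_le0; apply: le_eps => d d0; rewrite add0r.
    have [phi [tphi _ hphi]] := approx (d / Num.sqrt c) ltac:(by rewrite divr_gt0).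
    have [Lphi Ldphi] := test_L2 tphi.
    have := int_le_nrm c0 (L2_sub mD fD Lg Ldphi).
    rewrite int_sub // (test_mean c0 tphi) subr0 => /le_trans; apply.
    by rewrite -ler_pdivlMr // ltW.
  suff k0 : k = 0.
    by apply: filterS hk => x hx Dx; rewrite hx // k0 !fctE add0r.
  apply/eqP; rewrite -normr_le0; apply: le_eps => d d0; rewrite add0r.
  have c1 : 0 < 1 + c by rewrite addr_gt0.
  have [phi [tphi h1 h2]] := approx (d * Num.sqrt c / (1 + c)) ltac:(by rewrite divr_gt0 //
      mulr_gt0).
  have [Lphi Ldphi] := test_L2 tphi.
  have Lk := L2_cst mD fD k.
  have LB := L2_sub mD fD Lg Ldphi.
  have L1 := L2_sub mD fD Lf Lphi.
  have LP := prim_L2 c0 LB.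
  (* phi is the primitive of phi', so the constant k equals (f - phi) - P (g - phi'), which is small
     in L^2. *)
  have kE : nrm (cst k) = nrm ((f - phi) + - P (g - derive1 phi)).
    apply: nrm_ae => //; first exact: (L2_sub mD fD L1 LP).
    apply: filterS hk => x hx Dx; rewrite prim_sub // !fctE hx // (test_prim c0 tphi Dx).
    by rewrite !fctE; ring.
  have kE2 : nrm (cst k) = `|k| * Num.sqrt c.
    rewrite /nrm -sqrtr_sqr -sqrtrM ?sqr_ge0 //; congr Num.sqrt.
    exact: etrans (Rint_cst c0 (k * k)) _.
  rewrite -(ler_pM2r sc) -kE2 kE.
  apply: le_trans (nrm_triangle L1 (L2_opp mD fD LP)) _.
  have -> : nrm (- P (g - derive1 phi)) = nrm (P (g - derive1 phi)).
    by congr Num.sqrt; apply: eq_Rintegral => x _; rewrite !fctE mulrNN.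
  have h3 := nrm_prim c0 LB.
  have : nrm (f - phi) + c * nrm (g - derive1 phi) <= (1 + c) * (d * Num.sqrt c / (1 + c)).
    rewrite [leRHS]mulrDl mul1r lerD ?(ltW h1) // ler_wpM2l ?(ltW c0) ?(ltW h2) //.
  rewrite [leRHS]mulrC divfK ?(gt_eqF c1) //; apply: le_trans.
  by rewrite lerD2l.
have wk : weak f w.
  by apply: (@weak_prim _ _ c0 _ _ 0) => //; apply: filterS fE => x hx Dx;
      rewrite hx // !fctE add0r.
split; first by exists w.
move=> e e0; have c1 : 0 < c + 1 by rewrite addr_gt0.
have [psi [bpsi psi0 hpsi]] := bump_dense Lw w0 (divr_gt0 e0 c1).
have Lpsi := bump_L2 bpsi.
have [tphi dphi] := prim_bump c0 bpsi psi0; exists (P psi) => //.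
have LB := L2_sub mD fD Lw Lpsi.
have E2 : f \- P psi = P (w - psi) %[ae mu in D].
  by apply: filterS fE => x hx Dx /=; rewrite hx // prim_sub.
have LfP := L2_sub mD fD Lf (prim_L2 c0 Lpsi).
rewrite (@H1norm_eq _ (w - psi)); last first.
  apply: (@weak_prim _ _ c0 _ _ 0) => //.
  by apply: filterS E2 => x hx Dx; rewrite hx // !fctE add0r.
rewrite -!sqr_nrm (nrm_ae LfP (prim_L2 c0 LB) E2).
have h1 := nrm_prim c0 LB; have h0 := nrm_ge0 c (P (w - psi)); have h0' := nrm_ge0 c (w - psi).
apply: (@le_lt_trans _ _ ((c + 1) * nrm (w - psi))); last by rewrite mulrC -ltr_pdivlMr.
rewrite -[leRHS]ger0_norm ?mulr_ge0 ?(ltW c1) // -sqrtr_sqr ler_wsqrtr //.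
by move: h1 h0 h0' c0; move: (nrm _) (nrm _) => a b; nra.
Qed.

End ZeroTrace.

(** * Square-integrable functions on a rectangle *)

Lemma L2_ae d (T : measurableType d) (R : realType) (m : {measure set T -> \bar R})
    (D : set T) (f g : T -> R) : measurable D -> measurable_fun D f ->
  L2 m D g -> f = g %[ae m in D] -> L2 m D f.
Proof.
move=> mD mf Lg fg; apply/(L2P _ mD); split => //.
have [mg Ig] := (L2P m mD g).1 Lg; apply/integrableP; split.
  by apply/measurable_EFinP; exact: measurable_funX.
have [_] := integrableP _ _ _ Ig; congr (_ < _)%E; apply: ae_eq_integral => //.
- by apply: measurableT_comp => //; apply/measurable_EFinP; exact: measurable_funX.
- by apply: measurableT_comp => //; apply/measurable_EFinP; exact: measurable_funX.
by apply: filterS fg => x hx Dx /=; rewrite hx.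
Qed.

(** Tonelli gives measurability for nonnegative integrands, so positive and negative parts are
    treated separately. *)
Lemma Rint_param_measurable d1 d2 (T1 : measurableType d1) (T2 : measurableType d2)
    (R : realType) (m2 : {sigma_finite_measure set T2 -> \bar R}) (F : T1 * T2 -> R) :
  measurable_fun setT F -> measurable_fun setT (fun x => \int[m2]_y F (x, y)).
Proof.
move=> mF; have mE : measurable_fun setT (EFin \o F) by exact/measurable_EFinP.
have -> : (fun x => \int[m2]_y F (x, y)) = (fun x => fine
   (fubini_F m2 (EFin \o F)^\+%E x - fubini_F m2 (EFin \o F)^\-%E x)%E).
  apply/funext => x; rewrite /Rintegral integralE /fubini_F; congr (fine (_ - _)%E).
    by apply: eq_integral => y _; rewrite !funeposE.
  by apply: eq_integral => y _; rewrite !funenegE.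
apply: measurableT_comp => //; apply: emeasurable_funB.
- apply: measurable_fun_fubini_tonelli_F; first exact: measurable_funepos.
  by move=> z; exact: funepos_ge0.
- apply: measurable_fun_fubini_tonelli_F; first exact: measurable_funeneg.
  by move=> z; exact: funeneg_ge0.
Qed.

Section RectangleL2.
Context d1 d2 (T1 : measurableType d1) (T2 : measurableType d2) (R : realType).
Variables (m1 : {sigma_finite_measure set T1 -> \bar R}).
Variables (m2 : {sigma_finite_measure set T2 -> \bar R}).
Variables (D1 : set T1) (D2 : set T2).
Hypotheses (mD1 : measurable D1) (mD2 : measurable D2).
Hypotheses (fD1 : (m1 D1 < +oo)%E) (fD2 : (m2 D2 < +oo)%E).
Local Notation Q := (D1 `*` D2).
Local Notation mQ := (m1 \x m2)%E.
Implicit Types F G : T1 * T2 -> R.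

Lemma measurable_rect : measurable Q. Proof. exact: measurableX. Qed.

Lemma finite_rect : (mQ Q < +oo)%E.
Proof. by rewrite product_measure1E // lte_mul_pinfty // ge0_fin_numE. Qed.

Local Hint Resolve measurable_rect finite_rect : core.

Lemma rect_ae_sections F G : F = G %[ae mQ in Q] ->
  {ae m1, forall x, D1 x -> (fun y => F (x, y)) = (fun y => G (x, y)) %[ae m2 in D2]}.
Proof.
move=> [N [mN N0 sN]].
have : ae_eq m1 setT (m2 \o xsection N) (cst 0%E).
  apply: (proj1 (ae_eq_integral_abs m1 measurableT _)); first exact: measurable_fun_xsection.
  rewrite -[RHS]N0; apply: eq_integral => x _.
  by rewrite gee0_abs.
apply: filterS => x /(_ I) /= hx D1x; exists (xsection N x); split => //.
  exact: measurable_xsection.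
move=> y /= h; rewrite /xsection /= inE; apply: sN => /= h'; apply: h => D2y.
by apply: h'; split.
Qed.

Lemma rect_section_L2 F : L2 mQ Q F ->
  {ae m1, forall x, D1 x -> L2 m2 D2 (fun y => F (x, y))}.
Proof.
move=> LF; have IF := L2_integrable measurable_rect finite_rect LF.
have IF2 := L2_sqr measurable_rect LF.
have h1 := rect_section_integrable mD1 mD2 IF.
have h2 := rect_section_integrable mD1 mD2 IF2.
apply: filterS2 h1 h2 => x h1 h2 D1x; apply/(L2P _ mD2); split.
  by have /measurable_int/measurable_EFinP := h1 D1x.
exact: h2.
Qed.

Lemma ipL_rect F G : L2 mQ Q F -> L2 mQ Q G ->
  ipL mQ Q F G = \int[m1]_(x in D1) ipL m2 D2 (fun y => F (x, y)) (fun y => G (x, y)).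
Proof.
by move=> LF LG; rewrite /ipL (Rintegral_rect mD1 mD2 (L2_mul measurable_rect LF LG)).
Qed.

(** Assembling null sections into a null set requires joint measurability. Membership in L^2
    provides it, and Fubini computes the squared distance as an integral of zeros. *)
Lemma rect_ae F G : L2 mQ Q F -> L2 mQ Q G ->
  {ae m1, forall x, D1 x -> (fun y => F (x, y)) = (fun y => G (x, y)) %[ae m2 in D2]} ->
  F = G %[ae mQ in Q].
Proof.
move=> LF LG FG; have LB := L2_sub measurable_rect finite_rect LF LG.
suff B0 : F - G = 0 %[ae mQ in Q].
  by apply: filterS B0 => z hz Qz; apply/eqP; rewrite -subr_eq0; apply/eqP; exact: hz.
apply: (ipL_null measurable_rect LB); rewrite ipL_rect //.
have IB := L2_mul measurable_rect LB LB.
transitivity (\int[m1]_(x in D1) (cst (0 : R) x)); last by rewrite Rintegral_cst // mul0r.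
apply: ae_eq_Rintegral => //; first exact: (rect_int_measurable mD1 mD2 IB).
apply: filterS2 FG (rect_section_L2 LB) => x h1 h2 D1x; apply: (ipL_null_ae mD2 fD2 (h2 D1x)).
by apply: filterS (h1 D1x) => y hy D2y; rewrite !fctE hy // subrr.
Qed.

Lemma rect_int_integrable F : mQ.-integrable Q (EFin \o F) ->
  m1.-integrable D1 (EFin \o (fun x => \int[m2]_(y in D2) F (x, y))).
Proof.
move=> IF; have I1 := integrable_fubini_F (integrable_rectT mD1 mD2 IF).
have I2 := integrableS measurableT mD1 (@subsetT _ _) I1.
apply: (le_integrable mD1 _ _ I2); first by apply/measurable_EFinP;
    exact: (rect_int_measurable mD1 mD2 IF).
move=> x D1x /=; rewrite /fubini_F /Rintegral integral_mkcond.
rewrite [X in (_ <= `|X|)%E](_ : _ = (\int[m2]_y ((EFin \o (fun y => F (x, y))) \_ D2) y)%E);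
    last first.
  by apply: eq_integral => y _; rewrite restrict_EFin /= -(rect_section_patch D2 F D1x).
by case: (integral _ _ _) => [r| |] /=; rewrite ?normr0 ?leey.
Qed.

(** Sections of an L^2 function are square integrable for almost every x only. Multiplying by the
    indicator of the measurable set of good x allows estimates at every x. *)
Lemma regular_sections F : L2 mQ Q F -> exists G, [/\ L2 mQ Q G,
  forall x, D1 x -> L2 m2 D2 (fun y => G (x, y)) &
  {ae m1, forall x, D1 x -> forall y, G (x, y) = F (x, y)}].
Proof.
move=> LF; have mF := L2_measurable measurable_rect LF.
have mFT : measurable_fun setT (F \_ Q) by exact/(measurable_restrictT _ measurable_rect).
pose S (z : T1 * T2) : \bar R := ((F \_ Q) z ^+ 2)%:E.
have mS : measurable_fun setT S by apply/measurable_EFinP; exact: measurable_funX.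
have S0 z : (0 <= S z)%E by rewrite lee_fin sqr_ge0.
pose B := [set x | (fubini_F m2 S x < +oo)%E].
have mB : measurable B.
  rewrite -[B]setTI; apply: emeasurable_fun_infty_o => //.
  exact: measurable_fun_fubini_tonelli_F.
have SE x : D1 x -> fubini_F m2 S x = (\int[m2]_(y in D2) (F (x, y) ^+ 2)%:E)%E.
  move=> D1x; rewrite /fubini_F [RHS]integral_mkcond; apply: eq_integral => y _.
  rewrite /S patch_rect patchE mem_set //= !patchE; case: ifP => //.
  by rewrite expr0n.
have sL x : D1 x -> B x -> L2 m2 D2 (fun y => F (x, y)).
  move=> D1x Bx; have mx : measurable_fun D2 (fun y => F (x, y)).
    apply/(measurable_restrictT _ mD2); rewrite -(rect_section_patch D2 F D1x).
    exact: measurableT_comp mFT (measurable_pair1 x).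
  apply/(L2P _ mD2); split => //; apply/integrableP; split.
    by apply/measurable_EFinP; exact: measurable_funX.
  move: Bx; rewrite /B /= SE //; congr (_ < _)%E; apply: eq_integral => y _ /=.
  by rewrite ger0_norm // sqr_ge0.
have Bae : {ae m1, forall x, D1 x -> B x}.
  apply: filterS (rect_section_L2 LF) => x hx D1x.
  have [_ /integrableP[_]] := (L2P m2 mD2 _).1 (hx D1x).
  rewrite /B /= SE //; congr (_ < _)%E; apply: eq_integral => y _ /=.
  by rewrite ger0_norm // sqr_ge0.
exists (fun z => \1_B z.1 * F z); split.
- apply: (@L2_bounded _ _ _ _ _ measurable_rect F (fun z => \1_B z.1) 1) => //.
    have m1B : measurable_fun setT (\1_B : T1 -> R) by exact: measurable_indic.
    by apply: measurable_funTS; exact: (measurableT_comp m1B measurable_fst).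
  by move=> z _; rewrite indicE; case: (_ \in _); rewrite ?normr1 ?normr0.
- move=> x D1x; rewrite (_ : (fun y => _) = (fun y => (x \in B)%:R * F (x, y)));
    last by apply/funext => y; rewrite indicE.
  case: (boolP (x \in B)) => [|_].
    rewrite inE => Bx; rewrite (_ : (fun y => _) = (fun y => F (x, y))); first exact: sL.
    by apply/funext => y; rewrite mul1r.
  rewrite (_ : (fun y => _) = 0); first exact: L2_zero.
  by apply/funext => y; rewrite mul0r.
by apply: filterS Bae => x hx D1x y; rewrite indicE mem_set ?mul1r //; exact: hx.
Qed.

Lemma rect_int_L2 F : L2 mQ Q F -> L2 m1 D1 (fun x => \int[m2]_(y in D2) F (x, y)).
Proof.
move=> LF; have [G [LG sG GF]] := regular_sections LF.
have IF := L2_integrable measurable_rect finite_rect LF.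
have IG := L2_integrable measurable_rect finite_rect LG.
apply: (@L2_ae _ _ _ _ _ _ (fun x => \int[m2]_(y in D2) G (x, y))) => //.
- exact: (rect_int_measurable mD1 mD2 IF).
- pose h x := fine (m2 D2) * \int[m2]_(y in D2) (G (x, y) * G (x, y)).
  have Ih : m1.-integrable D1 (EFin \o h).
    exact: (integrableZl mD1 (fine (m2 D2)) (rect_int_integrable (L2_mul measurable_rect LG LG))).
  apply: (L2_dom mD1 _ Ih); first exact: (rect_int_measurable mD1 mD2 IG).
  move=> x D1x; have := L2_cauchy_schwarz mD2 fD2 (sG x D1x) (L2_cst mD2 fD2 1).
  have -> : ipL m2 D2 (fun y => G (x, y)) (cst 1) = \int[m2]_(y in D2) G (x, y).
    by apply: eq_Rintegral => y _; rewrite mulr1.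
  have -> : ipL m2 D2 (cst 1) (cst 1) = fine (m2 D2).
    by rewrite /ipL (@eq_Rintegral _ _ _ m2 D2 (cst 1)) ?Rintegral_cst ?mul1r // => y _;
        rewrite mulr1.
  rewrite -(@ler_pXn2r _ 2) ?nnegrE ?mulr_ge0 ?sqrtr_ge0 // real_normK ?num_real //.
  by rewrite exprMn !sqr_sqrtr ?ipL_ge0 ?fine_ge0 // mulrC.
by apply: filterS GF => x hx D1x; apply: eq_Rintegral => y _; rewrite hx.
Qed.

End RectangleL2.

(** * Products of primitives and the transport equation on one fibre *)

Section PrimitiveProduct.
Variables (R : realType) (c : R).
Hypothesis c0 : 0 < c.
Local Notation mu := (@lebesgue_measure R).
Local Notation D := (`]0, c[%classic : set (measurableTypeR R)).
Local Notation L := (L2 mu D).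
Local Notation ip := (ipL mu D).
Local Notation P := (prim c).
Implicit Types (f g : R -> R) (x y : R).
Let mD := mD c.
Let fD := fD c0.
Local Hint Resolve mD fD : core.

Lemma prim_add f g : L f -> L g -> P (f + g) = P f + P g.
Proof. by move=> Lf Lg; have := prim_linear c0 1 Lf Lg; rewrite !scale1r. Qed.

Lemma prim_scale (a : R) f : L f -> P (a *: f) = a *: P f.
Proof.
move=> Lf; have := prim_linear c0 a Lf (L2_zero mD fD); rewrite !addr0 => ->.
have -> : P 0 = 0 by apply/funext => x; rewrite primE ipL0.
by rewrite addr0.
Qed.

Lemma point_value_unique f x y y' : 0 <= x <= c ->
  point_value 0 c f x y -> point_value 0 c f x y' -> y = y'.
Proof.
move=> xc [g [cg fg <-]] [h [ch fh <-]].
have {}fg : f = g %[ae mu in D] := fg; have {}fh : f = h %[ae mu in D] := fh.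
apply: (ae_continuous_eq c0 cg ch) => //.
by apply: filterS2 fg fh => z h1 h2 Dz; rewrite -h1 // h2.
Qed.

Lemma L2_mul_prim f g : L f -> L g -> L (fun s => P f s * g s).
Proof.
move=> Lf Lg; apply: (@L2_bounded _ _ _ mu D mD g (P f) (nrm c f * Num.sqrt c)) => //.
  exact: (L2_measurable mD (prim_L2 c0 Lf)).
by move=> x Dx; exact: prim_le.
Qed.

Lemma prim_cut f x s : s <= x -> P (fun y => f y * \1_(`]-oo, x]) y) s = P f s.
Proof.
move=> sx; rewrite /prim; apply: eq_Rintegral => y _; rewrite -mulrA; congr (_ * _).
rewrite !indicE !mem_setE !in_itv /=; case: (leP y s) => ys; last by rewrite mulr0.
by rewrite (le_trans ys sx) mulr1.
Qed.

(** [prim_parts] for the two functions cut off at x, whose total integrals are P f x and P g x. *)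
Lemma prim_mul f g x : L f -> L g ->
  P f x * P g x = P (fun s => P f s * g s) x + P (fun s => P g s * f s) x.
Proof.
move=> Lf Lg.
have cutL h : L h -> L (fun y => h y * \1_(`]-oo, x]) y).
  move=> Lh; have := @L2_bounded _ _ _ mu D mD h (\1_(`]-oo, x])) 1 _ _ Lh.
  rewrite (_ : (fun y => _) = (fun y => h y * \1_(`]-oo, x]) y)); last first.
    by apply/funext => y; rewrite mulrC.
  apply; first by apply: measurable_indic; exact: measurable_itv.
  by move=> s _; rewrite indicE; case: (_ \in _); rewrite ?normr1 ?normr0.
have Lf' := cutL f Lf; have Lg' := cutL g Lg.
rewrite -[LHS](prim_parts c0 Lf' Lg'); congr (_ + _).
  rewrite /ipL [in RHS]/prim; apply: eq_Rintegral => s _;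
      rewrite mulrA !indicE !mem_setE !in_itv /=.
  by case: leP => sx; rewrite ?mulr0 // prim_cut.
rewrite ipLC /ipL [in RHS]/prim; apply: eq_Rintegral => s _;
    rewrite mulrA !indicE !mem_setE !in_itv /=.
by case: leP => sx; rewrite ?mulr0 // prim_cut.
Qed.

Lemma expR_continuous (a : R) : continuous (fun s : R => expR (a * s)).
Proof.
move=> x; apply: continuous_comp; last exact: continuous_expR.
by apply: cvgM; [exact: cvg_cst|exact: cvg_id].
Qed.

Lemma prim_expR (a x : R) : 0 <= x -> x <= c ->
  expR (a * x) = 1 + P (fun s => a * expR (a * s)) x.
Proof.
rewrite le_eqVlt => /orP[/eqP <- _|x0 xc]; first by rewrite prim0 mulr0 expR0 addr0.
pose F (s : R) := expR (a * s); pose f (s : R) := a * expR (a * s).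
have cf : continuous f.
  by move=> s; apply: cvgM; [exact: cvg_cst|exact: expR_continuous].
have If : mu.-integrable `[0, x] (EFin \o f).
  apply: continuous_compact_integrable; first exact: segment_compact.
  exact: continuous_subspaceT.
have -> : P f x = \int[mu]_(s in `[0, x]) f s.
  rewrite -Rintegral_itv_obnd_cbnd //; last first.
    by apply: integrableS If => //; exact: subset_itv_oc_cc.
  rewrite -[RHS]Rintegral_itv_bndo_bndc //; last first.
    by apply: integrableS If => //; exact: subset_itv_oo_cc.
  rewrite /prim Rintegral_mkcond [RHS]Rintegral_mkcond.
  apply: ae_eq_Rintegral => //.
  - apply/(measurable_restrictT _ mD); apply: measurable_funM.
      by apply: measurable_funTS; exact: continuous_measurable_fun.
    by apply: measurable_indic; exact: measurable_itv.
  - have mx : measurable (`]0, x[ : set (measurableTypeR R)) by exact: measurable_itv.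
    apply/(measurable_restrictT _ mx).
    by apply: measurable_funTS; exact: continuous_measurable_fun.
  have : {ae mu, forall y, y <> x}.
    exists [set x]; split; rewrite ?lebesgue_measure_set1 // => y /=.
    by move=> /contrapT.
  apply: filterS; first exact: (ae_filter_ringOfSetsType mu).
  move=> s sx _; rewrite !patchE indicE !mem_setE !in_itv /=.
  case: (ltP 0 s) => s0 //=; case: (ltgtP s x) => [sx'|sx'|/sx//].
    by rewrite (lt_le_trans sx' xc) mulr1.
  by rewrite mulr0 if_same.
have FTC := @continuous_FTC2 _ f F 0 x x0.
have -> : \int[mu]_(s in `[0, x]) f s = F x - F 0.
  apply: etrans (congr1 fine (FTC _ _ _)) _ => //.
  - exact: continuous_subspaceT.
  - split.
    + by move=> z _; rewrite /F; exact: ex_derive.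
    + by apply: cvg_at_right_filter; exact: expR_continuous.
    + by apply: cvg_at_left_filter; exact: expR_continuous.
  - move=> z _; have dl : is_derive z 1 (fun s : R => a *: s) (a *: 1) by apply: is_deriveZ.
    have de := @is_derive1_comp _ expR (fun s : R => a *: s) z (expR (a * z)) (a *: 1)
        (is_derive_expR _) dl.
    by rewrite derive1E; apply: etrans (@derive_val _ _ _ _ _ _ _ de) _;
        rewrite mulrC /GRing.scale /= mulr1.
by rewrite /F mulr0 expR0 addrC subrK.
Qed.

(** Variation of constants. As f is only square integrable, the equation is verified in integrated
    form, by the product rule [prim_mul] for the exponential and the primitive. *)
Lemma transport_ode (a k : R) f x : L f -> 0 <= x -> x <= c ->
  let z s := expR (- a * s) * (k + a * P (fun y => expR (a * y) * f y) s) in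
  z x = k + P (fun s => - a * (z s - f s)) x.
Proof.
move=> Lf x0 xc z.
have expL (b : R) g : L g -> L (fun y => expR (b * y) * g y).
  move=> Lg; apply: (@L2_bounded _ _ _ mu D mD g (fun y => expR (b * y)) (expR (`|b| * c))) => //.
    by apply: measurable_funTS; apply: continuous_measurable_fun; exact: expR_continuous.
  move=> y; rewrite /= in_itv /= => /andP[y0 yc]; rewrite ger0_norm ?expR_ge0 // ler_expR.
  apply: le_trans (ler_norm _) _; rewrite normrM ler_wpM2l // ger0_norm ?ltW //.
pose e (s : R) := expR (- a * s); pose h y := a * (expR (a * y) * f y).
have Lh : L h by exact: (L2_scale mD fD a (expL a f Lf)).
have PhE t : P h t = a * P (fun y => expR (a * y) * f y) t.
  exact: (congr1 (fun F => F t) (prim_scale a (expL a f Lf))).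
pose e' s := - a * e s.
have Le : L e by apply: continuous_L2; exact: expR_continuous.
have Le' : L e' by exact: (L2_scale mD fD (- a) Le).
have eE s : D s -> e s = 1 + P e' s.
  by rewrite /= in_itv /= => /andP[s0 sc]; exact: prim_expR (ltW s0) (ltW sc).
have LPh := prim_L2 c0 Lh.
have LeP : L (fun s => P h s * e' s) by exact: L2_mul_prim.
have LPe : L (fun s => P e' s * h s) by exact: L2_mul_prim.
have zE : z x = k * e x + (P h x + P e' x * P h x).
  rewrite /z -/(e x) PhE /= [in X in _ = X + _]mulrC mulrDr; congr (_ + _).
  by rewrite -[X in _ = X + _]mul1r -mulrDl {1}/e (prim_expR _ x0 xc).
have ex : e x = 1 + P e' x := prim_expR (- a) x0 xc.
rewrite zE prim_mul // ex mulrDr mulr1 -!addrA; congr (_ + _).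
have -> : k * P e' x = P (k *: e') x by rewrite prim_scale.
rewrite addrCA -[X in X + _]/(P h x).
have LkE := L2_scale mD fD k Le'.
have <- : P (k *: e' + (h + ((fun s => P e' s * h s) + (fun s => P h s * e' s)))) x =
    P (fun s => - a * (z s - f s)) x.
  apply: eq_Rintegral => s; rewrite inE => Ds; congr (_ * _); rewrite !fctE /=.
  have ee : expR (- a * s) * expR (a * s) = 1 by rewrite -expRD mulNr addNr expR0.
  have es := eE s Ds.
  rewrite /z -/(e s) PhE /= in es *; rewrite -[P e' s](addrK 1) (addrC _ 1) -es.
  rewrite /e' /h /GRing.scale /= -/(e s) in ee *.
  move: ee; rewrite -/(e s); move: (e s) (expR (a * s)) (P _ s) (f s) => u v p q uv.
  have -> : (u - 1) * (a * (v * q)) = a * (u * v) * q - a * (v * q) by ring.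
  rewrite uv; ring.
have L1 := L2_add mD LPe LeP; have L2' := L2_add mD Lh L1.
rewrite prim_add // fctE prim_add // fctE prim_add // !fctE; ring.
Qed.

End PrimitiveProduct.

(** * The delay variable *)

Lemma lebesgue_ae2 (R : realType) (A B C : R -> Prop) :
  {ae (@lebesgue_measure R), forall x, A x} -> {ae (@lebesgue_measure R), forall x, B x} ->
  (forall x, A x -> B x -> C x) -> {ae (@lebesgue_measure R), forall x, C x}.
Proof.
move=> hA hB ABC; move: hB; apply: filterS2; last exact: hA.
- exact: (ae_filter_ringOfSetsType lebesgue_measure).
- exact: ABC.
Qed.

Section DelayVariable.
Variables (R : realType) (l : R).
Hypothesis l0 : 0 < l.
Local Notation mu := (@lebesgue_measure R).
Local Notation T := (measurableTypeR R).
Local Notation Om := (`]0, l[%classic : set T).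
Local Notation I := (`]0, 1[%classic : set T).
Local Notation Q := (Om `*` I).
Local Notation mQ := (mu \x mu)%E.
Local Notation LQ := (L2 mQ Q).
Local Notation LO := (L2 mu Om).
Local Notation LI := (L2 mu I).
Local Notation P := (prim 1).
Implicit Types (z r f : R * R -> R) (w : R -> R).
Let mO := mD l.
Let fO := fD l0.
Let mI := mD (1 : R).
Let fI := fD (@ltr01 R).
Let mR : measurable Q := measurable_rect mO mI.
Let fR : (mQ Q < +oo)%E := finite_rect mO mI fO fI.
Local Hint Resolve mO fO mI fI mR fR : core.

(** This packs z in L^2(0, l; H^1(0, 1)), z_rho = r and z(., 0) = w into one statement about almost
    every fibre. *)
Definition rho_data z w r : Prop := [/\ LQ z, LO w, LQ r &
  {ae mu, forall x, Om x ->
    (fun s => z (x, s)) = cst (w x) + P (fun s => r (x, s)) %[ae mu in I]}].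

Lemma rho_weak z w r : rho_data z w r -> weak_rho_derivative l z r.
Proof.
move=> [Lz Lw Lr h]; split => //.
apply: filterS3 h (rect_section_L2 mO mI fO fI Lz) (rect_section_L2 mO mI fO fI Lr) => x h h1 h2 Ox.
exact: (weak_prim ltr01 (h1 Ox) (h2 Ox) (h Ox)).
Qed.

Lemma rho_trace0 z w r : rho_data z w r -> is_trace l z 0 w.
Proof.
move=> [Lz Lw Lr h]; split => //.
apply: filterS2 h (rect_section_L2 mO mI fO fI Lr) => x h h2 Ox.
apply: (proj2 (@point_value_rep _ _ ltr01 _ _ _ 0 (w x) (h2 Ox) (h Ox) _));
    first by rewrite lexx ler01.
by rewrite prim0 addr0.
Qed.

Lemma end_trace_L2 w r : LO w -> LQ r -> LO (fun x => w x + \int[mu]_(s in I) r (x, s)).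
Proof. by move=> Lw Lr; exact: (L2_add mO Lw (rect_int_L2 mO mI fO fI Lr)). Qed.

Lemma rho_trace1 z w r : rho_data z w r ->
  is_trace l z 1 (fun x => w x + \int[mu]_(s in I) r (x, s)).
Proof.
move=> [Lz Lw Lr h]; split; first exact: end_trace_L2.
apply: filterS2 h (rect_section_L2 mO mI fO fI Lr) => x h h2 Ox.
apply: (proj2 (@point_value_rep _ _ ltr01 _ _ _ 1 _ (h2 Ox) (h Ox) _)); first by rewrite lexx ler01.
by rewrite primc.
Qed.

Lemma is_trace_unique z (rho : R) w w' : 0 <= rho <= 1 ->
  is_trace l z rho w -> is_trace l z rho w' -> w = w' %[ae mu in Om].
Proof.
move=> rho01 [_ h] [_ h'].
by apply: (lebesgue_ae2 h h') => {h h'} x h h' Ox;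
    exact: (point_value_unique ltr01 rho01 (h Ox) (h' Ox)).
Qed.

Lemma weak_rho_data z w r : weak_rho_derivative l z r -> is_trace l z 0 w -> rho_data z w r.
Proof.
move=> [Lz Lr h] [Lw hw]; split => //.
apply: (lebesgue_ae2 h hw) => {h hw} x h hw Ox; have [k hk] := weak_rep ltr01 (h Ox).
have [_ Lrx _] := h Ox.
have := proj1 (@point_value_rep _ _ ltr01 _ _ _ 0 (w x) Lrx hk _) (hw Ox).
by rewrite lexx ler01 prim0 addr0 => /(_ isT) ->.
Qed.

Lemma rho_unique z w r z' w' r' : rho_data z w r -> rho_data z' w' r' ->
  z = z' %[ae mQ in Q] -> w = w' %[ae mu in Om] /\ r = r' %[ae mQ in Q].
Proof.
move=> [Lz Lw Lr h] [Lz' Lw' Lr' h'] /rect_ae_sections zz.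
have key : {ae mu, forall x, Om x -> w x = w' x /\
    (fun s => r (x, s)) = (fun s => r' (x, s)) %[ae mu in I]}.
  have hL := lebesgue_ae2 (rect_section_L2 mO mI fO fI Lr) (rect_section_L2 mO mI fO fI Lr')
      (fun x => @conj _ _).
  apply: (lebesgue_ae2 (lebesgue_ae2 h h' (fun x => @conj _ _)) (lebesgue_ae2 zz hL (fun x =>
      @conj _ _))).
  move=> x [h1 h2] [h3 [h4 h5]] Ox.
  apply: (prim_rep_unique ltr01 (h4 Ox) (h5 Ox) (h1 Ox)).
  by apply: filterS2 (h3 Ox) (h2 Ox) => s e1 e2 Is; rewrite e1 // e2.
split; first by apply: filterS key => x h1 Ox; case: (h1 Ox).
apply: (rect_ae mO mI fO fI Lr Lr').
by apply: filterS key => x h1 Ox; case: (h1 Ox).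
Qed.

Lemma rho_linear (a : R) z w r z' w' r' : rho_data z w r -> rho_data z' w' r' ->
  rho_data (a *: z + z') (a *: w + w') (a *: r + r').
Proof.
move=> [Lz Lw Lr h] [Lz' Lw' Lr' h']; split; [exact: L2_linear..|].
have hL := lebesgue_ae2 (rect_section_L2 mO mI fO fI Lr) (rect_section_L2 mO mI fO fI Lr')
    (fun x => @conj _ _).
apply: (lebesgue_ae2 (lebesgue_ae2 h h' (fun x => @conj _ _)) hL) => x [h1 h2] [h3 h4] Ox.
apply: filterS2 (h1 Ox) (h2 Ox) => s e1 e2 Is.
have -> : (fun s => (a *: r + r') (x, s)) = a *: (fun s => r (x, s)) + (fun s => r' (x, s)) by [].
rewrite prim_linear; [|exact: ltr01|exact: h3|exact: h4].
have -> : (a *: z + z') (x, s) = a * z (x, s) + z' (x, s) by [].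
rewrite e1 // e2 // !fctE /GRing.scale /=; ring.
Qed.

Lemma rho_ae z w r z' w' r' : rho_data z w r -> LQ z' -> LO w' -> LQ r' ->
  z = z' %[ae mQ in Q] -> w = w' %[ae mu in Om] -> r = r' %[ae mQ in Q] ->
  rho_data z' w' r'.
Proof.
move=> [Lz Lw Lr h] Lz' Lw' Lr' /rect_ae_sections zz ww /rect_ae_sections rr.
split => //.
have hL := lebesgue_ae2 (rect_section_L2 mO mI fO fI Lr) (rect_section_L2 mO mI fO fI Lr')
    (fun x => @conj _ _).
have hzr := lebesgue_ae2 zz rr (fun x => @conj _ _).
apply: (lebesgue_ae2 (lebesgue_ae2 h hL (fun x => @conj _ _)) (lebesgue_ae2 hzr ww (fun x =>
    @conj _ _))).
move=> x [h1 [h2 h3]] [[h4 h5] h6] Ox.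
apply: filterS2 (h1 Ox) (h4 Ox) => s e1 e2 Is.
rewrite -e2 // e1 // !fctE h6 //; congr (_ + _).
exact: (congr1 (fun F => F s) (prim_ae ltr01 (h2 Ox) (h3 Ox) (h5 Ox))).
Qed.

(* Integrating [d/ds (z^2 / 2) = z r] over (0, 1) on almost every fibre. *)
Lemma rho_energy z w r : rho_data z w r ->
  let w1 := fun x => w x + \int[mu]_(s in I) r (x, s) in
  2 * ipL mQ Q r z = ipL mu Om w1 w1 - ipL mu Om w w.
Proof.
move=> [Lz Lw Lr h] w1; have Lw1 : LO w1 := end_trace_L2 Lw Lr.
rewrite (ipL_rect mO mI Lr Lz).
have I1 := L2_mul mO Lw1 Lw1; have I2 := L2_mul mO Lw Lw.
have Irz := L2_mul mR Lr Lz.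
have If : mu.-integrable Om (EFin \o (fun x => ipL mu I (fun s => r (x, s)) (fun s => z (x, s)))).
  exact: (rect_int_integrable mO mI Irz).
rewrite -RintegralZl // /ipL -RintegralB //; apply: ae_eq_Rintegral => //.
- have /measurable_int/measurable_EFinP mf := If.
  exact: measurable_funM.
- have /measurable_int/measurable_EFinP m1 := I1.
  have /measurable_int/measurable_EFinP m2 := I2.
  exact: measurable_funB.
have hL := lebesgue_ae2 (rect_section_L2 mO mI fO fI Lr) (rect_section_L2 mO mI fO fI Lz)
    (fun x => @conj _ _).
apply: (lebesgue_ae2 h hL) => x hx [Lrx Lzx] Ox.
have {}hx := hx Ox; have {}Lrx := Lrx Ox; have {}Lzx := Lzx Ox.
have LP := prim_L2 ltr01 Lrx; have Lc := L2_cst mI fI (w x).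
suff : 2 * ipL mu I (fun s => r (x, s)) (fun s => z (x, s)) = w1 x * w1 x - w x * w x by [].
rewrite (ipL_ae mI Lrx Lrx Lzx (L2_add mI Lc LP) (ae_eq_refl _ _ _) hx) ipLC ipL_add //.
have -> : ipL mu I (cst (w x)) (fun s => r (x, s)) = w x * \int[mu]_(s in I) r (x, s).
  by rewrite /ipL RintegralZl //; exact: L2_integrable.
have := prim_parts ltr01 Lrx Lrx; rewrite (ipLC mu I _ (P _)) /w1.
move: (ipL _ _ _ _) (\int[mu]_(s in I) _) (w x) => a b d e.
have -> : a = b * b / 2 by move: e; lra.
by field.
Qed.

(** Joint measurability comes from writing the primitive as a parameter integral over s of a
    function of ((x, y), s) with the indicator of s <= y. *)
Lemma delay_prim_L2 r : LQ r -> (forall x, Om x -> LI (fun s => r (x, s))) ->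
  LQ (fun q => P (fun s => r (q.1, s)) q.2).
Proof.
move=> Lr sr; have mr := L2_measurable mR Lr.
have mrT : measurable_fun setT (r \_ Q) by exact/(measurable_restrictT _ mR).
pose F (u : (T * T) * T) : R := (r \_ Q) (u.1.1, u.2) * \1_[set u : (T * T) * T | u.2 <= u.1.2] u.
have m2 : measurable_fun setT (fun u : (T * T) * T => u.2) by exact: measurable_snd.
have m1 : measurable_fun setT (fun u : (T * T) * T => u.1) by exact: measurable_fst.
have m11 : measurable_fun setT (fun u : (T * T) * T => u.1.1) by exact: measurableT_comp
    measurable_fst m1.
have m12 : measurable_fun setT (fun u : (T * T) * T => u.1.2) by exact: measurableT_comp
    measurable_snd m1.
have mF : measurable_fun setT F.
  apply: measurable_funM.
    by apply: (measurableT_comp mrT); exact: measurable_fun_pair.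
  apply: measurable_indic; rewrite -[X in measurable X]setTI.
  exact: measurable_fun_le.
have mP : measurable_fun Q (fun q => P (fun s => r (q.1, s)) q.2).
  have := measurable_funTS (D := Q) (@Rint_param_measurable _ _ _ _ R mu F mF).
  apply: eq_measurable_fun => -[x y]; rewrite inE => -[/= Ox Iy].
  rewrite /prim [RHS]Rintegral_mkcond; apply: eq_Rintegral => s _.
  rewrite /F /= patch_rect patchE mem_set //= !patchE indicE mem_setE.
  rewrite indicE; case: ifP => _; last by rewrite mul0r.
  by congr (_ * _%:R); rewrite mem_setE /= in_itv.
pose h x := \int[mu]_(s in I) (r (x, s) * r (x, s)).
have Ih : mu.-integrable Om (EFin \o h) by exact: (rect_int_integrable mO mI (L2_mul mR Lr Lr)).
have I1 : mu.-integrable I (EFin \o cst (1 : R)) := L2_integrable mI fI (L2_cst mI fI 1).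
apply: (L2_dom mR mP (integrable_tensor mO mI Ih I1)) => -[x y] [/= Ox Iy].
rewrite mulr1 -real_normK ?num_real //.
have := prim_le ltr01 (sr x Ox) Iy; rewrite sqrtr1 mulr1 => hle.
rewrite -[h x](sqr_nrm 1 (fun s => r (x, s))) ler_pXn2r ?nnegrE ?nrm_ge0 //.
Qed.

Lemma tensor_L2 w (e : R -> R) : LO w -> LI e -> LQ (fun q => w q.1 * e q.2).
Proof.
move=> Lw Le; apply/(L2P _ mR); split.
  have := integrable_tensor mO mI (L2_integrable mO fO Lw) (L2_integrable mI fI Le).
  by move=> /measurable_int/measurable_EFinP.
have := integrable_tensor mO mI (L2_sqr mO Lw) (L2_sqr mI Le).
congr (_.-integrable _ _); apply/funext => z /=; by rewrite exprMn.
Qed.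

(* The transport equation [a (z - f) + z_rho = 0], [z(., 0) = w] *)
Lemma transport_solution (a : R) f : LQ f -> exists2 F, LO F &
  forall w, LO w -> exists2 z, rho_data z w (- a *: (z - f)) &
   (fun x => w x + \int[mu]_(s in I) (- a *: (z - f)) (x, s)) =
   (fun x => expR (- a) * w x + F x) %[ae mu in Om].
Proof.
(* [transport_ode] needs a square-integrable section; [f0] has one at every x. *)
move=> Lf; have [f0 [Lf0 sf0 f0E]] := regular_sections mO mI fO fI Lf.
have bE (b : R) y : I y -> `|expR (b * y)| <= expR `|b|.
  rewrite /= in_itv /= => /andP[y0 y1]; rewrite ger0_norm ?expR_ge0 // ler_expR.
  apply: le_trans (ler_norm _) _; rewrite normrM -[leRHS]mulr1 ler_wpM2l // ger0_norm ?ltW //.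
have mexp (b : R) : measurable_fun Q (fun q : T * T => expR (b * q.2)).
  apply: measurable_funTS.
  have mb : measurable_fun setT (fun s : T => expR (b * s)).
    by apply: continuous_measurable_fun; exact: expR_continuous.
  exact: (measurableT_comp mb measurable_snd).
pose g (q : R * R) := expR (a * q.2) * f0 q.
have Lg : LQ g.
  apply: (@L2_bounded _ _ _ mQ Q mR f0 (fun q => expR (a * q.2)) (expR `|a|)) => //.
  by move=> [x y] [_ Iy]; exact: bE.
have sg x : Om x -> LI (fun s => g (x, s)).
  move=> Ox; apply: (@L2_bounded _ _ _ mu I mI (fun s => f0 (x,
      s)) (fun s => expR (a * s)) (expR `|a|)) => //.
  - by apply: measurable_funTS; apply: continuous_measurable_fun; exact: expR_continuous.
  - by move=> y; exact: bE.
  - exact: sf0.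
have LK := delay_prim_L2 Lg sg.
(* The contribution of f at rho = 1. It is chosen before w: the end trace is affine in w with slope
   exp(- a). *)
pose F x := expR (- a) * (a * \int[mu]_(s in I) g (x, s)).
have LF : LO F.
  exact: (L2_scale mO fO (expR (- a)) (L2_scale mO fO a (rect_int_L2 mO mI fO fI Lg))).
exists F => // w Lw.
pose z (q : R * R) := expR (- a * q.2) * (w q.1 + a * P (fun s => g (q.1, s)) q.2).
have Lz : LQ z.
  have L1 := tensor_L2 Lw (L2_cst mI fI 1).
  have L2' := L2_linear mR a LK L1.
  have := @L2_bounded _ _ _ mQ Q mR _ (fun q => expR (- a * q.2)) (expR `|- a|) (mexp _) _ L2'.
  have -> : (fun q : R * R => expR (- a * q.2) * (a *: (fun q : R * R => P (fun s : R => g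
      (q.1, s)) q.2) +
      (fun q : R * R => w q.1 * cst 1 q.2)) q) = z.
    by apply/funext => q; rewrite /z !fctE mulr1 addrC.
  by apply; move=> [x y] [_ Iy]; exact: bE.
have Lr : LQ (- a *: (z - f)) := L2_scale mR fR (- a) (L2_sub mR fR Lz Lf).
have odeE : {ae mu, forall x, Om x -> forall y, 0 <= y -> y <= 1 ->
    z (x, y) = w x + P (fun s => (- a *: (z - f)) (x, s)) y}.
  apply: filterS f0E => x f0E Ox y y0 y1.
  have := transport_ode ltr01 a (w x) (sf0 x Ox) y0 y1; rewrite /= -[LHS]/(z (x, y)) => ->.
  congr (_ + _); apply: eq_Rintegral => s _; congr (_ * _).
  by rewrite -[f0 (x, s)]/(f0 (x, s)) f0E.
exists z.
  split => //; apply: filterS odeE => x h Ox; apply: aeW => s Is; apply: h => //.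
    by move: Is; rewrite /= in_itv /= => /andP[/ltW].
  by move: Is; rewrite /= in_itv /= => /andP[_ /ltW].
apply: filterS odeE => x h Ox; have := h Ox 1 ler01 (lexx 1); rewrite primc => <-.
by rewrite /z /= mulr1 primc mulrDr.
Qed.

End DelayVariable.

(** * Weighted products of semi-Hilbert spaces *)

Section PairSpace.
Variables (R : realType) (E1 E2 : lmodType R) (ip1 : E1 -> E1 -> R) (ip2 : E2 -> E2 -> R).
Variables (a1 a2 : R).
Hypotheses (a10 : 0 < a1) (a20 : 0 < a2).
Hypotheses (H1 : semi_hilbert ip1) (H2 : semi_hilbert ip2).

Definition ip_pair (x y : E1 * E2) : R := a1 * ip1 x.1 y.1 + a2 * ip2 x.2 y.2.

Lemma semi_hilbert_pair : semi_hilbert ip_pair.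
Proof.
split.
- by move=> x y; rewrite /ip_pair (ipC H1) (ipC H2).
- by move=> x y z; rewrite /ip_pair /= (ipDl H1) (ipDl H2); ring.
- by move=> a x z; rewrite /ip_pair /= (ipZl H1) (ipZl H2); ring.
- by move=> x; rewrite addr_ge0 // mulr_ge0 ?(ip_ge0 H1) ?(ip_ge0 H2) // ltW.
move=> x xC.
have [e e0|y1 hy1] := ip_complete H1 (x := fun n => (x n).1).
  have [n hn] := xC (a1 * e) ltac:(by rewrite mulr_gt0); exists n => i j ni nj.
  rewrite -(ltr_pM2l a10); apply: le_lt_trans (hn i j ni nj).
  by rewrite lerDl mulr_ge0 ?(ip_ge0 H2) // ltW.
have [e e0|y2 hy2] := ip_complete H2 (x := fun n => (x n).2).
  have [n hn] := xC (a2 * e) ltac:(by rewrite mulr_gt0); exists n => i j ni nj.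
  rewrite -(ltr_pM2l a20); apply: le_lt_trans (hn i j ni nj).
  by rewrite lerDr mulr_ge0 ?(ip_ge0 H1) // ltW.
exists (y1, y2) => e e0.
have [n1 hn1] := hy1 (e / (2 * a1)) ltac:(by rewrite divr_gt0 // mulr_gt0).
have [n2 hn2] := hy2 (e / (2 * a2)) ltac:(by rewrite divr_gt0 // mulr_gt0).
exists (maxn n1 n2) => i; rewrite geq_max => /andP[i1 i2].
have := hn1 i i1; have := hn2 i i2; rewrite !ltr_pdivlMr ?mulr_gt0 // /ip_pair /=.
by move: (ip1 _ _) (ip2 _ _) => u v; lra.
Qed.

Lemma hnorm_pair_le x : hnorm ip_pair x <= Num.sqrt a1 * hnorm ip1 x.1 + Num.sqrt a2 * hnorm
    ip2 x.2.
Proof.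
have p0 : 0 <= Num.sqrt a1 * hnorm ip1 x.1 + Num.sqrt a2 * hnorm ip2 x.2.
  by rewrite addr_ge0 // mulr_ge0 // ?sqrtr_ge0 ?hnorm_ge0.
rewrite -(@ler_pXn2r _ 2) ?nnegrE ?hnorm_ge0 //.
rewrite (sqr_hnorm semi_hilbert_pair) sqrrD !exprMn !sqr_sqrtr ?(ltW a10) ?(ltW a20) ?ip_ge0 //.
by rewrite -addrA lerD2l addrC lerDl mulrn_wge0 // !mulr_ge0 // ?sqrtr_ge0 ?hnorm_ge0.
Qed.

Lemma hnorm_pair_ge1 x : Num.sqrt a1 * hnorm ip1 x.1 <= hnorm ip_pair x.
Proof.
by rewrite -sqrtrM ?(ltW a10) // ler_wsqrtr // lerDl mulr_ge0 ?(ip_ge0 H2) // ltW.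
Qed.

Lemma hnorm_pair_ge2 x : Num.sqrt a2 * hnorm ip2 x.2 <= hnorm ip_pair x.
Proof.
by rewrite -sqrtrM ?(ltW a20) // ler_wsqrtr // lerDr mulr_ge0 ?(ip_ge0 H1) // ltW.
Qed.

End PairSpace.

(** Total, with value 0 off the submodule, so that a map can be built first and shown to land in it
    afterwards. *)
Definition to_smod (R : realType) (V : lmodType R) (S : submodule V) (v : V) : smod S :=
  insubd 0 v.

Lemma to_smodK (R : realType) (V : lmodType R) (S : submodule V) (v : V) :
  S v -> val (to_smod S v) = v.
Proof. by move=> Sv; rewrite val_insubd; case: ifPn => // /asboolP. Qed.

(** * Mean-zero functions *)

Section MeanZero.
Variables (R : realType) (c : R).
Hypothesis c0 : 0 < c.
Local Notation mu := (@lebesgue_measure R).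
Local Notation D := (`]0, c[%classic : set (measurableTypeR R)).
Local Notation L := (L2 mu D).
Local Notation ip := (ipL mu D).
Local Notation P := (prim c).
Local Notation nrm := (nrm c).
Implicit Types (f g m : R -> R) (x y : R).
Let mD := mD c.
Let fD := fD c0.
Local Hint Resolve mD fD : core.

Definition mean_zero f := L f /\ \int[mu]_(x in D) f x = 0.

Lemma mean_zero0 : mean_zero 0.
Proof. by split; [exact: L2_zero|apply: etrans (Rint_cst c0 0) _; rewrite mul0r]. Qed.

Lemma mean_zeroL (a : R) f g : mean_zero f -> mean_zero g -> mean_zero (a *: f + g).
Proof.
by move=> [Lf f0] [Lg g0]; split; [exact: L2_linear|rewrite int_linear // f0 g0 mulr0 addr0].
Qed.

Definition mean_zero_submodule := Submodule mean_zero0 mean_zeroL.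

Lemma mean_zero_semi_hilbert :
  semi_hilbert (fun f g : smod mean_zero_submodule => ip (val f) (val g)).
Proof.
have sL (x : smod mean_zero_submodule) : L (val x) by case: (smodP x).
split.
- by move=> x y; exact: ipLC.
- move=> x y z; rewrite linearD; exact: (ipL_add mD (sL x) (sL y) (sL z)).
- move=> a x z; rewrite linearZ; exact: (ipL_scale mD fD a (sL x) (sL z)).
- by move=> x; exact: ipL_ge0.
- move=> x xC; have [e e0|g Lg hg] := L2_complete mD fD (fun n => sL (x n)) _.
    have [n hn] := xC e e0; exists n => i j ni nj.
    by have := hn i j ni nj; rewrite linearB.
  have g0 : \int[mu]_(x in D) g x = 0.
    apply/eqP; rewrite -normr_le0; apply: le_eps => e e0; rewrite add0r.
    have [n hn] := hg (e ^+ 2 / c) ltac:(by rewrite divr_gt0 // exprn_gt0).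
    have {hn} := hn n (leqnn n); have [Lx x0] := smodP (x n).
    have := int_le_nrm c0 (L2_sub mD fD Lx Lg); rewrite int_sub // x0 sub0r normrN.
    move=> h1 h2; apply: le_trans h1 _.
    rewrite -[leRHS]ger0_norm ?(ltW e0) // -sqrtr_sqr -sqrtrM ?ipL_ge0 // ler_wsqrtr //.
    by rewrite -ler_pdivlMr // ltW.
  have [y yE] := smod_exists mean_zero_submodule (conj Lg g0); exists y => e e0.
  have [n hn] := hg e e0; exists n => i ni.
  by have := hn i ni; rewrite -yE -linearB.
Qed.

(** The orthogonal projection onto mean-zero functions; it removes free integration constants. *)
Definition center f := f - cst ((\int[mu]_(x in D) f x) / c).

Lemma center_mean_zero f : L f -> mean_zero (center f).
Proof.
move=> Lf; split; first exact: (L2_sub mD fD Lf (L2_cst mD fD _)).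
by rewrite int_sub //; [rewrite Rint_cst // divfK ?subrr // gt_eqF|exact: L2_cst].
Qed.

Lemma center_linear (a : R) f g : L f -> L g -> center (a *: f + g) = a *: center f + center g.
Proof.
move=> Lf Lg; apply/funext => x; rewrite /center int_linear // !fctE /GRing.scale /=; ring.
Qed.

Lemma ip_cst_mean_zero (k : R) m : mean_zero m -> ip (cst k) m = 0.
Proof.
move=> [Lm m0]; rewrite /ipL RintegralZl //; first by rewrite m0 mulr0.
exact: L2_integrable.
Qed.

Lemma ip_center f m : L f -> mean_zero m -> ip (center f) m = ip f m.
Proof.
move=> Lf m0; have [Lm _] := m0; rewrite /center -scaleN1r addrC ipL_linear //; last exact: L2_cst.
by rewrite ip_cst_mean_zero // mulr0 add0r.
Qed.

Lemma nrm_cst (k : R) : nrm (cst k) = `|k| * Num.sqrt c.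
Proof.
rewrite /nrm -sqrtr_sqr -sqrtrM ?sqr_ge0 //; congr Num.sqrt.
exact: etrans (Rint_cst c0 (k * k)) _.
Qed.

Lemma nrm_scale (a : R) f : L f -> nrm (a *: f) = `|a| * nrm f.
Proof.
move=> Lf; rewrite /nrm -sqrtr_sqr -sqrtrM ?sqr_ge0 //; congr Num.sqrt.
have La := L2_scale mD fD a Lf.
by rewrite ipL_scale // (ipLC mu D f) ipL_scale // expr2 mulrA.
Qed.

Lemma nrm_center f : L f -> nrm (center f) <= 2 * nrm f.
Proof.
move=> Lf; have Lk := L2_cst mD fD (- ((\int[mu]_(x in D) f x) / c)).
have -> : center f = f + cst (- ((\int[mu]_(x in D) f x) / c)) by [].
apply: le_trans (nrm_triangle c0 Lf Lk) _; rewrite nrm_cst normrN normrM normfV (gtr0_norm c0).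
have := int_le_nrm c0 Lf; have s0 : 0 < Num.sqrt c by rewrite sqrtr_gt0.
move=> h; rewrite (_ : 2 * nrm f = nrm f + nrm f); last by ring.
rewrite lerD2l mulrAC ler_pdivrMr //.
by rewrite -[X in _ <= _ * X](sqr_sqrtr (ltW c0)) expr2 mulrA ler_pM2r.
Qed.

(** [prim_parts] loses its boundary term as soon as one factor has mean zero. The integrations by
    parts in x made below are instances of this. *)
Lemma prim_skew f m : L f -> mean_zero m -> ip f (P m) = - ip (P f) m.
Proof.
move=> Lf [Lm m0]; have := prim_parts c0 Lf Lm; rewrite m0 mulr0 => /eqP.
by rewrite addrC addr_eq0 => /eqP.
Qed.

Lemma nrm_linear_prim (a b : R) f g : L f -> L g ->
  nrm (P (a *: f + b *: g)) <= c * (`|a| * nrm f + `|b| * nrm g).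
Proof.
move=> Lf Lg; have La := L2_scale mD fD a Lf; have Lb := L2_scale mD fD b Lg.
apply: le_trans (nrm_prim c0 (L2_add mD La Lb)) _; rewrite ler_pM2l // -!nrm_scale //.
exact: nrm_triangle.
Qed.

End MeanZero.

(** * The resolvent equation *)

Section Resolvent.
Variables (R : realType) (gamma kappa l lam b : R).
Hypotheses (gamma0 : 0 < gamma) (kappa0 : 0 < kappa) (l0 : 0 < l) (lam0 : 0 < lam) (b0 : 0 < b).
Local Notation mu := (@lebesgue_measure R).
Local Notation Om := (`]0, l[%classic : set (measurableTypeR R)).
Local Notation LO := (L2 mu Om).
Local Notation P := (prim l).
Local Notation ipO := (ipL mu Om).
Local Notation L20_sub := (mean_zero_submodule l0).
Let mO := mD l.
Let fO := fD l0.
Local Notation L2O_sub := (L2_submodule mO fO).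
Local Hint Resolve mO fO : core.
Local Notation ipm := (fun f g : smod L20_sub => ipO (val f) (val g)).
Local Notation ipq := (fun f g : smod L2O_sub => ipO (val f) (val g)).

(** The unknowns are m = v_x and q = theta_x. The momentum equation, integrated once and centered,
    has left side [m + opm m q]; the heat equation, integrated once with theta = [center l (P q)],
    has left side [q + opq m q]. *)
Let opm (m q : R -> R) := - b^-1 *: center l (P (lam *: P m + gamma *: q)).
Let opq (m q : R -> R) := - kappa^-1 *: P (lam *: center l (P q) + gamma *: m).

Let opm_source (m q : R -> R) : LO m -> LO q -> LO (lam *: P m + gamma *: q).
Proof.
by move=> Lm Lq; apply: (L2_linear mO); [exact: prim_L2|exact: (L2_scale mO fO)].
Qed.

Let opq_source (m q : R -> R) : LO m -> LO q -> LO (lam *: center l (P q) + gamma *: m).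
Proof.
move=> Lm Lq; apply: (L2_linear mO); last exact: (L2_scale mO fO).
by case: (center_mean_zero l0 (prim_L2 l0 Lq)).
Qed.

Let opm_mean_zero (m q : R -> R) : LO m -> LO q -> mean_zero l (opm m q).
Proof.
move=> Lm Lq; have := mean_zeroL l0 (- b^-1) (center_mean_zero l0 (prim_L2 l0 (opm_source Lm
    Lq))) (mean_zero0 l0).
by rewrite addr0.
Qed.

Let opq_L2 (m q : R -> R) : LO m -> LO q -> LO (opq m q).
Proof. by move=> Lm Lq; apply: (L2_scale mO fO); apply: prim_L2 => //; exact: opq_source. Qed.

Let opm_linear (a : R) m q m' q' : LO m -> LO q -> LO m' -> LO q' ->
  opm (a *: m + m') (a *: q + q') = a *: opm m q + opm m' q'.
Proof.
move=> Lm Lq Lm' Lq'; rewrite /opm.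
have -> : lam *: P (a *: m + m') + gamma *: (a *: q + q') =
   a *: (lam *: P m + gamma *: q) + (lam *: P m' + gamma *: q').
  by rewrite (prim_linear l0 a Lm Lm') !scalerDr !scalerA (mulrC a lam) (mulrC a gamma) addrACA.
have L1 := opm_source Lm Lq; have L2' := opm_source Lm' Lq'.
rewrite (prim_linear l0 a L1 L2') (center_linear l0 a (prim_L2 l0 L1) (prim_L2 l0 L2')).
by rewrite scalerDr !scalerA mulrC.
Qed.

Let opq_linear (a : R) m q m' q' : LO m -> LO q -> LO m' -> LO q' ->
  opq (a *: m + m') (a *: q + q') = a *: opq m q + opq m' q'.
Proof.
move=> Lm Lq Lm' Lq'.
have LP := prim_L2 l0 Lq; have LP' := prim_L2 l0 Lq'.
have E1 := etrans (congr1 (center l) (prim_linear l0 a Lq Lq')) (center_linear l0 a LP LP').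
have E2 : lam *: center l (P (a *: q + q')) + gamma *: (a *: m + m') =
    a *: (lam *: center l (P q) + gamma *: m) + (lam *: center l (P q') + gamma *: m').
  apply: etrans (congr1 (fun f => lam *: f + gamma *: (a *: m + m')) E1) _.
  move: (center l _) (center l _) => u v.
  by rewrite !scalerDr !scalerA (mulrC a lam) (mulrC a gamma) addrACA.
have E3 := etrans (congr1 P E2) (prim_linear l0 a (opq_source Lm Lq) (opq_source Lm' Lq')).
apply: etrans (congr1 (fun f => - kappa^-1 *: f) E3) _; rewrite /opq.
by move: (P _) (P _) => u v; rewrite scalerDr !scalerA mulrC.
Qed.

(** With the weights b and kappa the coupling terms gamma <q, P m> enter with opposite signs and
    cancel; the rest is lam times squares. *)
Let op_accretive (m q : R -> R) : mean_zero l m -> LO q ->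
  0 <= b * ipO (opm m q) m + kappa * ipO (opq m q) q.
Proof.
move=> m0 Lq; have [Lm _] := m0.
have L1 := opm_source Lm Lq; have L2' := opq_source Lm Lq.
have LP1 := prim_L2 l0 L1; have LP2 := prim_L2 l0 L2'.
have LPm := prim_L2 l0 Lm; have LPq := prim_L2 l0 Lq.
have c0 := center_mean_zero l0 LPq; have [Lc _] := c0.
have [Lc1 _] := center_mean_zero l0 LP1.
have Lgq := L2_scale mO fO gamma Lq; have Lgm := L2_scale mO fO gamma Lm.
have s0 : mean_zero l (lam *: center l (P q) + gamma *: m).
  by apply: mean_zeroL => //; rewrite -[gamma *: m]addr0; apply: mean_zeroL => //;
      exact: mean_zero0.
have -> : b * ipO (opm m q) m = lam * ipO (P m) (P m) + gamma * ipO q (P m).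
  rewrite /opm (ipL_scale mO fO _ Lc1 Lm) ip_center // mulNr mulrN mulrA divff ?gt_eqF // mul1r.
  by rewrite -(prim_skew l0 L1 m0) (ipL_linear mO lam LPm Lgq LPm) (ipL_scale mO fO gamma Lq LPm).
have -> : kappa * ipO (opq m q) q = lam * ipO (center l (P q)) (center l (P q)) - gamma * ipO
    q (P m).
  rewrite /opq (ipL_scale mO fO _ LP2 Lq) mulNr mulrN mulrA divff ?gt_eqF // mul1r.
  have -> : ipO (P (lam *: center l (P q) + gamma *: m)) q = - ipO (lam *: center l (P q) +
      gamma *: m) (P q).
    by rewrite ipLC (prim_skew l0 Lq s0) ipLC.
  rewrite opprK (ipL_linear mO lam Lc Lgm LPq) (ipL_scale mO fO gamma Lm LPq).
  have -> : ipO m (P q) = - ipO q (P m) by rewrite (prim_skew l0 Lq m0) opprK ipLC.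
  have -> : ipO (center l (P q)) (P q) = ipO (center l (P q)) (center l (P q)).
    by rewrite ipLC -(ip_center l0 LPq c0).
  by rewrite mulrN.
have := ipL_ge0 mu Om (P m); have := ipL_ge0 mu Om (center l (P q)).
have := lam0; move: (ipO _ _) (ipO _ _) (ipO _ _) => u v w la hu hv.
have := mulr_ge0 (ltW la) hu; have := mulr_ge0 (ltW la) hv; lra.
Qed.

Let norm_bound := b^-1 * (2 * (l * (lam * l + gamma))).
Let norm_bound' := kappa^-1 * (l * (2 * lam * l + gamma)).

Let opm_bound (m q : R -> R) : LO m -> LO q ->
  nrm l (opm m q) <= norm_bound * (nrm l m + nrm l q).
Proof.
move=> Lm Lq; have L1 := opm_source Lm Lq; have LP1 := prim_L2 l0 L1.
have [Lc _] := center_mean_zero l0 LP1; have LPm := prim_L2 l0 Lm.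
rewrite /opm nrm_scale // normrN gtr0_norm ?invr_gt0 // /norm_bound -mulrA ler_pM2l ?invr_gt0 //.
apply: le_trans (nrm_center l0 LP1) _; rewrite -mulrA ler_pM2l //.
apply: le_trans (nrm_linear_prim l0 lam gamma LPm Lq) _; rewrite -mulrA ler_pM2l // !gtr0_norm //.
have := nrm_prim l0 Lm; have := nrm_ge0 l m; have := nrm_ge0 l q; have := lam0; have :=
    gamma0; have := l0.
move: (nrm l m) (nrm l q) (nrm l (P m)) => u v w hl hg hla hv hu hw.
have := ler_wpM2l (ltW hla) hw; have := mulr_ge0 (mulr_ge0 (ltW hla) (ltW hl)) hv.
have := mulr_ge0 (ltW hg) hu; lra.
Qed.

Let opq_bound (m q : R -> R) : LO m -> LO q ->
  nrm l (opq m q) <= norm_bound' * (nrm l m + nrm l q).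
Proof.
move=> Lm Lq; have L1 := opq_source Lm Lq; have LP1 := prim_L2 l0 L1.
have LPq := prim_L2 l0 Lq; have [Lc _] := center_mean_zero l0 LPq.
rewrite /opq nrm_scale // normrN gtr0_norm ?invr_gt0 // /norm_bound' -mulrA ler_pM2l ?invr_gt0 //.
apply: le_trans (nrm_linear_prim l0 lam gamma Lc Lm) _;
    rewrite -(mulrA l) ler_pM2l // !gtr0_norm //.
have := nrm_prim l0 Lq; have := nrm_center l0 LPq.
have := nrm_ge0 l m; have := nrm_ge0 l q; have := lam0; have := gamma0; have := l0.
move: (nrm l m) (nrm l q) (nrm l (P q)) (nrm l (center _ _)) => u v w z hl hg hla hv hu hz hw.
have := ler_wpM2l (ltW hla) hw; have := ler_wpM2l (ltW hla) hz.
have := mulr_ge0 (mulr_ge0 (ltW hla) (ltW hl)) hu.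
have := mulr_ge0 (ltW hg) hv; lra.
Qed.

(** [accretive_onto] in the product weighted by b and kappa, the weights for which the operator is
    accretive. *)
Lemma resolvent_system (f1 f2 : R -> R) : mean_zero l f1 -> LO f2 ->
  exists m q, [/\ mean_zero l m, LO q,
    m + - b^-1 *: center l (P (lam *: P m + gamma *: q)) = f1 %[ae mu in Om] &
    q + - kappa^-1 *: P (lam *: center l (P q) + gamma *: m) = f2 %[ae mu in Om]].
Proof.
move=> f10 Lf2.
have H1 := mean_zero_semi_hilbert l0; have H2 := L2_semi_hilbert mO fO.
have H := semi_hilbert_pair b0 kappa0 H1 H2.
set ip' := ip_pair _ _ _ _ in H.
pose X : lmodType R := (smod L20_sub * smod L2O_sub)%type.
have Lv1 (x : X) : mean_zero l (val x.1) by exact: (smodP x.1).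
have Lv1' (x : X) : LO (val x.1) by case: (Lv1 x).
have Lv2 (x : X) : LO (val x.2) by exact: (smodP x.2).
have [S [S1 S2]] : exists S : X -> X, (forall x, val (S x).1 = opm (val x.1) (val x.2)) /\
    (forall x, val (S x).2 = opq (val x.1) (val x.2)).
  exists (fun x => (to_smod L20_sub (opm (val x.1) (val x.2)),
      to_smod L2O_sub (opq (val x.1) (val x.2)))).
  by split=> x; apply: to_smodK; [exact: opm_mean_zero|exact: opq_L2].
have Slin (a : R) x y : S (a *: x + y) = a *: S x + S y.
  have v1 : val (a *: x + y).1 = a *: val x.1 + val y.1 by exact: (linearP val).
  have v2 : val (a *: x + y).2 = a *: val x.2 + val y.2 by exact: (linearP val).
  have s1 : val (a *: S x + S y).1 = a *: val (S x).1 + val (S y).1 by exact: (linearP val).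
  have s2 : val (a *: S x + S y).2 = a *: val (S x).2 + val (S y).2 by exact: (linearP val).
  have l1 := etrans (congr2 opm v1 v2) (opm_linear a (Lv1' x) (Lv2 x) (Lv1' y) (Lv2 y)).
  have l2 := etrans (congr2 opq v1 v2) (opq_linear a (Lv1' x) (Lv2 x) (Lv1' y) (Lv2 y)).
  have r1 := etrans s1 (congr2 (fun u v => a *: u + v) (S1 x) (S1 y)).
  have r2 := etrans s2 (congr2 (fun u v => a *: u + v) (S2 x) (S2 y)).
  apply/eqP; rewrite -pair_eqE /pair_eq; apply/andP; split; apply/eqP; apply: val_inj.
    exact: etrans (S1 _) (etrans l1 (esym r1)).
  exact: etrans (S2 _) (etrans l2 (esym r2)).
pose sb := Num.sqrt b; pose sk := Num.sqrt kappa.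
have sb0 : 0 < sb by rewrite sqrtr_gt0.
have sk0 : 0 < sk by rewrite sqrtr_gt0.
pose C := (sb * norm_bound + sk * norm_bound') * (sb^-1 + sk^-1).
have Sbd x : hnorm ip' (S x) <= C * hnorm ip' x.
  apply: le_trans (hnorm_pair_le b0 kappa0 H1 H2 (S x)) _.
  have -> : hnorm ipm (S x).1 = nrm l (opm (val x.1) (val x.2)).
    by rewrite /hnorm S1.
  have -> : hnorm ipq (S x).2 = nrm l (opq (val x.1) (val x.2)).
    by rewrite /hnorm S2.
  have e1 := opm_bound (Lv1' x) (Lv2 x); have e2 := opq_bound (Lv1' x) (Lv2 x).
  have e3 : nrm l (val x.1) <= sb^-1 * hnorm ip' x.
    by rewrite mulrC ler_pdivlMr // mulrC; exact: (hnorm_pair_ge1 ipm b0 kappa0 H2 x).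
  have e4 : nrm l (val x.2) <= sk^-1 * hnorm ip' x.
    by rewrite mulrC ler_pdivlMr // mulrC; exact: (hnorm_pair_ge2 ipq b0 kappa0 H1 x).
  have nb0 : 0 <= norm_bound by rewrite !mulr_ge0 ?invr_ge0 ?addr_ge0 ?mulr_ge0 // ltW.
  have nb0' : 0 <= norm_bound' by rewrite !mulr_ge0 ?invr_ge0 ?addr_ge0 ?mulr_ge0 // ltW.
  apply: (@le_trans _ _ ((sb * norm_bound + sk * norm_bound') * (nrm l (val x.1) + nrm l (val
      x.2)))).
    have := lerD (ler_wpM2l (ltW sb0) e1) (ler_wpM2l (ltW sk0) e2).
    by rewrite (mulrA sb) (mulrA sk) -mulrDl.
  have K0 := addr_ge0 (mulr_ge0 (ltW sb0) nb0) (mulr_ge0 (ltW sk0) nb0').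
  rewrite /C -[leRHS]mulrA; apply: (ler_wpM2l K0).
  by rewrite [leRHS]mulrDl; exact: lerD.
have Sacc x : 0 <= ip' (S x) x.
  by rewrite /ip' /ip_pair S1 S2; exact: op_accretive.
pose F : X := (to_smod L20_sub f1, to_smod L2O_sub f2).
have [x hx] := accretive_onto H Slin Sbd Sacc F.
have null1 : nrm l (val (x + S x - F).1) = 0.
  apply/eqP; rewrite eq_le nrm_ge0 andbT -(ler_pM2l sb0) mulr0 -[leRHS]hx.
  exact: (hnorm_pair_ge1 ipm b0 kappa0 H2 (x + S x - F)).
have null2 : nrm l (val (x + S x - F).2) = 0.
  apply/eqP; rewrite eq_le nrm_ge0 andbT -(ler_pM2l sk0) mulr0 -[leRHS]hx.
  exact: (hnorm_pair_ge2 ipq b0 kappa0 H1 (x + S x - F)).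
have v1 : val (x + S x - F).1 = val x.1 + val (S x).1 - f1.
  by rewrite -[in RHS](to_smodK (S := L20_sub) f10).
have v2 : val (x + S x - F).2 = val x.2 + val (S x).2 - f2.
  by rewrite -[in RHS](to_smodK (S := L2O_sub) Lf2).
exists (val x.1), (val x.2); split => //.
- have := nrm_null (Lv1' (x + S x - F)) null1; rewrite v1 S1.
  by apply: filterS => s hs Os; apply/eqP; rewrite -subr_eq0; apply/eqP; exact: hs.
- have := nrm_null (Lv2 (x + S x - F)) null2; rewrite v2 S2.
  by apply: filterS => s hs Os; apply/eqP; rewrite -subr_eq0; apply/eqP; exact: hs.
Qed.

End Resolvent.

(** * The operator in coordinates *)

Lemma four_null (R : realType) (a b d e : R) : 0 <= a -> 0 <= b -> 0 <= d -> 0 <= e ->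
  a + b + d + e = 0 -> [/\ a = 0, b = 0, d = 0 & e = 0].
Proof. by move=> *; split; lra. Qed.

Section DelayedGraph.
Variables (R : realType) (alpha beta gamma kappa tau l : R).
Hypotheses (alpha0 : 0 < alpha) (beta0 : 0 < beta) (gamma0 : 0 < gamma)
  (kappa0 : 0 < kappa) (tau0 : 0 < tau) (l0 : 0 < l).
Local Notation mu := (@lebesgue_measure R).
Local Notation T := (measurableTypeR R).
Local Notation Om := (`]0, l[%classic : set T).
Local Notation I := (`]0, 1[%classic : set T).
Local Notation Q := (Om `*` I).
Local Notation mQ := (mu \x mu)%E.
Local Notation LQ := (L2 mQ Q).
Local Notation LO := (L2 mu Om).
Local Notation P := (prim l).
Local Notation ipO := (ipL mu Om).
Local Notation ipQ := (ipL mQ Q).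
Let mO := mD l.
Let fO := fD l0.
Let mI := mD (1 : R).
Let fI := fD (@ltr01 R).
Let mR : measurable Q := measurable_rect mO mI.
Let fR : (mQ Q < +oo)%E := finite_rect mO mI fO fI.
Local Hint Resolve mO fO mI fI mR fR : core.

Definition L2O_sub := L2_submodule mO fO.
Definition L2Q_sub := L2_submodule mR fR.
Definition L20_sub := mean_zero_submodule l0.

(* Coordinates (w, g, p, h) stand for the state (u, g, p, h) where u is the
   primitive of w. *)
Definition data : lmodType R :=
  (smod L20_sub * smod L2O_sub * smod L2Q_sub * smod L20_sub)%type.
Implicit Types x y : data.

Definition cw x : R -> R := val x.1.1.1.
Definition cg x : R -> R := val x.1.1.2.
Definition cp x : R * R -> R := val x.1.2.
Definition ch x : R -> R := val x.2.

Lemma cw_mean_zero x : mean_zero l (cw x). Proof. exact: (smodP x.1.1.1). Qed.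
Lemma ch_mean_zero x : mean_zero l (ch x). Proof. exact: (smodP x.2). Qed.
Lemma cw_L2 x : LO (cw x). Proof. by case: (cw_mean_zero x). Qed.
Lemma ch_L2 x : LO (ch x). Proof. by case: (ch_mean_zero x). Qed.
Lemma cg_L2 x : LO (cg x). Proof. exact: (smodP x.1.1.2). Qed.
Lemma cp_L2 x : LQ (cp x). Proof. exact: (smodP x.1.2). Qed.
Local Hint Resolve cw_mean_zero ch_mean_zero cw_L2 ch_L2 cg_L2 cp_L2 : core.

Lemma cw_linear a x y : cw (a *: x + y) = a *: cw x + cw y.
Proof. exact: (linearP val). Qed.
Lemma cg_linear a x y : cg (a *: x + y) = a *: cg x + cg y.
Proof. exact: (linearP val). Qed.
Lemma cp_linear a x y : cp (a *: x + y) = a *: cp x + cp y.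
Proof. exact: (linearP val). Qed.
Lemma ch_linear a x y : ch (a *: x + y) = a *: ch x + ch y.
Proof. exact: (linearP val). Qed.

Lemma cwB x y : cw (x - y) = cw x - cw y.
Proof. by rewrite addrC -scaleN1r cw_linear scaleN1r addrC. Qed.
Lemma cgB x y : cg (x - y) = cg x - cg y.
Proof. by rewrite addrC -scaleN1r cg_linear scaleN1r addrC. Qed.
Lemma cpB x y : cp (x - y) = cp x - cp y.
Proof. by rewrite addrC -scaleN1r cp_linear scaleN1r addrC. Qed.
Lemma chB x y : ch (x - y) = ch x - ch y.
Proof. by rewrite addrC -scaleN1r ch_linear scaleN1r addrC. Qed.

Lemma data_exists w g p h : mean_zero l w -> LO g -> LQ p -> mean_zero l h ->
  exists x, [/\ cw x = w, cg x = g, cp x = p & ch x = h].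
Proof.
move=> hw hg hp hh; exists (to_smod L20_sub w, to_smod L2O_sub g, to_smod L2Q_sub p,
    to_smod L20_sub h).
by split; exact: to_smodK.
Qed.

Definition delay_weight : R := 2 * tau * alpha ^+ 2 / beta.

Lemma delay_weight_gt0 : 0 < delay_weight.
Proof. by rewrite divr_gt0 // !mulr_gt0 // exprn_gt0. Qed.

Definition data_ip x y : R :=
  alpha * ipO (cw x) (cw y) + ipO (cg x) (cg y) +
  delay_weight * ipQ (cp x) (cp y) + ipO (ch x) (ch y).
Local Notation ip := data_ip.
Local Notation N := (hnorm data_ip).

Lemma data_semi_hilbert : semi_hilbert data_ip.
Proof.
have H1 := semi_hilbert_pair alpha0 ltr01 (mean_zero_semi_hilbert l0) (L2_semi_hilbert mO fO).
have H2 := semi_hilbert_pair ltr01 delay_weight_gt0 H1 (L2_semi_hilbert mR fR).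
have H3 := semi_hilbert_pair ltr01 ltr01 H2 (mean_zero_semi_hilbert l0).
suff -> : data_ip = ip_pair (ip_pair (ip_pair
    (fun f g : smod L20_sub => ipO (val f) (val g)) (fun f g : smod L2O_sub => ipO (val f)
        (val g)) alpha 1)
    (fun f g : smod L2Q_sub => ipQ (val f) (val g)) 1 delay_weight)
    (fun f g : smod L20_sub => ipO (val f) (val g)) 1 1 by exact: H3.
by apply/funext => x; apply/funext => y; rewrite /ip_pair /= !mul1r.
Qed.

Lemma data_null x y : N (x - y) = 0 ->
  [/\ cw x = cw y %[ae mu in Om], cg x = cg y %[ae mu in Om],
      cp x = cp y %[ae mQ in Q] & ch x = ch y %[ae mu in Om]].
Proof.
move=> n0; have : ip (x - y) (x - y) = 0 by rewrite -(sqr_hnorm data_semi_hilbert) n0 expr0n.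
rewrite /data_ip cwB cgB cpB chB.
have e1 := ipL_ge0 mu Om (cw x - cw y); have e2 := ipL_ge0 mu Om (cg x - cg y).
have e3 := ipL_ge0 mQ Q (cp x - cp y); have e4 := ipL_ge0 mu Om (ch x - ch y).
have dw := delay_weight_gt0; move=> s0.
have a1 := mulr_ge0 (ltW alpha0) e1; have a3 := mulr_ge0 (ltW dw) e3.
have [z1 z2 z3 z4] := four_null a1 e2 a3 e4 s0.
have sub d (S : measurableType d) (m : {measure set S -> \bar R}) (D : set S) (f g : S -> R) :
    f - g = 0 %[ae m in D] -> f = g %[ae m in D].
  by apply: filterS => s hs Ds; apply/eqP; rewrite -subr_eq0; apply/eqP; exact: hs.
split.
- apply: sub; apply: (ipL_null mO); first exact: (L2_sub mO fO).
  by apply/eqP; move/eqP: z1; rewrite mulf_eq0 gt_eqF.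
- by apply: sub; apply: (ipL_null mO) => //; exact: (L2_sub mO fO).
- apply: sub; apply: (ipL_null mR); first exact: (L2_sub mR fR).
  by apply/eqP; move/eqP: z3; rewrite mulf_eq0 gt_eqF.
- by apply: sub; apply: (ipL_null mO) => //; exact: (L2_sub mO fO).
Qed.

Lemma data_null_ae x y : cw x = cw y %[ae mu in Om] -> cg x = cg y %[ae mu in Om] ->
  cp x = cp y %[ae mQ in Q] -> ch x = ch y %[ae mu in Om] -> N (x - y) = 0.
Proof.
have sub d (S : measurableType d) (m : {measure set S -> \bar R}) (D : set S) (f g : S -> R) :
    f = g %[ae m in D] -> f - g = 0 %[ae m in D].
  by apply: filterS => s hs Ds; rewrite !fctE hs // subrr.
move=> h1 h2 h3 h4; rewrite /hnorm /data_ip cwB cgB cpB chB.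
rewrite (ipL_null_ae mO fO (L2_sub mO fO (cw_L2 x) (cw_L2 y)) (sub _ _ _ _ _ _ h1)).
rewrite (ipL_null_ae mO fO (L2_sub mO fO (cg_L2 x) (cg_L2 y)) (sub _ _ _ _ _ _ h2)).
rewrite (ipL_null_ae mR fR (L2_sub mR fR (cp_L2 x) (cp_L2 y)) (sub _ _ _ _ _ _ h3)).
rewrite (ipL_null_ae mO fO (L2_sub mO fO (ch_L2 x) (ch_L2 y)) (sub _ _ _ _ _ _ h4)).
by rewrite !mulr0 !addr0 sqrtr0.
Qed.

(* If y = (m, g', p', h') = A x, the heat equation h' = - gamma m + kappa q'
   with Neumann conditions gives q = theta_x as a primitive. *)
Definition heat_flux y : R -> R := kappa^-1 *: P (ch y + gamma *: cw y).

Definition end_trace x y : R -> R :=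
  fun s => cw x s + \int[mu]_(r in I) (- tau *: cp y) (s, r).

Definition stress x y : R -> R := fun s => alpha * end_trace x y s + beta * cw y s.

(* The relation y = A x, solved for x in terms of primitives of y. *)
Definition graph x y : Prop :=
  [/\ cg x = P (cw y) %[ae mu in Om],
      rho_data l (cp x) (cw x) (- tau *: cp y),
      exists k, stress x y = cst k + P (cg y + gamma *: heat_flux y) %[ae mu in Om] &
      exists k, ch x = cst k + P (heat_flux y) %[ae mu in Om]].

Lemma heat_source_mean_zero y : mean_zero l (ch y + gamma *: cw y).
Proof. by rewrite addrC; exact: mean_zeroL. Qed.

Lemma heat_flux_L2 y : LO (heat_flux y).
Proof. by apply: (L2_scale mO fO); apply: prim_L2 => //; case: (heat_source_mean_zero y). Qed.

Lemma force_L2 y : LO (cg y + gamma *: heat_flux y).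
Proof. by apply: (L2_add mO) => //; apply: (L2_scale mO fO); exact: heat_flux_L2. Qed.

Lemma data_end_trace_L2 x y : LO (end_trace x y).
Proof. by apply: end_trace_L2 => //; exact: (L2_scale mR fR). Qed.

Lemma stress_L2 x y : LO (stress x y).
Proof.
exact: (L2_linear mO alpha (data_end_trace_L2 x y) (L2_scale mO fO beta (cw_L2 y))).
Qed.
Local Hint Resolve heat_flux_L2 force_L2 data_end_trace_L2 stress_L2 : core.

Lemma heat_flux_linear a y y' : heat_flux (a *: y + y') = a *: heat_flux y + heat_flux y'.
Proof.
have -> : heat_flux (a *: y + y') = kappa^-1 *: P (a *: (ch y + gamma *: cw y) + (ch y' +
    gamma *: cw y')).
  rewrite /heat_flux ch_linear cw_linear; congr (_ *: P _); apply/funext => s.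
  rewrite !fctE /GRing.scale /=; ring.
have [L1 _] := heat_source_mean_zero y; have [L2' _] := heat_source_mean_zero y'.
rewrite prim_linear //; apply/funext => s; rewrite /heat_flux !fctE /GRing.scale /=; ring.
Qed.

Lemma end_trace_linear a x y x' y' :
  end_trace (a *: x + x') (a *: y + y') = a *: end_trace x y + end_trace x' y' %[ae mu in Om].
Proof.
have s1 := rect_section_L2 mO mI fO fI (L2_scale mR fR (- tau) (cp_L2 y)).
have s2 := rect_section_L2 mO mI fO fI (L2_scale mR fR (- tau) (cp_L2 y')).
apply: (lebesgue_ae2 s1 s2) => s h1 h2 Os.
rewrite /end_trace cw_linear cp_linear.
have := int_linear ltr01 a (h1 Os) (h2 Os).
rewrite (_ : (fun r => (- tau *: (a *: cp y + cp y')) (s, r)) =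
  a *: (fun r => (- tau *: cp y) (s, r)) + (fun r => (- tau *: cp y') (s, r))); last first.
  by apply/funext => r; rewrite !fctE /GRing.scale /=; ring.
by move=> ->; rewrite !fctE /GRing.scale /=; ring.
Qed.

Lemma graph_linear a x y x' y' : graph x y -> graph x' y' ->
  graph (a *: x + x') (a *: y + y').
Proof.
move=> [h1 h2 [k3 h3] [k4 h4]] [h1' h2' [k3' h3'] [k4' h4']].
have lin (k k' u v : R) : a * k + k' + (a *: u + v) = a * (k + u) + (k' + v).
  by rewrite /GRing.scale /=; ring.
split.
- rewrite cg_linear cw_linear prim_linear //.
  by apply: (lebesgue_ae2 h1 h1') => s e1 e2 Os; rewrite !fctE e1 // e2.
- have -> : - tau *: cp (a *: y + y') = a *: (- tau *: cp y) + (- tau *: cp y').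
    by rewrite cp_linear; apply/funext => s; rewrite !fctE /GRing.scale /=; ring.
  by rewrite cp_linear cw_linear; exact: rho_linear.
- exists (a * k3 + k3').
  have -> : cg (a *: y + y') + gamma *: heat_flux (a *: y + y') =
      a *: (cg y + gamma *: heat_flux y) + (cg y' + gamma *: heat_flux y').
    by rewrite cg_linear heat_flux_linear; apply/funext => s; rewrite !fctE /GRing.scale /=; ring.
  rewrite prim_linear //.
  apply: (lebesgue_ae2 (lebesgue_ae2 h3 h3' (fun _ => @conj _ _)) (end_trace_linear a x y x' y')).
  move=> s [e1 e2] e3 Os; have {}e1 := e1 Os; have {}e2 := e2 Os; have {}e3 := e3 Os.
  rewrite /stress e3 cw_linear !fctE; rewrite /stress !fctE in e1 e2.
  by rewrite lin -e1 -e2 /GRing.scale /=; ring.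
- exists (a * k4 + k4'); rewrite heat_flux_linear prim_linear // ch_linear.
  apply: (lebesgue_ae2 h4 h4') => s e1 e2 Os; by rewrite !fctE e1 // e2 // !fctE lin.
Qed.

Lemma heat_flux_ae y y' : cw y = cw y' %[ae mu in Om] -> ch y = ch y' %[ae mu in Om] ->
  heat_flux y = heat_flux y'.
Proof.
move=> h1 h2; congr (_ *: _); apply: prim_ae => //.
- by case: (heat_source_mean_zero y).
- by case: (heat_source_mean_zero y').
by apply: (lebesgue_ae2 h1 h2) => s e1 e2 Os; rewrite !fctE e1 // e2.
Qed.

Lemma graph_ext x y y' : graph x y -> N (y - y') = 0 -> graph x y'.
Proof.
move=> [h1 h2 [k3 h3] [k4 h4]] /data_null[n1 n2 n3 n4].
have qE := heat_flux_ae n1 n4; split.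
- by rewrite -(prim_ae l0 (cw_L2 y) (cw_L2 y') n1).
- apply: (rho_ae l0 h2) => //; first exact: (L2_scale mR fR).
  + exact: ae_eq_refl.
  + exact: ae_eq_refl.
  + by apply: filterS n3 => s e Qs; rewrite !fctE e.
- exists k3; rewrite -qE.
  rewrite -(@prim_ae _ _ l0 (cg y + gamma *: heat_flux y) (cg y' + gamma *: heat_flux y));
      first last.
  + by apply: filterS n2 => s e Os; rewrite !fctE e.
  + by rewrite qE.
  + by [].
  have s3 := rect_ae_sections n3.
  apply: (lebesgue_ae2 (lebesgue_ae2 h3 s3 (fun _ => @conj _ _)) 
     (lebesgue_ae2 (rect_section_L2 mO mI fO fI (cp_L2 y)) (lebesgue_ae2 (rect_section_L2 mO
         mI fO fI (cp_L2 y')) n1 (fun _ => @conj _ _)) (fun _ => @conj _ _))).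
  move=> s [e1 e2] [e3 [e4 e5]] Os; rewrite -e1 // /stress e5 //; congr (_ * (_ + _) + _).
  have tr y0 : (fun r => (- tau *: cp y0) (s, r)) = - tau *: (fun r => cp y0 (s, r)) by [].
  apply: ae_eq_Rintegral => //.
  + by rewrite tr; exact: (L2_measurable mI (L2_scale mI fI _ (e4 Os))).
  + by rewrite tr; exact: (L2_measurable mI (L2_scale mI fI _ (e3 Os))).
  by apply: filterS (e2 Os) => r er Ir; rewrite !fctE er.
- by exists k4; rewrite -qE.
Qed.

(** Representations by primitives are unique, which gives one component after another: p' from the
    transport equation, m from v, the heat flux from theta, then h', and last g' from the stress,
    which vanishes since z(., 1) and m do. *)
Lemma graph_null x y : graph x y -> N x = 0 -> N y = 0.
Proof.
move=> [h1 h2 [k3 h3] [k4 h4]]; rewrite -[x in N x]subr0 => /data_null[n1 n2 n3 n4].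
rewrite -[y]subr0.
have z0 : rho_data l (0 : R * R -> R) 0 0.
  split; [exact: L2_zero..|]; apply: aeW => s Os; apply: aeW => r Ir.
  have -> : prim 1 (fun r : R => (0 : R * R -> R) (s, r)) = 0.
    by apply/funext => t; rewrite primE; exact: ipL0.
  by rewrite !fctE addr0.
have L0 : LO 0 by exact: L2_zero.
have P0 : P 0 = 0 by apply/funext => s; rewrite primE ipL0.
have [_ pz] := rho_unique l0 h2 z0 n3.
have pz' : cp y = 0 %[ae mQ in Q].
  apply: filterS pz => s e Qs; have := e Qs; rewrite !fctE => /eqP.
  by rewrite scaler_eq0 oppr_eq0 (gt_eqF tau0) => /eqP.
have m0 : cw y = 0 %[ae mu in Om].
  have e1 : cg x = cst 0 + P (cw y) %[ae mu in Om].
    by apply: filterS h1 => s e Os; rewrite e // !fctE add0r.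
  have e2 : cg x = cst 0 + P 0 %[ae mu in Om].
    by apply: filterS n2 => s e Os; rewrite e // !fctE P0 addr0.
  by have [] := prim_rep_unique l0 (cw_L2 y) L0 e1 e2.
have q0 : heat_flux y = 0 %[ae mu in Om].
  have e2 : ch x = cst 0 + P 0 %[ae mu in Om].
    by apply: filterS n4 => s e Os; rewrite e // !fctE P0 addr0.
  by have [] := prim_rep_unique l0 (heat_flux_L2 y) L0 h4 e2.
have hy0 : ch y = 0 %[ae mu in Om].
  have [Ls _] := heat_source_mean_zero y.
  have LPs := L2_scale mO fO kappa^-1 Ls.
  have e1 : heat_flux y = cst 0 + P (kappa^-1 *: (ch y + gamma *: cw y)) %[ae mu in Om].
    by apply: aeW => s Os; rewrite prim_scale // !fctE add0r.
  have e2 : heat_flux y = cst 0 + P 0 %[ae mu in Om].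
    by apply: filterS q0 => s e Os; rewrite e // !fctE P0 addr0.
  have [_ e3] := prim_rep_unique l0 LPs L0 e1 e2.
  apply: (lebesgue_ae2 e3 m0) => s e4 e5 Os; have := e4 Os;
      rewrite !fctE e5 // scaler0 addr0 => /eqP.
  by rewrite scaler_eq0 invr_eq0 (gt_eqF kappa0) => /eqP.
have tr0 : stress x y = 0 %[ae mu in Om].
  have Ly := rect_section_L2 mO mI fO fI (L2_scale mR fR (- tau) (cp_L2 y)).
  have s3 := rect_ae_sections pz.
  apply: (lebesgue_ae2 (lebesgue_ae2 s3 Ly (fun _ => @conj _ _)) (lebesgue_ae2 n1 m0 (fun _
      => @conj _ _))).
  move=> s [e1 e2] [e3 e4] Os; rewrite /stress /end_trace e3 // e4 //.
  rewrite (@ae_eq_Rintegral _ _ _ mu I mI _ (cst 0)) //.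
  + have -> : cw 0 = 0 by exact: (linear0 val).
    by rewrite Rintegral_cst // mul0r -[(0 : R -> R) s]/(0 : R) !(addr0, mulr0).
  + exact: (L2_measurable mI (e2 Os)).
  + exact: e1.
have g0 : cg y = 0 %[ae mu in Om].
  have e2 : stress x y = cst 0 + P 0 %[ae mu in Om].
    by apply: filterS tr0 => s e Os; rewrite e // !fctE P0 addr0.
  have [_ e3] := prim_rep_unique l0 (force_L2 y) L0 h3 e2.
  apply: (lebesgue_ae2 e3 q0) => s e4 e5 Os; have := e4 Os; rewrite !fctE e5 //.
  by rewrite scaler0 addr0.
by apply: data_null_ae.
Qed.

(** A sum-of-squares certificate with t = alpha / beta and b = beta. The letters w, z, m stand for
    u_x, z(., 1), v_x; [qq] is the thermal dissipation, [gg], [pp], [hh] the other parts of the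
    energy. Each completed square uses a quarter of b mm. *)
Let dissipation_identity (t b ww wm zz zm mm qq gg pp hh : R) :
  0 <= 2 * t * (gg + pp + hh) ->
  0 <= b * ((- (2 * t)) ^+ 2 * ww + 2 * (- (2 * t)) * wm + mm) ->
  0 <= b * ((2 * t) ^+ 2 * zz + 2 * (2 * t) * zm + mm) -> 0 <= b * mm -> 0 <= qq ->
  t * b * wm + (- (t * b) * zm - b * mm - qq) + t ^+ 2 * b * (ww - zz) <=
  2 * t * (t * b * ww + gg + pp + hh).
Proof.
move=> n1 n2 n3 n4 n5; rewrite -subr_ge0.
have -> : 2 * t * (t * b * ww + gg + pp + hh) -
    (t * b * wm + (- (t * b) * zm - b * mm - qq) + t ^+ 2 * b * (ww - zz))
 = 2 * t * (gg + pp + hh) + qq + 4^-1 * (b * ((- (2 * t)) ^+ 2 * ww + 2 * (- (2 * t)) * wm + mm))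
   + 4^-1 * (b * ((2 * t) ^+ 2 * zz + 2 * (2 * t) * zm + mm)) + 2^-1 * (b * mm) by field.
by rewrite !addr_ge0 // mulr_ge0.
Qed.

(** The coupling terms are gamma <theta_x, v> and gamma <v_x, theta>, negatives of each other by
    [prim_skew]. The integration constants of stress and temperature are paired with mean-zero
    functions and drop out. *)
Lemma thermal_cancellation x y : graph x y ->
  ipO (cg y) (cg x) + ipO (ch y) (ch x) =
  - alpha * ipO (end_trace x y) (cw y) - beta * ipO (cw y) (cw y)
  - kappa * ipO (heat_flux y) (heat_flux y).
Proof.
move=> [h1 h2 [k3 h3] [k4 h4]].
have m0 := cw_mean_zero y; have u0 := heat_source_mean_zero y.
have Lm := cw_L2 y; have Lq := heat_flux_L2 y; have Ls := force_L2 y; have [Lu _] := u0.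
have LPm := prim_L2 l0 Lm; have LPq := prim_L2 l0 Lq; have LPs := prim_L2 l0 Ls.
have Lgq := L2_scale mO fO gamma Lq; have Lgm := L2_scale mO fO gamma Lm.
have refl (f : R -> R) : f = f %[ae mu in Om] by exact: ae_eq_refl.
have F1 : ipO (ch y) (ch x) = ipO (ch y + gamma *: cw y) (ch x) - gamma * ipO (cw y) (ch x).
  by rewrite ipL_add // ipL_scale // addrK.
have F2 : ipO (ch y + gamma *: cw y) (ch x) = - kappa * ipO (heat_flux y) (heat_flux y).
  rewrite (ipL_ae mO Lu Lu (ch_L2 x) (L2_add mO (L2_cst mO fO k4) LPq) (refl _) h4) ipLC.
  rewrite ipL_add //; last exact: L2_cst.
  rewrite (ip_cst_mean_zero l0 k4 u0) add0r (ipLC mu Om (P _)).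
  have := prim_skew l0 Lq u0; rewrite (ipLC mu Om (P (heat_flux y))) => /eqP.
  rewrite -eqr_oppLR => /eqP <-; rewrite mulNr; congr (- _).
  have -> : P (ch y + gamma *: cw y) = kappa *: heat_flux y.
    by rewrite /heat_flux scalerA divff ?gt_eqF // scale1r.
  by rewrite ipLC ipL_scale.
have F3 : ipO (cg y) (cg x) = ipO (cg y + gamma *: heat_flux y) (P (cw y)) - gamma * ipO
    (heat_flux y) (P (cw y)).
  rewrite (ipL_ae mO (cg_L2 y) (cg_L2 y) (cg_L2 x) LPm (refl _) h1).
  by rewrite ipL_add // ipL_scale // addrK.
have F4 : ipO (cg y + gamma *: heat_flux y) (P (cw y)) =
    - alpha * ipO (end_trace x y) (cw y) - beta * ipO (cw y) (cw y).
  rewrite (prim_skew l0 Ls m0).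
  have -> : ipO (P (cg y + gamma *: heat_flux y)) (cw y) = ipO (stress x y) (cw y).
    rewrite (ipL_ae mO (stress_L2 x y) (L2_add mO (L2_cst mO fO k3) LPs) Lm Lm h3 (refl _)).
    by rewrite ipL_add ?(ip_cst_mean_zero l0 k3 m0) ?add0r //; exact: L2_cst.
  have -> : stress x y = alpha *: end_trace x y + beta *: cw y by [].
  rewrite ipL_linear //; last exact: (L2_scale mO fO).
  by rewrite ipL_scale // opprD mulNr.
have F5 : ipO (heat_flux y) (P (cw y)) = - ipO (cw y) (ch x).
  rewrite (prim_skew l0 Lq m0) (ipLC mu Om (cw y)).
  rewrite (ipL_ae mO (ch_L2 x) (L2_add mO (L2_cst mO fO k4) LPq) Lm Lm h4 (refl _)).
  by rewrite ipL_add ?(ip_cst_mean_zero l0 k4 m0) ?add0r //; exact: L2_cst.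
rewrite F1 F2 F3 F4 F5; ring.
Qed.

Lemma delay_energy x y : graph x y ->
  delay_weight * ipQ (cp y) (cp x) =
  alpha ^+ 2 / beta * (ipO (cw x) (cw x) - ipO (end_trace x y) (end_trace x y)).
Proof.
move=> [_ h2 _ _]; have := rho_energy l0 h2; rewrite /= -/(end_trace x y).
rewrite (ipL_scale mR fR (- tau) (cp_L2 y) (cp_L2 x)) /delay_weight.
move: (ipQ _ _) (ipO _ _) (ipO _ _) => a b d e.
have bn : beta != 0 by rewrite gt_eqF.
have -> : b - d = - (2 * (- tau * a)) by rewrite e; ring.
by field.
Qed.

(** Young's estimate of alpha <u_x, v_x> and the inflow each produce (alpha^2/beta) |u_x|^2; the sum
    is 2 alpha / beta times the energy term alpha |u_x|^2. *)
Definition growth_bound : R := 2 * alpha / beta.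

(* The weight of the delay term is chosen so that the trace term
   - alpha <z(1), v_x> is absorbed by the viscosity and the outflow. *)
Lemma graph_dissipative x y : graph x y -> ip y x <= growth_bound * ip x x.
Proof.
move=> G; have E1 := thermal_cancellation G; have E2 := delay_energy G.
pose t := alpha / beta; have t0 : 0 < t by rewrite divr_gt0.
have sq (a : R) f g : LO f -> LO g ->
    0 <= a ^+ 2 * ipO f f + 2 * a * ipO f g + ipO g g.
  move=> Lf Lg; have La := L2_scale mO fO a Lf.
  have := ipL_ge0 mu Om (a *: f + g); rewrite (ipL_linear mO a Lf Lg (L2_add mO La Lg)).
  rewrite (ipLC mu Om f) (ipLC mu Om g) (ipL_linear mO a Lf Lg Lf) (ipL_linear mO a Lf Lg Lg)
      (ipLC mu Om g f).
  by move: (ipO _ _) (ipO _ _) (ipO _ _) => u v z; congr (0 <= _); ring.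
have S1 := sq (- (2 * t)) _ _ (cw_L2 x) (cw_L2 y).
have S2 := sq (2 * t) _ _ (data_end_trace_L2 x y) (cw_L2 y).
have g0 := ipL_ge0 mu Om (cg x); have p0 := ipL_ge0 mQ Q (cp x); have h0 := ipL_ge0 mu Om (ch x).
have q0 := ipL_ge0 mu Om (heat_flux y); have m0 := ipL_ge0 mu Om (cw y).
have dw := delay_weight_gt0.
have tb : growth_bound = 2 * t by rewrite /growth_bound /t mulrA.
have ab : alpha = t * beta by rewrite /t divfK // gt_eqF.
have ab2 : alpha ^+ 2 / beta = t ^+ 2 * beta.
  by rewrite ab exprMn; field; rewrite gt_eqF.
rewrite /data_ip tb.
have -> : alpha * ipO (cw y) (cw x) + ipO (cg y) (cg x) + delay_weight * ipQ (cp y) (cp x) +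
    ipO (ch y) (ch x)
  = alpha * ipO (cw x) (cw y) + (ipO (cg y) (cg x) + ipO (ch y) (ch x)) + delay_weight * ipQ
      (cp y) (cp x).
  by rewrite (ipLC mu Om (cw y)); ring.
rewrite E1 E2 ab2 ab.
have wp := mulr_ge0 (ltW dw) p0.
have kq := mulr_ge0 (ltW kappa0) q0.
have n1 : 0 <= 2 * t * (ipO (cg x) (cg x) + delay_weight * ipQ (cp x) (cp x) + ipO (ch x) (ch x)).
  by rewrite mulr_ge0 ?addr_ge0 // mulr_ge0 // ltW.
have n2 := mulr_ge0 (ltW beta0) S1; have n3 := mulr_ge0 (ltW beta0) S2.
have n4 := mulr_ge0 (ltW beta0) m0.
exact: dissipation_identity.
Qed.

Let stress_identity (lam e m p c1 g w F c2 : R) : lam != 0 -> l != 0 ->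
  beta + alpha * e / lam != 0 ->
  m + - (beta + alpha * e / lam)^-1 * (p + - (c1 / l)) =
    (beta + alpha * e / lam)^-1 * (- lam * g + - (alpha * e * w + alpha * F) + - (c2 / l)) ->
  alpha * (e * (lam^-1 * m + w) + F) + beta * m =
    - (c1 / l) + - (c2 / l) + (p + - lam * g).
Proof.
move=> ln l0' bn E; set b := beta + _ in bn E.
have {}E : b * m = p + - (c1 / l) + (- lam * g + - (alpha * e * w + alpha * F) + - (c2 / l)).
  move: E; move: (p + _) (_ + - (c2 / l)) => X Y E.
  have -> : m = b^-1 * (X + Y) by rewrite mulrDr -E; ring.
  by rewrite mulrA divff // mul1r.
rewrite (_ : alpha * _ + beta * m = b * m + (alpha * e * w + alpha * F)).
  by rewrite E; ring.
by rewrite /b; field.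
Qed.

(** z is eliminated first: by [transport_solution] its end trace is exp(- lam tau) w + F0 with w = m
    / lam + [cw f]. The stress becomes b m plus data, which leaves a system for m and q. *)
Lemma graph_range (h : R) (f : data) : 0 < h -> exists x, graph x (h^-1 *: (x - f)).
Proof.
move=> h0; pose lam := h^-1; have lam0 : 0 < lam by rewrite invr_gt0.
have ln0 : lam != 0 by rewrite gt_eqF.
pose a0 := lam * tau; have [F0 LF0 hF0] := transport_solution l0 a0 (cp_L2 f).
(* Effective viscosity: the delayed elastic stress adds its share to the coefficient of m = v_x. *)
pose b := beta + alpha * expR (- a0) / lam.
have b0 : 0 < b by rewrite addr_gt0 // divr_gt0 // mulr_gt0 // expR_gt0.
have bn0 : b != 0 by rewrite gt_eqF.
pose Fm := (alpha * expR (- a0)) *: cw f + alpha *: F0.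
have LFm : LO Fm := L2_linear mO _ (cw_L2 f) (L2_scale mO fO alpha LF0).
have LPf := prim_L2 l0 (cg_L2 f).
(* Data terms of the once-integrated momentum equation, whose free constant is removed by
   centering. *)
pose F1 := - lam *: P (cg f) + - Fm.
have LF1 : LO F1 := L2_linear mO (- lam) LPf (L2_opp mO fO LFm).
have c0 : mean_zero l (b^-1 *: center l F1).
  by have := mean_zeroL l0 b^-1 (center_mean_zero l0 LF1) (mean_zero0 l0); rewrite addr0.
have Lf4 := L2_scale mO fO (- lam) (ch_L2 f).
have LF2 : LO (kappa^-1 *: P (- lam *: ch f)) by apply: (L2_scale mO fO); exact: prim_L2.
have [m [q [m0 Lq em eq]]] := resolvent_system gamma0 kappa0 l0 lam0 b0 c0 LF2.
have [Lm _] := m0; have LPm := prim_L2 l0 Lm; have LPq := prim_L2 l0 Lq.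
have hh0 := center_mean_zero l0 LPq; have [Lhh _] := hh0.
have w0 : mean_zero l (lam^-1 *: m + cw f) := mean_zeroL l0 lam^-1 m0 (cw_mean_zero f).
have [Lw _] := w0.
have [z hz zE] := hF0 _ Lw; have [Lz _ _ _] := hz.
have [x [xw xg xp xh]] := data_exists w0 LPm Lz hh0; exists x.
set y := h^-1 *: (x - f); have yE : y = lam *: (x - f) + 0 by rewrite addr0.
have yw : cw y = m.
  rewrite yE cw_linear cwB xw addrK scalerA mulfV // scale1r.
  by rewrite (_ : cw 0 = 0) ?addr0 //; exact: (linear0 val).
have yg : cg y = lam *: (P m - cg f).
  by rewrite yE cg_linear cgB xg (_ : cg 0 = 0) ?addr0 //; exact: (linear0 val).
have yp : - tau *: cp y = - a0 *: (z - cp f).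
  rewrite yE cp_linear cpB xp (_ : cp 0 = 0) ?addr0; last exact: (linear0 val).
  by rewrite scalerA /a0 mulNr mulrC.
have yh : ch y = lam *: (center l (P q) - ch f).
  by rewrite yE ch_linear chB xh (_ : ch 0 = 0) ?addr0 //; exact: (linear0 val).
pose src := lam *: center l (P q) + gamma *: m.
have Lsrc : LO src := L2_linear mO lam Lhh (L2_scale mO fO gamma Lm).
have hfq : heat_flux y = q %[ae mu in Om].
  have -> : heat_flux y = kappa^-1 *: P src + kappa^-1 *: P (- lam *: ch f).
    rewrite -scalerDr; congr (_ *: _); rewrite -(prim_add l0 Lsrc Lf4); congr P.
    by rewrite yh yw /src scalerBr scaleNr addrAC.
  apply: filterS eq => s e Os; have := e Os; rewrite !fctE -/src => <-.
  by move: (P src s) (q s) => u v; rewrite /GRing.scale /=; ring.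
have PhfE : P (heat_flux y) = P q by exact: (prim_ae l0 (heat_flux_L2 y) Lq hfq).
pose src1 := lam *: P m + gamma *: q.
have Lsrc1 : LO src1 := L2_linear mO lam LPm (L2_scale mO fO gamma Lq).
have forceE : P (cg y + gamma *: heat_flux y) = P src1 + - lam *: P (cg f).
  have Lf2 := L2_scale mO fO (- lam) (cg_L2 f).
  rewrite -(prim_scale l0 (- lam) (cg_L2 f)) -(prim_add l0 Lsrc1 Lf2).
  apply: (prim_ae l0 (force_L2 y) (L2_add mO Lsrc1 Lf2)).
  apply: filterS hfq => s e Os; have {}e := e Os; rewrite /src1 yg !fctE e.
  by move: (P m s) (cg f s) (q s) => u v t; rewrite /GRing.scale /=; ring.
split.
- by rewrite yw xg; exact: ae_eq_refl.
- by rewrite xp xw yp.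
(* The constant collects the two means subtracted by [center]. *)
- exists (- ((\int[mu]_(s in Om) P src1 s) / l) - (\int[mu]_(s in Om) F1 s) / l).
  rewrite forceE; apply: (lebesgue_ae2 em zE) => s e1 e2 Os.
  have {}e1 := e1 Os; have {}e2 := e2 Os.
  rewrite /stress /end_trace xw yp e2 yw.
  move: e1; rewrite -/src1 /center /F1 /Fm !fctE /GRing.scale /=.
  move: (m s) (P src1 s) (\int[mu]_(s in _) _) (P (cg f) s) (cw f s) (F0 s) (\int[mu]_(s in _) _).
  move=> m' p c1 g w F c2; rewrite /b in bn0 *.
  have ln0' : l != 0 by rewrite gt_eqF.
  exact: stress_identity.
- exists (- ((\int[mu]_(s in Om) P q s) / l)).
  by rewrite PhfE xh; apply: aeW => s _; rewrite /center !fctE addrC.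
Qed.

Theorem graph_quasi_m_dissipative : quasi_m_dissipative data_ip graph growth_bound.
Proof.
split.
(* An arbitrary element of the graph minus itself. *)
- have [x hx] := graph_range 0 ltr01.
  by have := graph_linear (-1) hx hx; rewrite !scaleN1r !addNr.
- by move=> a x y x' y'; exact: graph_linear.
- by move=> x y y'; exact: graph_ext.
- by move=> x y; exact: graph_null.
- by rewrite divr_ge0 ?mulr_ge0 // ltW.
- by move=> x y; exact: graph_dissipative.
- by move=> h f; exact: graph_range.
Qed.
End DelayedGraph.

(** * Back to the state space *)

Lemma rect_ae2 (R : realType) (A B C : R * R -> Prop) :
  {ae ((@lebesgue_measure R) \x (@lebesgue_measure R))%E, forall z, A z} ->
  {ae ((@lebesgue_measure R) \x (@lebesgue_measure R))%E, forall z, B z} ->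
  (forall z, A z -> B z -> C z) ->
  {ae ((@lebesgue_measure R) \x (@lebesgue_measure R))%E, forall z, C z}.
Proof.
move=> hA hB ABC; move: hB; apply: filterS2; last exact: hA.
- exact: (ae_filter_ringOfSetsType (lebesgue_measure \x lebesgue_measure)%E).
- exact: ABC.
Qed.

Lemma primitiveB (R : realType) (E : lmodType R) (ip : E -> E -> R) (U W U' W' : R -> E) :
  semi_hilbert ip -> primitive ip U W -> primitive ip U' W' ->
  primitive ip (fun t => U t - U' t) (fun t => W t - W' t).
Proof.
move=> H pU pU' T e e0; have e2 : 0 < e / 2 by rewrite divr_gt0.
have [d d0 hd] := pU T (e / 2) e2; have [d' d'0 hd'] := pU' T (e / 2) e2.
exists (Num.min d d'); first by rewrite lt_min d0.
move=> a c b a0 ac cb bT; rewrite lt_min => /andP[ba ba'].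
have -> : W b - W' b - (W a - W' a) - (b - a) *: (U c - U' c) =
    (W b - W a - (b - a) *: U c) - (W' b - W' a - (b - a) *: U' c) by module_eq R.
have h1 := hd a c b a0 ac cb bT ba; have h2 := hd' a c b a0 ac cb bT ba'.
have := ler_hnormD H (W b - W a - (b - a) *: U c) (- (W' b - W' a - (b - a) *: U' c)).
rewrite (hnormN H) => /le_trans; apply; apply: le_trans (lerD h1 h2) _.
by rewrite -mulrDl -splitr.
Qed.

Section StateSpace.
Variables (R : realType) (alpha beta gamma kappa tau l xi : R).
Hypotheses (alpha0 : 0 < alpha) (beta0 : 0 < beta) (gamma0 : 0 < gamma)
  (kappa0 : 0 < kappa) (tau0 : 0 < tau) (l0 : 0 < l) (xi0 : 0 < xi).
Local Notation mu := (@lebesgue_measure R).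
Local Notation T := (measurableTypeR R).
Local Notation Om := (`]0, l[%classic : set T).
Local Notation I := (`]0, 1[%classic : set T).
Local Notation Q := (Om `*` I).
Local Notation mQ := (mu \x mu)%E.
Local Notation LQ := (L2 mQ Q).
Local Notation LO := (L2 mu Om).
Local Notation P := (prim l).
Local Notation ipO := (ipL mu Om).
Local Notation ipQ := (ipL mQ Q).
Local Notation D := (wderiv 0 l).
Local Notation data := (data l0).
Local Notation ip := (@data_ip R alpha beta tau l l0).
Local Notation N := (hnorm ip).
Local Notation graph := (@graph R alpha beta gamma kappa tau l l0).
Local Notation Heq := (Heq l).
Local Notation Hnorm := (Hnorm alpha l xi).
Local Notation inDA := (inDA alpha beta l).
Local Notation A := (A alpha beta gamma kappa tau l).
Let mO := mD l.
Let fO := fD l0.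
Let mI := mD (1 : R).
Let fI := fD (@ltr01 R).
Let mR : measurable Q := measurable_rect mO mI.
Let fR : (mQ Q < +oo)%E := finite_rect mO mI fO fI.
Local Hint Resolve mO fO mI fI mR fR : core.
Implicit Types (x y : data) (U V : @state R).

Lemma Heq_refl U : Heq U U.
Proof. by case: U => [[[f g] p] h]; split; exact: ae_eq_refl. Qed.

Lemma Heq_sym U V : Heq U V -> Heq V U.
Proof.
case: U V => [[[f g] p] h] [[[f' g'] p'] h'] [e1 e2 e3 e4].
by split; exact: ae_eq_sym.
Qed.

Lemma Heq_linear (a : R) U U' V V' : Heq U U' -> Heq V V' -> Heq (a *: U + V) (a *: U' + V').
Proof.
case: U U' V V' => [[[f1 g1] p1] h1] [[[f2 g2] p2] h2] [[[f3 g3] p3] h3] [[[f4 g4] p4] h4].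
move=> [e1 e2 e3 e4] [e1' e2' e3' e4']; split.
- by apply: (lebesgue_ae2 e1 e1') => s a1 a2 Os; rewrite -[LHS]/(a * f1 s + f3 s) -[RHS]/(a *
    f2 s + f4 s) a1 // a2.
- by apply: (lebesgue_ae2 e2 e2') => s a1 a2 Os; rewrite -[LHS]/(a * g1 s + g3 s) -[RHS]/(a *
    g2 s + g4 s) a1 // a2.
- by apply: (rect_ae2 e3 e3') => s a1 a2 Os; rewrite -[LHS]/(a * p1 s + p3 s) -[RHS]/(a * p2
    s + p4 s) a1 // a2.
- by apply: (lebesgue_ae2 e4 e4') => s a1 a2 Os; rewrite -[LHS]/(a * h1 s + h3 s) -[RHS]/(a *
    h2 s + h4 s) a1 // a2.
Qed.

Lemma Heq_trans U V W : Heq U V -> Heq V W -> Heq U W.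
Proof.
case: U V W => [[[f1 g1] p1] h1] [[[f2 g2] p2] h2] [[[f3 g3] p3] h3].
move=> [e1 e2 e3 e4] [e1' e2' e3' e4']; split.
- by apply: (lebesgue_ae2 e1 e1') => s a1 a2 Os; rewrite a1 // a2.
- by apply: (lebesgue_ae2 e2 e2') => s a1 a2 Os; rewrite a1 // a2.
- by apply: (rect_ae2 e3 e3') => s a1 a2 Os; rewrite a1 // a2.
- by apply: (lebesgue_ae2 e4 e4') => s a1 a2 Os; rewrite a1 // a2.
Qed.

Definition realize x : @state R := (P (cw x), cg x, cp x, ch x).

Lemma realize_linear : linear realize.
Proof.
by move=> a x y; rewrite /realize cw_linear cg_linear cp_linear ch_linear (prim_linear l0 a
    (cw_L2 x) (cw_L2 y)).
Qed.

Lemma H10_prim f w : LO f -> mean_zero l w -> f = P w %[ae mu in Om] -> H10 0 l f.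
Proof. by move=> Lf [Lw w0] fw; apply/(H10P l0); split => //; exists w. Qed.

Lemma wderiv_rep f w (k : R) : LO f -> LO w -> f = cst k + P w %[ae mu in Om] ->
  weak_derivative 0 l f w /\ LO (D f) /\ D f = w %[ae mu in Om].
Proof.
move=> Lf Lw fw; have wk := weak_prim l0 Lf Lw fw.
by have [[_ LD _] e] := wderivP l0 wk.
Qed.

Lemma wderiv_prim f w : LO f -> LO w -> f = P w %[ae mu in Om] ->
  weak_derivative 0 l f w /\ LO (D f) /\ D f = w %[ae mu in Om].
Proof.
move=> Lf Lw fw; apply: (@wderiv_rep f w 0) => //.
by apply: filterS fw => s e Os; rewrite e // !fctE add0r.
Qed.

Lemma realize_inH x : inH l (realize x).
Proof.
have [h1 h2] := ch_mean_zero x; split => //; [|exact: cg_L2|exact: cp_L2].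
by apply: (H10_prim _ (cw_mean_zero x)); [exact: (prim_L2 l0 (cw_L2 x))|exact: ae_eq_refl].
Qed.

Lemma inH_realize U : inH l U -> exists x, Heq U (realize x).
Proof.
case: U => [[[f g] p] h] [hf Lg Lp Lh h0].
have [Lf [w [Lw w0 fw]]] := (H10P l0 f).1 hf.
have [x [xw xg xp xh]] := data_exists l0 (conj Lw w0) Lg Lp (conj Lh h0); exists x.
by rewrite /realize xw xg xp xh; split => //; exact: ae_eq_refl.
Qed.

Lemma Heq_realize x y : Heq (realize x) (realize y) -> N (x - y) = 0.
Proof.
move=> [e1 e2 e3 e4]; have {}e1 : P (cw x) = P (cw y) %[ae mu in Om] := e1.
apply: data_null_ae => //.
have r1 : P (cw x) = cst 0 + P (cw x) %[ae mu in Om] by apply: aeW => s _; rewrite !fctE add0r.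
have r2 : P (cw x) = cst 0 + P (cw y) %[ae mu in Om].
  by apply: filterS e1 => s e Os; rewrite e // !fctE add0r.
by have [] := prim_rep_unique l0 (cw_L2 x) (cw_L2 y) r1 r2.
Qed.

Lemma inH_linear (a : R) U V : inH l U -> inH l V -> inH l (a *: U + V).
Proof.
case: U V => [[[f1 g1] p1] h1] [[[f2 g2] p2] h2] [F1 G1 P1 L1 I1] [F2 G2 P2 L2' I2].
have [hf1 hf2] := ((H10P l0 f1).1 F1, (H10P l0 f2).1 F2).
have [Lf1 [w1 [Lw1 w10 e1]]] := hf1; have [Lf2 [w2 [Lw2 w20 e2]]] := hf2.
have w0 := mean_zeroL l0 a (conj Lw1 w10) (conj Lw2 w20).
have h0 := mean_zeroL l0 a (conj L1 I1) (conj L2' I2).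
split; [|exact: (L2_linear mO a G1 G2)|exact: (L2_linear mR a P1 P2)|by case: h0|by case: h0].
apply: (H10_prim (L2_linear mO a Lf1 Lf2) w0); rewrite prim_linear //.
by apply: (lebesgue_ae2 e1 e2) => s a1 a2 Os; rewrite !fctE a1 // a2.
Qed.

(** [D] picks a weak derivative, determined only almost everywhere, so the form is evaluated through
    the coordinates of U. *)
Lemma Hip_realize U x : inH l U -> Heq U (realize x) ->
  Hip alpha l xi U U = alpha * ipO (cw x) (cw x) + ipO (cg x) (cg x) +
    xi * ipQ (cp x) (cp x) + ipO (ch x) (ch x).
Proof.
case: U => [[[f g] p] h] [hf Lg Lp Lh h0] [e1 e2 e3 e4].
have [Lf _] := (H10P l0 f).1 hf.
have [_ [LD De]] := wderiv_prim Lf (cw_L2 x) e1.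
rewrite /Hip -(ipL_rect mO mI Lp Lp).
rewrite -(ipL_ae mR Lp (cp_L2 x) Lp (cp_L2 x) e3 e3).
rewrite -(ipL_ae mO LD (cw_L2 x) LD (cw_L2 x) De De).
rewrite -(ipL_ae mO Lg (cg_L2 x) Lg (cg_L2 x) e2 e2).
rewrite -(ipL_ae mO Lh (ch_L2 x) Lh (ch_L2 x) e4 e4).
have I1 := L2_mul mO LD LD; have I2 := L2_mul mO Lg Lg; have I3 := L2_mul mO Lh Lh.
have I1' := integrableZl mO alpha I1.
have I12 := integrableD mO I1' I2.
rewrite [X in X + _ = _](_ : _ = alpha * ipO (D f) (D f) + ipO g g + ipO h h).
  by rewrite addrAC.
by rewrite RintegralD // RintegralD // RintegralZl.
Qed.

Lemma Hnorm_Heq U V : inH l U -> inH l V -> Heq U V -> Hnorm U = Hnorm V.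
Proof.
move=> HU HV UV; have [x hx] := inH_realize HU.
by rewrite /Hnorm (Hip_realize HU hx) (Hip_realize HV (Heq_trans (Heq_sym UV) hx)).
Qed.

(** Symmetric in xi and the delay weight, so one constant serves both norm comparisons: its square
    dominates 1 and both quotients. *)
Definition norm_ratio : R := 1 + xi / delay_weight alpha beta tau + delay_weight alpha beta
    tau / xi.

Let dw0 : 0 < delay_weight alpha beta tau.
Proof. exact: delay_weight_gt0. Qed.

Lemma norm_ratio_gt0 : 0 < norm_ratio.
Proof. by rewrite !addr_gt0 // divr_gt0. Qed.

Let weighted_le (a b u v t s : R) : 0 < a -> 0 < b -> 0 <= u -> 0 <= v -> 0 <= t -> 0 <= s ->
  u + v + a * t + s <= (1 + a / b + b / a) ^+ 2 * (u + v + b * t + s).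
Proof.
move=> a0 b0 u0 v0 t0 s0; set K := 1 + _ + _.
have ab : 0 < a / b by rewrite divr_gt0.
have ba : 0 < b / a by rewrite divr_gt0.
have K1 : 1 <= K by rewrite /K; lra.
have K2 : 1 <= K ^+ 2 by rewrite expr_ge1 // (le_trans ler01 K1).
have Kab : a / b <= K ^+ 2.
  apply: (@le_trans _ _ K); first by rewrite /K; lra.
  by rewrite expr2 ler_peMr // (le_trans ler01 K1).
have h (r : R) : 0 <= r -> r <= K ^+ 2 * r by move=> r0; rewrite ler_peMl.
rewrite !mulrDr; apply: lerD; [apply: lerD; [apply: lerD|]|]; try exact: h.
rewrite mulrA; apply: ler_wpM2r => //.
by rewrite -ler_pdivrMr.
Qed.

Lemma realize_norm_le x : Hnorm (realize x) <= norm_ratio * N x.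
Proof.
rewrite /Hnorm (Hip_realize (realize_inH x) (Heq_refl _)) /hnorm.
rewrite -[norm_ratio]ger0_norm ?(ltW norm_ratio_gt0) // -sqrtr_sqr -sqrtrM ?sqr_ge0 //.
apply: ler_wsqrtr; rewrite /data_ip /norm_ratio.
apply: weighted_le => //; rewrite ?mulr_ge0 ?ipL_ge0 // ltW //.
Qed.

Lemma realize_norm_ge x : N x <= norm_ratio * Hnorm (realize x).
Proof.
rewrite /Hnorm (Hip_realize (realize_inH x) (Heq_refl _)) /hnorm.
rewrite -[norm_ratio]ger0_norm ?(ltW norm_ratio_gt0) // -sqrtr_sqr -sqrtrM ?sqr_ge0 //.
apply: ler_wsqrtr; rewrite /data_ip /norm_ratio (addrAC 1).
apply: weighted_le => //; rewrite ?mulr_ge0 ?ipL_ge0 // ltW //.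
Qed.

Lemma trace_rep z w r : rho_data l z w r ->
  is_trace l z 1 (trace l z 1) /\
  trace l z 1 = (fun s => w s + \int[mu]_(t in I) r (s, t)) %[ae mu in Om].
Proof.
move=> h; have t1 := rho_trace1 l0 h.
have t2 : is_trace l z 1 (trace l z 1) by exact: (xgetPex (fun=> 0) (ex_intro _ _ t1)).
by split=> //; apply: (is_trace_unique _ t2 t1); rewrite ler01 lexx.
Qed.

Lemma wderiv_rho_rep z w r : rho_data l z w r ->
  weak_rho_derivative l z (wderiv_rho l z) /\ wderiv_rho l z = r %[ae mQ in Q].
Proof.
move=> h; have h1 := rho_weak l0 h.
have h2 : weak_rho_derivative l z (wderiv_rho l z) by exact: (xgetPex (fun=> 0) (ex_intro _ _ h1)).
split => //; have h3 := weak_rho_data h2 (rho_trace0 l0 h).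
by have [_] := rho_unique l0 h3 h (ae_eq_refl _ _ _).
Qed.

Lemma flux_rep v m z w r : LO v -> LO m -> v = P m %[ae mu in Om] -> rho_data l z w r ->
  LO (flux alpha beta l v z) /\
  flux alpha beta l v z =
    (fun s => alpha * (w s + \int[mu]_(t in I) r (s, t)) + beta * m s) %[ae mu in Om].
Proof.
move=> Lv Lm vm h; have [[Lt _] te] := trace_rep h.
have [_ [LD De]] := wderiv_prim Lv Lm vm; split.
  exact: (L2_linear mO alpha Lt (L2_scale mO fO beta LD)).
by apply: (lebesgue_ae2 te De) => s e1 e2 Os; rewrite /flux e1 // e2.
Qed.

(** Every primitive in [graph] exhibits a weak derivative. The Neumann conditions hold because
    theta_x is the primitive of a function of mean zero. *)
Lemma graph_inDA x y : graph x y ->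
  [/\ inDA (realize x), inH l (A (realize x)) & Heq (A (realize x)) (realize y)].
Proof.
move=> [h1 h2 [k3 h3] [k4 h4]].
have Lm := cw_L2 y; have Lw := cw_L2 x; have LPw := prim_L2 l0 Lw.
have Lhf := heat_flux_L2 gamma kappa y; have Lfo := force_L2 gamma kappa y.
have [Ls s0] := heat_source_mean_zero gamma y.
have [_ [LDu Due]] := wderiv_prim LPw Lw (ae_eq_refl _ _ _).
have [_ [LDv Dve]] := wderiv_prim (cg_L2 x) Lm h1.
have [wkth [LDth Dthe]] := wderiv_rep (ch_L2 x) Lhf h4.
have LQ2 := L2_scale mO fO kappa^-1 Ls.
have DthP : D (ch x) = P (kappa^-1 *: (ch y + gamma *: cw y)) %[ae mu in Om].
  by rewrite (prim_scale l0 kappa^-1 Ls).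
have [wkDth [LDDth DDthe]] := wderiv_prim LDth LQ2 DthP.
(* [inDA] states the trace condition with the chosen derivative [D (P (cw x))], which agrees with
   [cw x] only almost everywhere. *)
have h2' : rho_data l (cp x) (D (P (cw x))) (- tau *: cp y).
  apply: (rho_ae l0 h2 (cp_L2 x) LDu (L2_scale mR fR (- tau) (cp_L2 y))).
  - exact: ae_eq_refl.
  - exact: ae_eq_sym.
  - exact: ae_eq_refl.
have [Lfl fle] := flux_rep (cg_L2 x) Lm h1 h2.
have flP : flux alpha beta l (cg x) (cp x) = cst k3 + P (cg y + gamma *: heat_flux gamma
    kappa y) %[ae mu in Om].
  by apply: (lebesgue_ae2 fle h3) => s e1 e2 Os; rewrite e1 // -e2.
have [wkfl [LDfl Dfle]] := wderiv_rep Lfl Lfo flP.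
have [[_ Lr _] re] := wderiv_rho_rep h2.
have mean1 : \int[mu]_(s in Om) (kappa^-1 *: (ch y + gamma *: cw y)) s = 0.
  have := mean_zeroL l0 kappa^-1 (conj Ls s0) (mean_zero0 l0).
  by rewrite addr0 => -[].
have DthC : D (ch x) = cst 0 + P (kappa^-1 *: (ch y + gamma *: cw y)) %[ae mu in Om].
  by apply: filterS DthP => s e Os; rewrite e // !fctE add0r.
have A2 : (fun s => D (flux alpha beta l (cg x) (cp x)) s - gamma * D (ch x) s) = cg y %[ae
    mu in Om].
  apply: (lebesgue_ae2 Dfle Dthe) => s e1 e2 Os; rewrite e1 // e2 // !fctE.
  by rewrite /GRing.scale /= addrK.
have A4 : (fun s => - gamma * D (cg x) s + kappa * D (D (ch x)) s) = ch y %[ae mu in Om].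
  apply: (lebesgue_ae2 Dve DDthe) => s e1 e2 Os; rewrite e1 // e2 // !fctE /GRing.scale /=.
  by rewrite mulrA divff ?gt_eqF // mul1r mulNr addrCA addNr addr0.
have A3 : (fun q => - tau^-1 * wderiv_rho l (cp x) q) = cp y %[ae mQ in Q].
  apply: filterS re => s e Qs; rewrite e // !fctE /GRing.scale /=.
  by rewrite mulrA mulrNN mulVf ?mul1r // gt_eqF.
have LA2 : LO (fun s => D (flux alpha beta l (cg x) (cp x)) s - gamma * D (ch x) s).
  have := L2_linear mO (- gamma) LDth LDfl; congr (L2 _ _ _); apply/funext => s.
  by rewrite !fctE /GRing.scale /= mulNr addrC.
have LA4 : LO (fun s => - gamma * D (cg x) s + kappa * D (D (ch x)) s).
  exact: (L2_linear mO (- gamma) LDv (L2_scale mO fO kappa LDDth)).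
have H10v : H10 0 l (cg x) := H10_prim (cg_L2 x) (cw_mean_zero y) h1.
split.
- split; first exact: realize_inH.
  split; split.
  + by have [] := realize_inH x.
  + exact: H10v.
  + by exists (wderiv_rho l (cp x)); have [] := wderiv_rho_rep h2.
  + by split; [exists (heat_flux gamma kappa y)|exists (kappa^-1 *: (ch y + gamma *: cw y))].
  + exact: (rho_trace0 l0 h2').
  + by exists (cg y + gamma *: heat_flux gamma kappa y).
  + apply: (proj2 (@point_value_rep _ _ l0 _ _ _ 0 0 LQ2 DthC _)); first by rewrite lexx ltW.
    by rewrite prim0 addr0.
  + apply: (proj2 (@point_value_rep _ _ l0 _ _ _ l 0 LQ2 DthC _)); first by rewrite lexx ltW.
    by rewrite primc mean1 addr0.
- split.
  + exact: H10v.
  + exact: LA2.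
  + exact: (L2_scale mR fR (- tau^-1) Lr).
  + exact: LA4.
  + have [Lhy hy0] := ch_mean_zero y; rewrite -[RHS]hy0.
    exact: (ae_eq_Rintegral mO (L2_measurable mO LA4) (L2_measurable mO Lhy) A4).
- by split.
Qed.

(** Functions with weak derivatives are primitives up to constants. The Neumann condition at 0 kills
    the constant of theta_x; the one at l gives theta_xx mean zero, so that the last component of A
    U has mean zero. *)
Lemma inDA_graph U x : inDA U -> Heq U (realize x) ->
  exists2 y, graph x y & Heq (A U) (realize y).
Proof.
case: U => [[[u v] z] th] [[hu Lv0 Lz Lth th0] [[_ hv hz [hth hDth]] [t0 hfl pv0 pvl]]]
    [e1 e2 e3 e4].
have {}e1 : u = P (cw x) %[ae mu in Om] := e1.
have {}e2 : v = cg x %[ae mu in Om] := e2.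
have {}e3 : z = cp x %[ae mQ in Q] := e3.
have {}e4 : th = ch x %[ae mu in Om] := e4.
have [Lu _] := (H10P l0 u).1 hu.
have [_ [LDu Due]] := wderiv_prim Lu (cw_L2 x) e1.
have [Lv [m [Lm m0 vm]]] := (H10P l0 v).1 hv.
have [_ [LDv Dve]] := wderiv_prim Lv Lm vm.
have hr : weak_rho_derivative l z (wderiv_rho l z) by exact: (xgetPex (fun=> 0) hz).
have [_ Lr _] := hr.
have rd0 := weak_rho_data hr t0.
have rd : rho_data l z (cw x) (wderiv_rho l z).
  by apply: (rho_ae l0 rd0 Lz (cw_L2 x) Lr); [exact: ae_eq_refl|exact: Due|exact: ae_eq_refl].
have [Lfl fle] := flux_rep Lv Lm vm rd.
have [g1 hg1] := hfl; have [[_ Ls _] _] := wderivP l0 hg1.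
have wks : weak_derivative 0 l (flux alpha beta l v z) (D (flux alpha beta l v z)) by exact:
    (wderivP l0 hg1).1.
have [k3 fl3] := weak_rep l0 wks.
have [g2 hg2] := hth; have wkq : weak_derivative 0 l th (D th) by exact: (wderivP l0 hg2).1.
have [_ Lq _] := wkq; have [k4 th4] := weak_rep l0 wkq.
have [g3 hg3] := hDth; have wkq2 : weak_derivative 0 l (D th) (D (D th)) by exact: (wderivP
    l0 hg3).1.
have [_ Lq2 _] := wkq2; have [k5 q5] := weak_rep l0 wkq2.
have k50 : k5 = 0.
  have := proj1 (@point_value_rep _ _ l0 _ _ _ 0 0 Lq2 q5 _) pv0.
  by rewrite lexx ltW // prim0 addr0 => /(_ isT) <-.
have q20 : \int[mu]_(s in Om) D (D th) s = 0.
  have := proj1 (@point_value_rep _ _ l0 _ _ _ l 0 Lq2 q5 _) pvl.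
  by rewrite lexx ltW // primc k50 add0r => /(_ isT) <-.
pose g' := - gamma *: D th + D (flux alpha beta l v z).
have Lg' : LO g' := L2_linear mO (- gamma) Lq Ls.
pose h' := - gamma *: m + kappa *: D (D th).
have h'0 : mean_zero l h'.
  apply: mean_zeroL => //; have := mean_zeroL l0 kappa (conj Lq2 q20) (mean_zero0 l0).
  by rewrite addr0.
have Lp' := L2_scale mR fR (- tau^-1) Lr.
have [y [yw yg yp yh]] := data_exists l0 (conj Lm m0) Lg' Lp' h'0.
have hfE : heat_flux gamma kappa y = P (D (D th)).
  have -> : heat_flux gamma kappa y = kappa^-1 *: P (kappa *: D (D th)).
    congr (_ *: P _); rewrite yh yw /h'; apply/funext => s; rewrite !fctE.
    by rewrite scaleNr addrAC addNr add0r.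
  by rewrite (prim_scale l0 kappa Lq2) scalerA mulVf ?scale1r // gt_eqF.
have hfq : heat_flux gamma kappa y = D th %[ae mu in Om].
  by rewrite hfE; apply: filterS q5 => s e Os; rewrite e // k50 !fctE add0r.
have Lhf := heat_flux_L2 gamma kappa y; have Lfo := force_L2 gamma kappa y.
have ypE : - tau *: cp y = wderiv_rho l z.
  by rewrite yp scalerA mulrNN mulfV ?scale1r // gt_eqF.
exists y.
- split.
  + by rewrite yw; apply: (lebesgue_ae2 e2 vm) => s a1 a2 Os; rewrite -a1 // a2.
  + rewrite ypE; apply: (rho_ae l0 rd (cp_L2 x) (cw_L2 x) Lr e3); exact: ae_eq_refl.
  + exists k3; rewrite (prim_ae l0 Lfo Ls); last first.
      by apply: filterS hfq => s e Os; rewrite !fctE e // yg /g' !fctE scaleNr addrAC addNr add0r.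
    by apply: (lebesgue_ae2 fle fl3) => s a1 a2 Os; rewrite /stress /end_trace ypE yw -a1 // a2.
  + exists k4; rewrite (prim_ae l0 Lhf Lq hfq).
    by apply: (lebesgue_ae2 e4 th4) => s a1 a2 Os; rewrite -a1 // a2.
- rewrite /realize yw yg yp yh; split => //=.
  + by apply: aeW => s _; rewrite /g' !fctE /GRing.scale /= mulNr addrC.
  + exact: ae_eq_refl.
  + by apply: filterS Dve => s e Os; rewrite /h' e // !fctE.
Qed.

HB.instance Definition _ :=
  GRing.isLinear.Build R data (@state R) _ realize realize_linear.

Lemma HeqB U U' V V' : Heq U U' -> Heq V V' -> Heq (U - V) (U' - V').
Proof.
move=> h h'; rewrite (addrC U) (addrC U') -!(scaleN1r V) -!(scaleN1r V').
exact: Heq_linear.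
Qed.

Lemma HeqD U U' V V' : Heq U U' -> Heq V V' -> Heq (U + V) (U' + V').
Proof. by move=> h h'; rewrite -[U]scale1r -[U']scale1r; exact: Heq_linear. Qed.

Lemma inHB U V : inH l U -> inH l V -> inH l (U - V).
Proof. by move=> h h'; rewrite addrC -(scaleN1r V); exact: inH_linear. Qed.

Let state_sum_recr n (a : nat -> R) (F : nat -> @state R) :
  \sum_(i < n.+1) a i *: F i = a n *: F n + \sum_(i < n) a i *: F i.
Proof. by rewrite big_ord_recr addrC. Qed.

Lemma inH_sum n (a : nat -> R) (F : nat -> @state R) :
  (forall i, (i < n)%N -> inH l (F i)) -> inH l (\sum_(i < n) a i *: F i).
Proof.
elim: n => [|n IH] h.
  by rewrite big_ord0 -(linear0 realize); exact: realize_inH.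
rewrite state_sum_recr; apply: inH_linear; first exact: h.
by apply: IH => i hi; apply: h; exact: ltnW.
Qed.

Lemma Heq_sum n (a : nat -> R) (F G : nat -> @state R) :
  (forall i, (i < n)%N -> Heq (F i) (G i)) ->
  Heq (\sum_(i < n) a i *: F i) (\sum_(i < n) a i *: G i).
Proof.
elim: n => [|n IH] h; first by rewrite !big_ord0; exact: Heq_refl.
rewrite !state_sum_recr.
by apply: Heq_linear; [exact: h|apply: IH => i hi; apply: h; exact: ltnW].
Qed.

Lemma Hnorm_ge0 U : 0 <= Hnorm U. Proof. exact: sqrtr_ge0. Qed.

Let H := data_semi_hilbert alpha0 beta0 tau0 l0.
Let HG := graph_quasi_m_dissipative alpha0 beta0 gamma0 kappa0 tau0 l0.

(** [Hnorm_Heq] concerns members of H, which is why both curves are assumed to stay there. *)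
Lemma continuous_curve_Heq (X Y : R -> @state R) :
  (forall t, 0 <= t -> inH l (X t)) -> (forall t, 0 <= t -> inH l (Y t)) ->
  (forall t, 0 <= t -> Heq (X t) (Y t)) ->
  continuous_curve Hnorm X -> continuous_curve Hnorm Y.
Proof.
move=> hX hY XY /(continuous_curveP Hnorm_ge0) cX; apply/(continuous_curveP Hnorm_ge0) => t e t0 e0.
have [d d0 hd] := cX t e t0 e0; exists d; [exact: d0|move=> s s0 st].
rewrite -(Hnorm_Heq (inHB (hX s s0) (hX t t0)) (inHB (hY s s0) (hY t t0)) (HeqB (XY s s0) (XY
    t t0))).
exact: hd.
Qed.

Lemma is_integral_Heq (X Y : R -> @state R) (t : R) (W Z : @state R) :
  (forall t, 0 <= t -> inH l (X t)) -> (forall t, 0 <= t -> inH l (Y t)) ->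
  (forall t, 0 <= t -> Heq (X t) (Y t)) -> inH l W -> inH l Z -> Heq W Z ->
  is_integral Hnorm X t W -> is_integral Hnorm Y t Z.
Proof.
move=> hX hY XY hW hZ WZ hI e e0; have [d d0 hd] := hI e e0; exists d;
    [exact: d0|move=> n s c s0 sn sc].
have s_ge0 i : (i <= n)%N -> 0 <= s i.
  elim: i => [|i IH] hi; first by rewrite s0.
  by have [a b _] := sc i hi; apply: le_trans (le_trans a b); exact: IH (ltnW hi).
have c_ge0 i : (i < n)%N -> 0 <= c i.
  by move=> hi; have [a _ _] := sc i hi; apply: le_trans a; exact: s_ge0 (ltnW hi).
pose a i := s i.+1 - s i.
have h1 := inH_sum (n := n) a (fun i hi => hX (c i) (c_ge0 i hi)).
have h2 := inH_sum (n := n) a (fun i hi => hY (c i) (c_ge0 i hi)).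
have h3 := Heq_sum (n := n) a (fun i hi => XY (c i) (c_ge0 i hi)).
rewrite -(Hnorm_Heq (inHB h1 hW) (inHB h2 hZ) (HeqB h3 WZ)).
exact: hd.
Qed.

Lemma realize_null x y : N (x - y) = 0 -> Heq (realize x) (realize y).
Proof.
move=> /(data_null alpha0 beta0 tau0)[e1 e2 e3 e4]; split => //=.
by rewrite (prim_ae l0 (cw_L2 x) (cw_L2 y) e1); exact: ae_eq_refl.
Qed.

(** Coordinates of V t and of its integral are chosen separately at each time; equivalence of the
    norms makes the latter a primitive of the former. *)
Lemma solution_data (U0 : @state R) x0 (V : R -> @state R) : Heq U0 (realize x0) ->
  solution alpha beta gamma kappa tau l xi U0 V ->
  exists X W : R -> data, [/\ forall t, 0 <= t -> Heq (V t) (realize (X t)),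
    primitive ip X W, N (W 0) = 0 & forall t, 0 <= t -> graph (W t) (X t - x0)].
Proof.
move=> h0 [VH cV hV].
have hx t : exists x, 0 <= t -> Heq (V t) (realize x).
  have [t0|t0] := pselect (0 <= t); last by exists 0.
  by have [x hx] := inH_realize (VH t t0); exists x.
have [X hX] := choice hx.
have XH t : 0 <= t -> inH l (realize (X t)) by move=> _; exact: realize_inH.
have hw t : exists w, 0 <= t -> is_integral Hnorm (fun t => realize (X t)) t (realize w) /\
    graph w (X t - x0).
  have [t0|t0] := pselect (0 <= t); last by exists 0.
  have [W [IW WA VW]] := hV t t0.
  have WH : inH l W by case: W WA {IW VW} => [[[? ?] ?] ?] [].
  have [w hw] := inH_realize WH; have [y Gy Ay] := inDA_graph WA hw.
  exists w => _; split; first exact: (is_integral_Heq VH XH hX WH (realize_inH w) hw IW).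
  apply: (gr_ext HG Gy); apply: Heq_realize; rewrite linearB.
  apply: Heq_trans (Heq_sym Ay) _; apply: Heq_trans _ (HeqB (hX t t0) h0).
  (* V t = U0 + A W up to [Heq] is read as A W = V t - U0. *)
  rewrite -[A W](addKr U0) [_ + (U0 + _)]addrC.
  by apply: HeqB; [exact: Heq_sym|exact: Heq_refl].
have [W hW] := choice hw.
have cX := curve_ucontinuous H Hnorm_ge0 norm_ratio_gt0 realize_norm_ge (fun t _ => erefl)
  (continuous_curve_Heq VH XH hX cV).
have [pX W0] := integral_primitive H norm_ratio_gt0 realize_norm_ge (X := fun t => realize (X t))
  (Y := fun t => realize (W t)) (fun t _ => erefl) (fun t _ => erefl) cX (fun t t0 => (hW t t0).1).
by exists X, W; split; [exact: hX|exact: pX|exact: W0|move=> t t0; have [] := hW t t0].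
Qed.

(** In coordinates, the difference of two solutions is a mild solution with zero datum. *)
Lemma solution_unique (U0 : @state R) (U V : R -> @state R) : inH l U0 ->
  solution alpha beta gamma kappa tau l xi U0 U ->
  solution alpha beta gamma kappa tau l xi U0 V ->
  forall t, 0 <= t -> Heq (U t) (V t).
Proof.
move=> hU0 sU sV t t0; have [x0 h0] := inH_realize hU0.
have [X [W [hX pX W0 GX]]] := solution_data h0 sU.
have [Y [Z [hY pY Z0 GY]]] := solution_data h0 sV.
apply: Heq_trans (hX t t0) _; apply: Heq_trans _ (Heq_sym (hY t t0)).
have WZ0 : N (W 0 - Z 0) = 0.
  apply/eqP; rewrite eq_le hnorm_ge0 andbT.
  by have := ler_hnormB H (W 0) 0 (Z 0); rewrite subr0 sub0r (hnormN H) W0 Z0 addr0.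
have GXY s : 0 <= s -> graph (W s - Z s) (X s - Y s).
  move=> s0; have -> : X s - Y s = X s - x0 - (Y s - x0) by module_eq R.
  exact: (grB HG (GX s s0) (GY s s0)).
exact: realize_null (mild_unique H HG (primitiveB H pX pY) WZ0 GXY t0).
Qed.

Lemma solution_exists (U0 : @state R) : inH l U0 -> exists U : R -> @state R,
  solution alpha beta gamma kappa tau l xi U0 U /\
  (inDA U0 -> continuous_in_DA alpha beta gamma kappa tau l xi U /\ C1_in_H alpha l xi U).
Proof.
move=> hU0; have [x0 h0] := inH_realize hU0.
have [X [W [cX pX W0 GX hG]]] := generation H HG x0.
exists (fun t => realize (X t)); split.
  split.
  - by move=> t _; exact: realize_inH.
  - exact: (ucontinuous_curve Hnorm_ge0 norm_ratio_gt0 realize_norm_le cX).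
  move=> t t0; exists (realize (W t)); have [WA _ AW] := graph_inDA (GX t t0); split; [|exact: WA|].
  - exact: (primitive_integral H norm_ratio_gt0 realize_norm_le pX W0 t0).
  have XE : realize (X t) = realize x0 + realize (X t - x0).
    by rewrite -linearD; congr realize; module_eq R.
  by apply: Heq_sym; rewrite XE; exact: HeqD.
move=> U0A; have [y0 Gy0 _] := inDA_graph U0A h0.
have [X' [cX' pX' GX']] := hG y0 Gy0.
have DX := primitive_derivative H Hnorm_ge0 norm_ratio_gt0 realize_norm_le pX'.
have CX' := ucontinuous_curve Hnorm_ge0 norm_ratio_gt0 realize_norm_le cX'.
have CX := ucontinuous_curve Hnorm_ge0 norm_ratio_gt0 realize_norm_le cX.
split.
  split; first by move=> t t0; have [] := graph_inDA (GX' t t0).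
  apply/continuous_curveP; first by move=> U; rewrite addr_ge0 ?Hnorm_ge0.
  move=> t e t0 e0; have e2 : 0 < e / 2 by rewrite divr_gt0.
  have [d1 d10 h1] := (continuous_curveP Hnorm_ge0 _).1 CX t (e / 2) t0 e2.
  have [d2 d20 h2] := (continuous_curveP Hnorm_ge0 _).1 CX' t (e / 2) t0 e2.
  exists (Num.min d1 d2); first by rewrite lt_min d10.
  move=> s s0; rewrite lt_min => /andP[st1 st2].
  (* [A] is built from chosen derivatives and need not be linear on representatives. Linearity of
     [graph] gives A (U s - U t) = U' s - U' t up to [Heq]. *)
  have [_ AH AE] := graph_inDA (grB HG (GX' s s0) (GX' t t0)).
  rewrite /graph_norm.
  have := h1 s s0 st1; have := h2 s s0 st2; rewrite -!linearB.
  rewrite (Hnorm_Heq AH (realize_inH _) AE).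
  by move: (Hnorm _) (Hnorm _) => a b; lra.
split; first by move=> t _; exact: realize_inH.
exists (fun t => realize (X' t)); split; [|exact: DX|exact: CX'].
by move=> t _; exact: realize_inH.
Qed.

End StateSpace.

Theorem theorem2p3 (R : realType) (alpha beta gamma kappa tau l xi : R)
    (halpha : 0 < alpha) (hbeta : 0 < beta) (hgamma : 0 < gamma)
    (hkappa : 0 < kappa) (htau : 0 < tau) (hl : 0 < l) (hxi : 0 < xi)
    (U0 : @state R) (hU0 : inH l U0) :
  exists U : R -> @state R,
    [/\ solution alpha beta gamma kappa tau l xi U0 U,
        (forall V : R -> @state R,
           solution alpha beta gamma kappa tau l xi U0 V ->
           forall t : R, 0 <= t -> Heq l (U t) (V t)) &
        (inDA alpha beta l U0 ->
           continuous_in_DA alpha beta gamma kappa tau l xi U /\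
           C1_in_H alpha l xi U)].
Proof.
have [U [sU hU]] := solution_exists halpha hbeta hgamma hkappa htau hl hxi hU0.
exists U; split; [exact: sU| |exact: hU].
move=> V sV; exact: (solution_unique halpha hbeta hgamma hkappa htau hl hxi hU0 sU sV).
Qed.
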